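(* Let $n \geq 2$. For all but finitely many (isomorphism classes of) cubic regular $(n+1)$-toroids $\mathcal{T}$ there exists a chiral abstract $(n+2)$-polytope all of whose facets are isomorphic to $\mathcal{T}$.
   Context: An abstract $d$-polytope is a ranked poset with a minimum and maximum face, all flags (maximal chains) having $d+2$ elements, which is strongly flag-connected and satisfies the diamond condition; its facets are its faces of rank $d-1$ (viewed as $(d-1)$-polytopes). A polytope is chiral if its automorphism group has exactly two orbits on flags with adjacent flags in different orbits. A cubic $(n+1)$-toroid is the quotient $\mathcal{U}/\Lambda$ of the cubic tessellation $\mathcal{U}=\{4,3^{n-2},4\}$ of Euclidean $n$-space by a group of translations generated by $n$ linearly independent translations preserving $\mathcal{U}$; it is regular if its automorphism group acts transitively on its flags. Up to isomorphism the cubic regular $(n+1)$-toroids are exactly the toroids $\{4,3^{n-2},4\}_{(a^k,0^{n-k})}$ with $a$ a positive integer and $k\in\{1,2,n\}$, i.e. the quotients by the translation lattices $a\mathbb{Z}^n$ ($k=1$), $a\{x\in\mathbb{Z}^n : \sum x_i \text{ even}\}$ ($k=2$), and $a\{x\in\mathbb{Z}^n : \text{all } x_i \text{ of the same parity}\}$ ($k=n$). *)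

(* Defs.v *)
From HB Require Import structures.
From mathcomp Require Import all_boot all_order all_algebra.
From mathcomp Require Import boolp classical_sets cardinality reals.

Set Implicit Arguments.
Unset Strict Implicit.
Unset Printing Implicit Defensive.

Import Order.TTheory GRing.Theory Num.Theory.
Local Open Scope classical_set_scope.
Local Open Scope card_scope.
Local Open Scope order_scope.

Section Posets.
Context {d : Order.disp_t} {P : porderType d}.
Implicit Types (x y : P) (Phi Psi : set P).

Definition chain Phi := total_on Phi (fun x y => x <= y).

Definition flag Phi :=
  chain Phi /\ forall Psi, chain Psi -> Phi `<=` Psi -> Psi `<=` Phi.

Definition adjacent Phi Psi :=
  (exists x, Phi `\` Psi = [set x]) /\ (exists y, Psi `\` Phi = [set y]).

Inductive flag_path (A : set P) : set P -> set P -> Prop :=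
| flag_path_refl Phi : flag Phi -> A `<=` Phi -> flag_path A Phi Phi
| flag_path_step Phi Psi Om : flag Phi -> A `<=` Phi -> adjacent Phi Psi ->
    flag_path A Psi Om -> flag_path A Phi Om.

Definition strongly_flag_connected :=
  forall Phi Psi, flag Phi -> flag Psi -> flag_path (Phi `&` Psi) Phi Psi.

Definition covers x y := x < y /\ forall z, ~~ (x < z < y).

Definition automorphism (f : P -> P) :=
  bijective f /\ {mono f : x y / x <= y}.

Definition flag_orbit Phi : set (set P) :=
  [set Psi | exists2 f, automorphism f & Psi = f @` Phi].

Definition regular :=
  forall Phi Psi, flag Phi -> flag Psi -> flag_orbit Phi Psi.

Definition chiral :=
  [set flag_orbit Phi | Phi in flag] #= `I_2 /\
  forall Phi Psi, flag Phi -> flag Psi -> adjacent Phi Psi ->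
    ~ flag_orbit Phi Psi.

End Posets.
Arguments strongly_flag_connected {d} P.
Arguments regular {d} P.
Arguments chiral {d} P.

Definition isomorphic {d d' : Order.disp_t}
    (P : porderType d) (Q : porderType d') : Prop :=
  exists f : P -> Q, bijective f /\ {mono f : x y / x <= y}.

(* The section G/F; the facet F, viewed as a polytope, is section \bot F. *)
Definition section {d : Order.disp_t} {P : porderType d} (F G : P) : Type :=
  {x : P | F <= x <= G}.

HB.instance Definition _ (d : Order.disp_t) (P : porderType d) (F G : P) :=
  SubType.on (section F G).
HB.instance Definition _ (d : Order.disp_t) (P : porderType d) (F G : P) :=
  [Choice of section F G by <:].
HB.instance Definition _ (d : Order.disp_t) (P : porderType d) (F G : P) :=
  [SubChoice_isSubPOrder of section F G by <: with d].

Record polytope (r : nat) := Polytope {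
  polytope_disp : Order.disp_t;
  polytope_face :> tbPOrderType polytope_disp;
  rank : polytope_face -> int;
  rank_bot : rank \bot = (-1)%R;
  rank_lt : {homo rank : F G / F < G >-> (F < G)%R};
  rank_covers : forall F G : polytope_face,
    covers F G -> rank G = (rank F + 1)%R;
  flag_card : forall Phi : set polytope_face, flag Phi -> Phi #= `I_r.+2;
  polytope_sfc : strongly_flag_connected polytope_face;
  diamond : forall F G : polytope_face, F < G -> rank G = (rank F + 2)%R ->
    [set H : polytope_face | F < H < G] #= `I_2
}.

Definition facet (r : nat) (P : polytope r) (F : P) : Prop :=
  rank F = (r%:Z - 1)%R.

Local Open Scope ring_scope.

Section CubicToroids.
Context {R : realType} {n : nat}.
Local Notation V := 'rV[R]_n.
Implicit Types (t : V) (X Y : set V) (B : 'M[R]_n).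

Definition cube (a : 'rV[int]_n) (S : {set 'I_n}) : set V :=
  [set x : V | forall i, if i \in S
                     then (a 0 i)%:~R <= x 0 i <= (a 0 i + 1)%:~R
                     else x 0 i == (a 0 i)%:~R].

(* The faces of {4,3^(n-2),4}, ordered by inclusion; the empty set and the
   whole space are its improper faces, of rank -1 and n + 1. *)
Definition tessellation : set (set V) :=
  [set X | [\/ X = set0, exists a S, X = cube a S | X = setT]].

Definition translate t X : set V := [set x + t | x in X].

(* The group of translations generated by the rows of B. *)
Definition lattice B : set V :=
  [set map_mx intr z *m B | z in [set: 'rV[int]_n]].

Definition cubic_lattice B : Prop :=
  row_free B /\ forall i, translate (row i B) @` tessellation = tessellation.

Definition lattice_orbit B X : set (set V) :=
  [set translate t X | t in lattice B].

(* Faces of the quotient are orbits of faces of the tessellation, two orbits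
   being incident when they have incident representatives. *)
Definition toroid B : Type := {O | O \in lattice_orbit B @` tessellation}.

HB.instance Definition _ B := SubType.on (toroid B).
HB.instance Definition _ B := [Choice of toroid B by <:].

Definition toroid_le B (O O' : toroid B) : bool :=
  `[< exists X Y, [/\ val O X, val O' Y & X `<=` Y] >].

Lemma lattice0 B : lattice B 0.
Proof. by exists 0 => //; rewrite map_mx0 mul0mx. Qed.

Lemma latticeB B s t : lattice B s -> lattice B t -> lattice B (s - t).
Proof.
by move=> [x _ <-] [y _ <-]; exists (x - y) => //; rewrite map_mxB mulmxBl.
Qed.

Lemma translate0 X : translate 0 X = X.
Proof.
apply/seteqP; split=> [_ [y Xy <-]|x Xx]; first by rewrite addr0.
by exists x => //; rewrite addr0.
Qed.

Lemma translateD s t X : translate (s + t) X = translate t (translate s X).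
Proof.
apply/seteqP; split=> [_ [y Xy <-]|_ [_ [y Xy <-] <-]].
  by exists (y + s); [exists y | rewrite addrA].
by exists y; rewrite ?addrA.
Qed.

Lemma translateS t X Y : X `<=` Y -> translate t X `<=` translate t Y.
Proof. by move=> XY _ [x Xx <-]; exists x => //; apply: XY. Qed.

Lemma translate_face_id t X :
  tessellation X -> translate t X `<=` X -> translate t X = X.
Proof.
case=> [->|[a [S ->]]|->] XX; first by rewrite /translate image_set0.
  suff -> : t = 0 by rewrite translate0.
  pose lo : V := map_mx intr a.
  pose hi : V := \row_i (a 0 i + (i \in S)%:R)%:~R.
  have lo_in : cube a S lo.
    by move=> i; rewrite mxE; case: ifP => // _; rewrite lexx ler_int lerDl.
  have hi_in : cube a S hi.
    move=> i; rewrite mxE; case: (i \in S); last by rewrite addr0 eqxx.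
    by rewrite lexx ler_int lerDl ler01.
  apply/rowP => i; rewrite mxE.
  have := XX _ (imageP _ lo_in) i; have := XX _ (imageP _ hi_in) i.
  rewrite !mxE; case: (i \in S).
    case/andP=> _ tle /andP[tge _]; apply/le_anti.
    by move: tge tle; rewrite lerDl gerDl => -> ->.
  by move=> _ /eqP/(canRL (addKr _)); rewrite addNr.
apply/seteqP; split=> // x _.
by exists (x - t) => //; rewrite subrK.
Qed.

Lemma orbitP B X Y Z : lattice_orbit B X Y -> lattice_orbit B X Z ->
  exists2 t, lattice B t & Z = translate t Y.
Proof.
move=> [s Bs <-] [t Bt <-]; exists (t - s); first exact: latticeB.
by rewrite -translateD addrC subrK.
Qed.

Lemma orbit_tessellation B (O : toroid B) :
  exists2 X, tessellation X & val O = lattice_orbit B X.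
Proof. by have := valP O; rewrite inE => -[X tX <-]; exists X. Qed.

Lemma orbit_self B X : lattice_orbit B X X.
Proof. by exists 0; [exact: lattice0 | rewrite translate0]. Qed.

Lemma orbit_eq B X Y Z : lattice_orbit B X Z -> lattice_orbit B Y Z ->
  lattice_orbit B X = lattice_orbit B Y.
Proof.
suff H X' Y' : lattice_orbit B X' Z -> lattice_orbit B Y' Z ->
    lattice_orbit B X' `<=` lattice_orbit B Y'.
  by move=> XZ YZ; apply/seteqP; split; apply: H.
move=> XZ [t Bt tZ] W /(orbitP XZ)[s Bs ->]; rewrite -tZ -translateD.
exists (t + s) => //.
by rewrite -[s]opprK -[- s]sub0r; do 2!apply: latticeB => //; exact: lattice0.
Qed.

Lemma toroid_le_refl B : reflexive (@toroid_le B).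
Proof.
move=> O; apply/asboolP; have [X _ ->] := orbit_tessellation O.
by exists X, X; split=> //; apply: orbit_self.
Qed.

Lemma toroid_le_anti B : antisymmetric (@toroid_le B).
Proof.
move=> O O' /andP[/asboolP[X1 [Y1 [+ + XY]]] /asboolP[Y2 [X2 [+ + YX]]]].
have [X tX OX] := orbit_tessellation O; have [Y tY OY] := orbit_tessellation O'.
rewrite OX OY => XX1 YY1 YY2 XX2; apply: val_inj; rewrite OX OY.
have [t Bt eY] := orbitP YY1 YY2.
have [s Bs eX] := orbitP (orbit_self B X) XX2.
have [u Bu eX1] := orbitP (orbit_self B X) XX1.
have sub1 : translate t X1 `<=` Y2 by rewrite eY; apply: translateS.
have Xsub : translate t X1 `<=` X2 by exact: subset_trans sub1 YX.
have eq1 : translate (u + t - s) X = X.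
  apply: translate_face_id => //.
  have := @translateS (- s) _ _ Xsub.
  by rewrite eX1 eX -!translateD subrr translate0 addrA.
have eq2 : translate t X1 = X2.
  rewrite eX -[in RHS]eq1 -translateD subrK eX1 translateD //.
have eYX : Y2 = X2 by apply/seteqP; split=> //; rewrite -eq2.
by apply: (@orbit_eq _ _ _ X2) => //; rewrite -eYX.
Qed.

Lemma toroid_le_trans B : transitive (@toroid_le B).
Proof.
move=> O2 O1 O3 /asboolP[X1 [Y1 [+ + XY]]] /asboolP[Y2 [Z2 [+ + YZ]]].
have [Y _ ->] := orbit_tessellation O2.
have [Z _ eZ] := orbit_tessellation O3; rewrite eZ => XX1 YY1 YY2 [u Bu eZ2].
have [t Bt eY] := orbitP YY2 YY1.
apply/asboolP; exists X1, (translate t Z2); rewrite eZ; split=> //.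
  rewrite -eZ2 -translateD; exists (u + t) => //.
  by rewrite -[t]opprK -[- t]sub0r; do 2!apply: latticeB => //; exact: lattice0.
by apply: subset_trans XY _; rewrite eY; apply: translateS.
Qed.

Fact toroid_display : Order.disp_t. Proof. exact: Order.Disp tt tt. Qed.

HB.instance Definition _ B := Order.Le_isPOrder.Build toroid_display (toroid B)
  (@toroid_le_refl B) (@toroid_le_anti B) (@toroid_le_trans B).

Definition toroid_face B X (tX : tessellation X) : toroid B :=
  Sub (lattice_orbit B X) (mem_set (imageP (lattice_orbit B) tX)).

Definition toroid_bot B : toroid B := toroid_face B (Or31 _ _ (erefl set0)).
Definition toroid_top B : toroid B := toroid_face B (Or33 _ _ (erefl setT)).

Lemma toroid_le0 B (O : toroid B) : (toroid_bot B <= O)%O.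
Proof.
have [X _ eO] := orbit_tessellation O; apply/asboolP; exists set0, X.
by rewrite eO; split; [exact: orbit_self | exact: orbit_self | exact: sub0set].
Qed.

Lemma toroid_le1 B (O : toroid B) : (O <= toroid_top B)%O.
Proof.
have [X _ eO] := orbit_tessellation O; apply/asboolP; exists X, setT.
by rewrite eO; split; [exact: orbit_self | exact: orbit_self | exact: subsetT].
Qed.

HB.instance Definition _ B :=
  Order.hasBottom.Build toroid_display (toroid B) (@toroid_le0 B).
HB.instance Definition _ B :=
  Order.hasTop.Build toroid_display (toroid B) (@toroid_le1 B).

End CubicToroids.

(* Main.v *)
(** A regular polytope [T] whose facets serve as colours, together with an
    edge-coloured graph, yields a polytope of rank one higher with one facet [T]
    for each vertex of the graph: two copies of [T] are glued along their facet
    [c] when the vertices are joined by an edge of colour [c].  Its flags are the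
    pairs of a flag of [T] and a vertex.  Taking a bipartite graph built from a
    voltage assignment in a power of a finite group indexed by the automorphisms
    of [T], every even automorphism of [T] extends preserving the two sides, every
    odd one extends exchanging them, and the colour preserving automorphisms are
    transitive on each side.  Hence there are at most two flag orbits, and there
    are two as soon as some word in the colours is a closed walk from the vertices
    of one side only.

    Such a word exists when [T] has three facets in general position: put
    generators [a], [c] of the affine group of the line over 'F_5, where
    [a c a^-1 = c^2], on two of them and the unit on all other facets; a suitable
    commutator word in [a] and [c] is trivial but its mirror image is not.

    For a toroid, the automorphisms lift to the affine maps of the tessellation as
    soon as no nonzero translation has all its coordinates in {-1, 0, 1}, and three
    cubes of different mutual distances are in general position if the lattice has
    no short vectors.  A regular toroid violating one of the two conditions has a
    lattice containing m Z^n, where m depends on n only, and there are finitely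
    many such lattices. *)

From HB Require Import structures.
Require Import Defs.
From mathcomp Require Import all_boot all_order all_algebra all_fingroup.
From mathcomp Require Import boolp classical_sets cardinality reals.
From mathcomp Require Import zify ring.

Set Implicit Arguments.
Unset Strict Implicit.
Unset Printing Implicit Defensive.

Import Order.TTheory GRing.Theory Num.Theory.
Local Open Scope classical_set_scope.
Local Open Scope card_scope.
Local Open Scope order_scope.

(** * Flags and graded posets *)

(** The index set of the power is what makes every automorphism of [T] extend: coordinate [g] of a
    vertex records the voltages of the colours as seen through [g], so an automorphism permutes the
    coordinates, up to an exchange of the sides and a constant factor. The price is that a closed
    word must be trivial in all coordinates at once, that is for the images of the three chosen
    facets under every automorphism; the conditions of general position come from there. Along a
    walk the voltages enter alternately as themselves and inverted, so a word started on the other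
    side evaluates with all its generators inverted, which replaces the multiplier 2 by its inverse.
    The prime 5 is the smallest odd one modulo which 2 differs from its inverse. On the geometric
    side coordinates are doubled: a cell is the integral vector of twice its centre, and flags
    become signed permutations with an even translation. Regularity of the toroid serves a second
    time, to spread one short lattice vector to a multiple of every basis vector. *)

Lemma card_set2P (T : Type) (A : set T) :
  A #= `I_2 <-> exists x y, x <> y /\ A = [set x; y].
Proof.
split=> [/card_set_bijP[f [fA finj fsurj]]|[x [y [xy ->]]]].
  have [x Ax fx] := fsurj 0%N isT; have [y Ay fy] := fsurj 1%N isT.
  exists x, y; split=> [exy|]; first by move: fx; rewrite exy fy.
  apply/seteqP; split=> [z Az|z [->|->]//].
  have := fA z Az; rewrite /= ltnS leq_eqVlt ltnS leqn0 => /orP[]/eqP fz.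
    by right; apply: finj; rewrite ?inE// fz.
  by left; apply: finj; rewrite ?inE// fz.
apply/card_set_bijP; exists (fun z => if `[< z = x >] then 0%N else 1%N); split.
- by move=> z _ /=; case: asboolP.
- by move=> z t; rewrite !inE => -[]-> []->; do 2!case: asboolP => //.
- case=> [|[|//]] _; first by exists x; [left|case: asboolP].
  by exists y; [right|case: asboolP => // /esym].
Qed.

Section Flags.
Context {d : Order.disp_t} {P : porderType d}.
Implicit Types (x y : P) (Phi Psi : set P).

Lemma chain_sub_flag Phi : chain Phi -> exists2 Psi, flag Psi & Phi `<=` Psi.
Proof.
(* Adding [Phi] to every member lets the empty family, whose union is empty, satisfy the hypothesis
   of Zorn's lemma. *)
move=> cPhi; pose C X := chain (X `|` Phi).
have totC (F : set (set P)) : F `<=` C -> total_on F subset ->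
    C (\bigcup_(X in F) X).
  move=> FP totF x y [[X FX Xx]|Px] [[Y FY Yy]|Py].
  - have [XY|YX] := totF _ _ FX FY.
      by apply: (FP _ FY); left => //; apply: XY.
    by apply: (FP _ FX); left => //; apply: YX.
  - by apply: (FP _ FX); [left|right].
  - by apply: (FP _ FY); [right|left].
  - exact: cPhi.
have [A [cA maxA]] := Zorn_bigcup totC.
exists (A `|` Phi); last by move=> x; right.
split=> // Psi cPsi sPsi x Psix; left; apply: contrapT => nAx.
apply: (maxA Psi); last first.
  by rewrite /C setUidl // => y Py; apply: sPsi; right.
by split=> [|/(_ _ Psix)//]; apply: subset_trans sPsi => y; left.
Qed.

Lemma flag_mem Phi x : flag Phi -> (forall y, Phi y -> x <= y \/ y <= x) ->
  Phi x.
Proof.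
move=> [cPhi maxPhi] cx; apply: (maxPhi (x |` Phi)); last by left.
  move=> y z [->|Py] [->|Pz]; rewrite ?lexx; first by left.
  - exact: cx.
  - by have [] := cx y Py; [right|left].
  - exact: cPhi.
by move=> y; right.
Qed.

Lemma flag_eq Phi Psi : flag Phi -> flag Psi -> Phi `<=` Psi -> Phi = Psi.
Proof.
by move=> [_ mPhi] [cPsi _] sub; apply/seteqP; split=> //; apply: mPhi.
Qed.

Lemma flag_pathA (A : set P) Phi Psi Om :
  flag_path A Phi Psi -> flag_path A Psi Om -> flag_path A Phi Om.
Proof.
by elim=> [//|{}Phi {}Psi X fP AP aP _ IH] /IH; apply: flag_path_step.
Qed.

Lemma flag_path_sub (A B : set P) Phi Psi : A `<=` B ->
  flag_path B Phi Psi -> flag_path A Phi Psi.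
Proof.
move=> AB; elim=> [X fX BX|X Y Z fX BX aX _ IH].
  by apply: flag_path_refl => //; apply: subset_trans BX.
by apply: flag_path_step aX IH => //; apply: subset_trans BX.
Qed.

Lemma automorphism_comp (f g : P -> P) :
  automorphism f -> automorphism g -> automorphism (f \o g).
Proof.
move=> [bf mf] [bg mg]; split; first exact: bij_comp.
by move=> x y /=; rewrite mf mg.
Qed.

Lemma automorphism_inv (f : P -> P) : automorphism f ->
  exists g, [/\ automorphism g, cancel f g & cancel g f].
Proof.
move=> [[g fg gf] mf]; exists g; split=> //; split; first by exists f.
by move=> x y; rewrite -[x in RHS]gf -[y in RHS]gf mf.
Qed.

Lemma automorphism_id : automorphism (@id P).
Proof. by split=> //; exists id. Qed.

Lemma automorphism_lt (f : P -> P) : automorphism f ->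
  {mono f : x y / x < y}.
Proof. by move=> [_ mf]; apply: leW_mono. Qed.

Lemma automorphism_flag (f : P -> P) Phi :
  automorphism f -> flag Phi -> flag (f @` Phi).
Proof.
move=> af [cPhi maxPhi]; have [g [[bg mg] fg gf]] := automorphism_inv af.
have [_ mf] := af.
split=> [_ _ [x Px <-] [y Py <-]|Psi cPsi sPsi y Psiy].
  by rewrite !mf; apply: cPhi.
exists (g y) => //; apply: (maxPhi (g @` Psi)); last by exists y.
  by move=> _ _ [x Px <-] [z Pz <-]; rewrite !mg; apply: cPsi.
by move=> x Px; exists (f x) => //; apply: sPsi; exists x.
Qed.

Lemma automorphism_adjacent (f : P -> P) Phi Psi : automorphism f ->
  adjacent Phi Psi -> adjacent (f @` Phi) (f @` Psi).
Proof.
move=> [/bij_inj fi _]; suff H (X Y : set P) :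
    (exists x, X `\` Y = [set x]) ->
    (exists x, f @` X `\` f @` Y = [set x]) by case=> /H ? /H.
move=> [x e]; have [Xx nYx] : (X `\` Y) x by rewrite e.
exists (f x); apply/seteqP; split=> [_ [[y Xy <-] nY]|_ ->].
  congr f; suff : (X `\` Y) y by rewrite e.
  by split=> // Yy; apply: nY; exists y.
by split=> [|[y Yy /fi eyx]]; [exists x | apply: nYx; rewrite -eyx].
Qed.

Lemma flag_orbit_sym Phi Psi : flag_orbit Phi Psi -> flag_orbit Psi Phi.
Proof.
move=> [f /automorphism_inv[g [ag fg gf]] ->]; exists g => //.
apply/seteqP; split=> [x Px|_ [_ [x Px <-] <-]]; last by rewrite fg.
by exists (f x); rewrite ?fg //; exists x.
Qed.

Lemma flag_orbit_trans Phi Psi Om :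
  flag_orbit Phi Psi -> flag_orbit Psi Om -> flag_orbit Phi Om.
Proof.
move=> [f af ->] [g ag ->]; exists (g \o f); first exact: automorphism_comp.
by rewrite -image_comp.
Qed.

End Flags.

Section Graded.
Context {d : Order.disp_t} {P : tbPOrderType d} (rk : P -> int) (r : nat).
Hypothesis rk_bot : rk \bot = (-1)%R.
Hypothesis rk_top : rk \top = r%:Z%R.
Hypothesis rk_lt : {homo rk : F G / F < G >-> (F < G)%R}.
Hypothesis rk_covers : forall F G : P, covers F G -> rk G = (rk F + 1)%R.
Implicit Types (F G H : P) (Phi Psi : set P).

Lemma flag_bot Phi : flag Phi -> Phi \bot.
Proof. by move=> fPhi; apply: flag_mem => // y _; left; rewrite le0x. Qed.

Lemma flag_top Phi : flag Phi -> Phi \top.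
Proof. by move=> fPhi; apply: flag_mem => // y _; right; rewrite lex1. Qed.

Lemma rk_le F G : F <= G -> (rk F <= rk G)%R.
Proof. by rewrite le_eqVlt => /orP[/eqP->//|/rk_lt/ltW]. Qed.

Lemma rk_eq F G : F <= G -> rk F = rk G -> F = G.
Proof. by rewrite le_eqVlt => /orP[/eqP//|/rk_lt +] e; rewrite e ltxx. Qed.

Lemma rk_ge F : (-1 <= rk F)%R.
Proof. by rewrite -rk_bot rk_le ?le0x. Qed.

Lemma rk_le_top F : (rk F <= r%:Z)%R.
Proof. by rewrite -rk_top rk_le ?lex1. Qed.

Lemma rk_between F G : F < G -> (rk F + 1 < rk G)%R -> exists H, F < H < G.
Proof.
move=> FG rkFG; apply: contrapT => nH.
have /rk_covers e : covers F G.
  by split=> // H; apply/negP => FHG; apply: nH; exists H.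
by move: rkFG; rewrite e ltxx.
Qed.

Lemma flag_rk_inj Phi F G : flag Phi -> Phi F -> Phi G -> rk F = rk G -> F = G.
Proof.
by move=> [cPhi _] PF PG e; have [/rk_eq->//|/rk_eq->//] := cPhi F G PF PG.
Qed.

Lemma flag_rk_le Phi F G : flag Phi -> Phi F -> Phi G ->
  (rk F <= rk G)%R -> F <= G.
Proof.
move=> [cPhi _] PF PG e; have [//|le] := cPhi F G PF PG.
by rewrite (rk_eq le) //; apply/eqP; rewrite eq_le e rk_le.
Qed.

Lemma flag_rk_lt Phi F G : flag Phi -> Phi F -> Phi G ->
  (rk F < rk G)%R -> F < G.
Proof.
move=> fPhi PF PG e; rewrite lt_neqAle (flag_rk_le fPhi) ?ltW // andbT.
by apply: contraTneq e => ->; rewrite ltxx.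
Qed.

(** Otherwise take the face [F] of the flag of largest rank below [k] and the face [G] of smallest
    rank above [k]. Their ranks differ by more than one, so some [H] lies strictly between; it is
    comparable with the whole flag, hence belongs to it, against the choice of [F] or [G]. *)
Lemma flag_rank Phi (k : int) : flag Phi -> (-1 <= k <= r%:Z)%R ->
  exists2 F, Phi F & rk F = k.
Proof.
move=> fPhi /andP[k_ge k_le]; apply: contrapT => nk.
have {}nk F : Phi F -> rk F != k.
  by move=> PF; apply/eqP => e; apply: nk; exists F.
(* Ranks are shifted by one to become natural numbers, so that [ex_maxnP] and [ex_minnP] provide the
   extremal faces. *)
pose lo m := `[< exists F, [/\ Phi F, (rk F < k)%R & rk F + 1 = m%:Z]%R >].
pose hi m := `[< exists F, [/\ Phi F, (k < rk F)%R & rk F + 1 = m%:Z]%R >].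
have lo0 : exists m, lo m.
  exists 0%N; apply/asboolP; exists \bot; have Pb := flag_bot fPhi.
  by split=> //; rewrite ?rk_bot // lt_neqAle -rk_bot nk //= rk_bot.
have hi0 : exists m, hi m.
  exists r.+1; apply/asboolP; exists \top; have Pt := flag_top fPhi.
  split=> //; last by rewrite rk_top intS addrC.
  by rewrite lt_neqAle eq_sym nk // rk_top.
have lo_ub m : lo m -> (m <= r.+1)%N.
  by case/asboolP=> F [_ _ e]; have := rk_le_top F; lia.
have [m /asboolP[F [PF Fk eF]] maxF] := ex_maxnP lo0 lo_ub.
have [p /asboolP[G [PG Gk eG]] minG] := ex_minnP hi0.
have FG : F < G by apply: (flag_rk_lt fPhi) => //; apply: lt_trans Gk.
have [|H /andP[FH HG]] := rk_between FG; first by lia.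
have rkFH := rk_lt FH; have rkHG := rk_lt HG.
have PH : Phi H.
  apply: flag_mem => // X PX; have rX := rk_ge X.
  have [Xk|kX|/eqP] := ltgtP (rk X) k; last by rewrite (negPf (nk _ PX)).
    right; apply: le_trans (ltW FH); apply: (flag_rk_le fPhi) => //.
    have : lo `|(rk X + 1)%R|%N by apply/asboolP; exists X; split=> //; lia.
    by move/maxF; lia.
  left; apply: le_trans (ltW HG) _; apply: (flag_rk_le fPhi) => //.
  have : hi `|(rk X + 1)%R|%N by apply/asboolP; exists X; split=> //; lia.
  by move/minG; lia.
have rH := rk_ge H; have /eqP := nk _ PH.
have [Hk|kH|//] := ltgtP (rk H) k.
  have : lo `|(rk H + 1)%R|%N by apply/asboolP; exists H; split=> //; lia.
  by move/maxF; lia.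
have : hi `|(rk H + 1)%R|%N by apply/asboolP; exists H; split=> //; lia.
by move/minG; lia.
Qed.

Lemma graded_flag_card Phi : flag Phi -> Phi #= `I_r.+2.
Proof.
move=> fPhi; apply/card_set_bijP; exists (fun F => `|(rk F + 1)%R|%N); split.
- by move=> F _ /=; have := rk_ge F; have := rk_le_top F; lia.
- move=> F G; rewrite !inE => PF PG e; apply: (flag_rk_inj fPhi) => //.
  by have := rk_ge F; have := rk_ge G; lia.
- move=> m /= m_lt; have [|F PF eF] := @flag_rank Phi (m%:Z - 1)%R fPhi.
    by lia.
  by exists F => //; rewrite eF; lia.
Qed.

Lemma mem_flag F : exists2 Phi, flag Phi & Phi F.
Proof.
have [|Phi fPhi sPhi] := @chain_sub_flag _ P [set F].
  by move=> x y -> ->; left.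
by exists Phi => //; apply: sPhi.
Qed.

Lemma chain_flag Phi : chain Phi ->
  (forall k, (-1 <= k <= r%:Z)%R -> exists2 F, Phi F & rk F = k) -> flag Phi.
Proof.
move=> cPhi rkPhi; split=> // Psi cPsi sPsi F PsiF.
have [|G PG eG] := rkPhi (rk F); first by rewrite rk_ge rk_le_top.
by have [/rk_eq->|/rk_eq<-] := cPsi F G PsiF (sPsi _ PG).
Qed.

Lemma rk_lower F : F != \bot -> exists2 H, H < F & rk H = (rk F - 1)%R.
Proof.
move=> Fn; have [Phi fPhi PF] := mem_flag F.
have rF : (-1 < rk F)%R by rewrite -rk_bot rk_lt // lt0x.
have [|H PH eH] := @flag_rank Phi (rk F - 1)%R fPhi.
  by have := rk_le_top F; lia.
by exists H => //; apply: (flag_rk_lt fPhi) => //; lia.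
Qed.

(** Descending from [F] one rank at a time shows that an automorphism cannot lower a rank; the
    inverse automorphism gives the other inequality. *)
Lemma automorphism_rk f F : automorphism f -> rk (f F) = rk F.
Proof.
have le g G : automorphism g -> (rk G <= rk (g G))%R.
  move=> ag; have [m em] : exists m : nat, (rk G + 1 = m%:Z)%R.
    by exists `|(rk G + 1)%R|%N; have := rk_ge G; lia.
  elim: m G em => [|m IH] G eG; first by have := rk_ge (g G); lia.
  have [|H HG eH] := @rk_lower G.
    by apply: contra_eq_neq eG => ->; rewrite rk_bot.
  have := IH H; rewrite eH => /(_ _); have := @rk_lt (g H) (g G).
  by rewrite (automorphism_lt ag) HG; lia.
move=> af; have [g [ag fg gf]] := automorphism_inv af.
by apply/le_anti/andP; split; [rewrite -[F in leRHS]fg; apply: le | apply: le].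
Qed.

Lemma adjacent_rk Phi Psi F G : flag Phi -> flag Psi ->
  Phi `\` Psi = [set F] -> Psi `\` Phi = [set G] -> rk F = rk G.
Proof.
move=> fPhi fPsi eF eG; have [PF nPF] : (Phi `\` Psi) F by rewrite eF.
have [|H PH eH] := @flag_rank Psi (rk F) fPsi.
  by rewrite rk_ge rk_le_top.
have [PhiH|nPhiH] := pselect (Phi H).
  by case: nPF; rewrite (flag_rk_inj fPhi PF PhiH).
by have -> : G = H; [suff : (Psi `\` Phi) H by rewrite eG|].
Qed.

End Graded.


Section Polytopes.
Context (r : nat) (T : polytope r).
Implicit Types (F G H c : T) (Phi Psi : set T).

(** The record prescribes only the rank of [\bot]; that of [\top] is read off from the size of a
    flag. A negative rank would force [\top = \bot] and flags with a single face. *)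
Lemma rank_top : rank (\top : T) = r%:Z%R.
Proof.
have [Phi fPhi _] := @chain_sub_flag _ T set0 (fun x y (h : set0 x) => False_ind _ h).
have := flag_card fPhi; have := rk_ge (@rank_bot _ T) (@rank_lt _ T) \top.
case e : (rank _) => [m|m] m_ge.
  move: (graded_flag_card (@rank_bot _ T) e (@rank_lt _ T) (@rank_covers _ T) fPhi).
  by move=> cm cr; move: cm; rewrite (card_eql cr) => /card_eq_II[->].
have tb : (\top : T) = \bot.
  apply/eqP; apply: contraTT isT => tb.
  have := @rank_lt _ T \bot \top; rewrite lt0x tb e (@rank_bot _ T) => /(_ isT).
  by move: m_ge; rewrite NegzE; lia.
have -> : Phi = [set \bot].
  apply/seteqP; split=> [F _|_ ->]; last exact: flag_bot.
  by apply/eqP; rewrite eq_le le0x andbT -tb lex1.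
by rewrite (card_eql card_set1) => /card_eq_II.
Qed.

Local Notation rb := (@rank_bot _ T).
Local Notation rl := (@rank_lt _ T).
Local Notation rc := (@rank_covers _ T).

Lemma polytope_flag_rank Phi (k : int) : flag Phi -> (-1 <= k <= r%:Z)%R ->
  exists2 F, Phi F & rank F = k.
Proof. exact: (flag_rank rb rank_top rl rc). Qed.

Lemma polytope_aut_rank f F : automorphism f -> rank (f F) = rank F.
Proof. exact: (automorphism_rk rb rank_top rl rc). Qed.

Lemma diamond_third F G x y z : rank G = (rank F + 2)%R ->
  F < x < G -> F < y < G -> F < z < G -> x <> y -> x <> z -> y = z.
Proof.
move=> rFG hx hy hz; have FG : F < G by case/andP: hx; apply: lt_trans.
have /card_set2P[a [b [_ e]]] := diamond FG rFG.
have mem t : F < t < G -> t = a \/ t = b.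
  by move=> ht; have : [set H | F < H < G] t by []; rewrite e.
by have [] := mem _ hx; have [] := mem _ hy; have [] := mem _ hz;
   do 3!move=> ->.
Qed.

(** The faces just below and just above the exchanged face are common to both flags, hence fixed. By
    the diamond condition only [x] and [y] lie between them, and [f] fixes [x]. *)
Lemma adjacent_fix f Phi Psi : automorphism f -> flag Phi -> flag Psi ->
  adjacent Phi Psi -> (forall F, Phi F -> f F = F) -> forall F, Psi F -> f F = F.
Proof.
move=> af fPhi fPsi [[x ex] [y ey]] fix_Phi F PF.
have [PhiF|nPhiF] := pselect (Phi F); first exact: fix_Phi.
have -> : F = y by suff : (Psi `\` Phi) F by rewrite ey.
have [Phix nPsix] : (Phi `\` Psi) x by rewrite ex.
have [Psiy nPhiy] : (Psi `\` Phi) y by rewrite ey.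
have PhiPsi G : Phi G -> rank G <> rank x -> Psi G.
  move=> PG nG; apply: contrapT => nPG; apply: nG.
  by have -> : G = x by suff : (Phi `\` Psi) G by rewrite ex.
have rxy := adjacent_rk rb rank_top rl rc fPhi fPsi ex ey.
have rx_gt : (-1 < rank x)%R.
  rewrite -(@rank_bot _ T) rank_lt // lt0x; apply: contra_notN nPsix => /eqP->.
  exact: flag_bot.
have rx_lt : (rank x < r%:Z)%R.
  rewrite -rank_top rank_lt // ltx1; apply: contra_notN nPsix => /eqP->.
  exact: flag_top.
have [|A PhiA rA] := @polytope_flag_rank Phi (rank x - 1)%R fPhi; first by lia.
have [|B PhiB rB] := @polytope_flag_rank Phi (rank x + 1)%R fPhi; first by lia.
have PsiA : Psi A by apply: PhiPsi => //; lia.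
have PsiB : Psi B by apply: PhiPsi => //; lia.
have Ax : A < x by apply: (flag_rk_lt rl fPhi) => //; lia.
have xB : x < B by apply: (flag_rk_lt rl fPhi) => //; lia.
have Ay : A < y by apply: (flag_rk_lt rl fPsi) => //; lia.
have yB : y < B by apply: (flag_rk_lt rl fPsi) => //; lia.
have xy : x <> y by move=> e; apply: nPsix; rewrite e.
apply/esym; apply: (@diamond_third A B x); rewrite ?Ax ?Ay //; first by lia.
  by rewrite -[A]fix_Phi // -[B]fix_Phi // !(automorphism_lt af) Ay.
rewrite -[x]fix_Phi // => /(bij_inj af.1); exact: xy.
Qed.

Lemma automorphism_fix f Phi : automorphism f -> flag Phi ->
  (forall F, Phi F -> f F = F) -> f =1 id.
Proof.
move=> af fPhi fixPhi F.
have [Psi fPsi PF] := @mem_flag _ T F.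
have path := polytope_sfc fPhi fPsi.
suff: forall A X Y, flag_path A X Y -> (forall F, X F -> f F = F) ->
    flag Y -> forall F, Y F -> f F = F.
  by move/(_ _ _ _ path fixPhi fPsi); apply.
move=> A X Y; elim=> [//|X' Y' Z' fX' _ adj pY' IH] fixX' /[dup] fZ /IH; apply.
suff fY' : flag Y' by exact: adjacent_fix adj fixX'.
by case: pY'.
Qed.

End Polytopes.

(** * The extension of a polytope by a coloured graph *)

Section Walks.
Context (r : nat) (T : polytope r) (Z : Type) (step : T -> Z -> Z).
Implicit Types (F G c : T) (z : Z) (w : seq T).

Definition walk F w := forall c, c \in w -> facet c /\ F <= c.

(** The copies of [T] placed at the vertices of [component F z] are those that share the face [F]
    after gluing: only colours that contain [F] are crossed. *)
Definition component F z : set Z :=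
  [set z' | exists2 w, walk F w & z' = foldr step z w].

Lemma component_refl F z : component F z z.
Proof. by exists [::]. Qed.

Lemma component_trans F x y z :
  component F x y -> component F y z -> component F x z.
Proof.
move=> [v wv ->] [w ww ->]; exists (w ++ v); last by rewrite foldr_cat.
by move=> c; rewrite mem_cat => /orP[/ww|/wv].
Qed.

Lemma component_step F c z : facet c -> F <= c -> component F z (step c z).
Proof. by move=> fc Fc; exists [:: c] => // x; rewrite inE => /eqP->. Qed.

Lemma component_mono F G z : F <= G -> component G z `<=` component F z.
Proof.
move=> FG _ [w ww ->]; exists w => // c /ww[fc Gc]; split=> //.
exact: le_trans Gc.
Qed.

Lemma component_symm F x z :
  (forall c, facet c -> involutive (step c)) ->
  component F x z -> component F z x.
Proof.
move=> stepK [w ww ->]; exists (rev w); first by move=> c; rewrite mem_rev => /ww.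
elim: w ww => [//|c w IH] ww /=; rewrite rev_cons -cats1 foldr_cat /=.
rewrite stepK; last by have [] := ww c (mem_head _ _).
by apply: IH => d dw; apply: ww; rewrite inE dw orbT.
Qed.

Lemma component_top z : component \top z = [set z].
Proof.
apply/seteqP; split=> [_ [[|c w] ww ->//]|_ ->]; last exact: component_refl.
have [|fc] := ww c; first by rewrite inE eqxx.
rewrite le1x => /eqP e; move: fc; rewrite /facet e rank_top; lia.
Qed.

End Walks.

(* The parity makes every [step c] fixed point free. *)
Record cgraph (r : nat) (T : polytope r) := CGraph {
  vertex :> Type;
  step : T -> vertex -> vertex;
  parity : vertex -> bool;
  root : vertex;
  stepK : forall c, facet c -> involutive (step c);
  parity_step : forall c z, facet c -> parity (step c z) = ~~ parity z;
  connected : forall z, component step \bot root z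
}.

Section Extension.
Context (r : nat) (T : polytope r) (Z : cgraph T).
Implicit Types (F G H c : T) (z : Z) (C : set Z).
Local Notation comp := (component (@step _ _ Z)).

Lemma component_sym F x z : comp F x z -> comp F z x.
Proof. by apply: component_symm => c; exact: stepK. Qed.

Lemma component_eq F x z : comp F x z -> comp F x = comp F z.
Proof.
move=> xz; apply/seteqP; split=> y; apply: component_trans => //.
exact: component_sym.
Qed.

Lemma component_bot x z : comp \bot x z.
Proof. exact: component_trans (component_sym (connected x)) (connected z). Qed.

Lemma facet_le c F : facet c -> facet F -> c <= F -> F = c.
Proof.
move=> fc fF cF; apply/esym/eqP; apply: contraT => ne.
have := @rank_lt _ T c F; rewrite lt_neqAle ne cF fc fF => /(_ isT); lia.
Qed.

(** No other facet lies above [c], so [c] is the only colour available, and its step is an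
    involution. *)
Lemma component_facet c z : facet c -> comp c z = [set z; step c z].
Proof.
move=> fc; apply/seteqP; split=> [_ [w ww ->]|_ [->|->]]; last 2 first.
- exact: component_refl.
- exact: component_step.
elim: w ww => [|d w IH] ww /=; first by left.
have [|fd cd] := ww d; first by rewrite inE eqxx.
rewrite (facet_le fc fd cd); have [|->|->] := IH.
- by move=> x xw; apply: ww; rewrite inE xw orbT.
- by right.
- by left; rewrite (stepK fc).
Qed.

Lemma step_neq c z : facet c -> step c z <> z.
Proof. by move=> fc e; have := parity_step z fc; rewrite e; case: parity. Qed.

(** A face of [T] is paired with the set of vertices whose copies share it; [(\top, set0)] is the
    new greatest face. The empty set is contained in every component, so ordering by reverse
    inclusion needs no special case. *)
Definition ext_faces : set (T * set Z) :=
  [set p | p = (\top, set0) \/ exists z, p.2 = comp p.1 z].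

Definition ext : Type := {p | p \in ext_faces}.
HB.instance Definition _ := SubType.on ext.
HB.instance Definition _ := [Choice of ext by <:].

Definition ext_le (p q : ext) : bool :=
  ((val p).1 <= (val q).1) && `[< (val q).2 `<=` (val p).2 >].

Lemma ext_le_refl : reflexive ext_le.
Proof. by move=> p; rewrite /ext_le lexx; apply/asboolP. Qed.

Lemma ext_le_anti : antisymmetric ext_le.
Proof.
move=> p q /andP[/andP[pq /asboolP qp2] /andP[qp /asboolP pq2]].
apply: val_inj; case: (val p) (val q) pq qp2 qp pq2 => [F C] [G D] /= FG DC GF CD.
by congr pair; [apply/le_anti; rewrite FG | apply/seteqP].
Qed.

Lemma ext_le_trans : transitive ext_le.
Proof.
move=> q p t /andP[pq /asboolP qp2] /andP[qt /asboolP tq2].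
by apply/andP; split; [exact: le_trans qt | apply/asboolP; exact: subset_trans qp2].
Qed.

Fact ext_display : Order.disp_t. Proof. exact: Order.Disp tt tt. Qed.

HB.instance Definition _ := Order.Le_isPOrder.Build ext_display ext
  ext_le_refl ext_le_anti ext_le_trans.

Definition cell F z : ext :=
  Sub (F, comp F z) (mem_set (or_intror (ex_intro _ z erefl))).

Definition ext_top : ext := Sub (\top, set0) (mem_set (or_introl erefl)).

Lemma cell_le F G x z : (cell F x <= cell G z) <-> (F <= G /\ comp F x z).
Proof.
rewrite [in X in X <-> _]/Order.le /= /ext_le /=; split.
  by move=> /andP[FG /asboolP sub]; split=> //; apply/sub/component_refl.
move=> [FG xz]; rewrite FG /=; apply/asboolP; rewrite (component_eq xz).
exact: component_mono.
Qed.

Lemma cell_eq F x z : comp F x z -> cell F x = cell F z.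
Proof. by move=> /component_eq e; apply: val_inj; rewrite /= e. Qed.

Lemma cell_inj F G x z : cell F x = cell G z -> F = G /\ comp F x z.
Proof.
by move=> e; case: (congr1 val e) => -> e2; split=> //; rewrite e2; exact: component_refl.
Qed.

Lemma ext_bot_le p : cell \bot (root Z) <= p.
Proof.
apply/andP; split; first exact: le0x.
by apply/asboolP => x _; apply: component_bot.
Qed.

Lemma ext_top_le p : p <= ext_top.
Proof. by apply/andP; split; [exact: lex1 | apply/asboolP]. Qed.

HB.instance Definition _ := Order.hasBottom.Build ext_display ext ext_bot_le.
HB.instance Definition _ := Order.hasTop.Build ext_display ext ext_top_le.

Variant ext_spec : ext -> Type :=
| ExtTop : ext_spec \top
| ExtCell F z : ext_spec (cell F z).

Lemma extP p : ext_spec p.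
Proof.
have [->|ne] := pselect (p = \top); first by constructor.
have /cid[z ez] : exists z, p = cell (val p).1 z.
  have := valP p; rewrite inE => -[e|[z ez]].
    by case: ne; apply: val_inj.
  by exists z; apply: val_inj; rewrite /= -ez; exact: surjective_pairing.
by rewrite ez; constructor.
Qed.

Lemma cell_neq_top F z : cell F z <> \top.
Proof.
move=> /(congr1 val)[_ e]; have : comp F z z by exact: component_refl.
by rewrite e.
Qed.

Lemma cell_lt_top F z : cell F z < \top.
Proof. by rewrite ltx1; apply/eqP/cell_neq_top. Qed.

Lemma cell_lt F G x z : (cell F x < cell G z) <-> (F < G /\ comp F x z).
Proof.
rewrite lt_neqAle; split=> [/andP[ne /cell_le[FG xz]]|[FG xz]].
  split=> //; rewrite lt_neqAle FG andbT; apply: contra_neq ne => e.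
  by rewrite -e; apply: cell_eq.
apply/andP; split; last by apply/cell_le; split=> //; exact: ltW.
by apply: contraTneq FG => /cell_inj[-> _]; rewrite ltxx.
Qed.

(** The second summand lifts the new greatest face to rank [r.+1], one above the facets
    [cell \top z]. *)
Definition ext_rank (p : ext) : int :=
  (rank (val p).1 + `[< (val p).2 = set0 >]%:Z)%R.

Lemma ext_rank_cell F z : ext_rank (cell F z) = rank F.
Proof.
rewrite /ext_rank /=; case: asboolP => [e|_]; last by rewrite addr0.
by have := component_refl (@step _ _ Z) F z; rewrite e.
Qed.

Lemma ext_rank_top : ext_rank \top = r.+1%:Z%R.
Proof. by rewrite /ext_rank /= asboolT // rank_top -addn1 PoszD. Qed.

Lemma ext_rank_bot : ext_rank \bot = (-1)%R.
Proof. by rewrite ext_rank_cell (@rank_bot _ T). Qed.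

Lemma ext_rank_lt : {homo ext_rank : p q / p < q >-> (p < q)%R}.
Proof.
move=> p q; case: (extP p) => [|F x]; first by rewrite (le_gtF (lex1 q)).
case: (extP q) => [_|G z /cell_lt[FG _]]; last by rewrite !ext_rank_cell rank_lt.
rewrite ext_rank_cell ext_rank_top -addn1 PoszD -(rank_top T).
have := rk_le (@rank_lt _ T) (lex1 F); lia.
Qed.

Lemma ext_rank_covers (p q : ext) : covers p q -> ext_rank q = (ext_rank p + 1)%R.
Proof.
move=> [pq nb]; case: (extP p) pq nb => [|F x]; first by rewrite (le_gtF (lex1 _)).
case: (extP q) => [_ nb|G z /cell_lt[FG xz] nb].
  rewrite ext_rank_cell ext_rank_top -[F]/F.
  have -> : F = \top.
    apply/eqP; rewrite -[_ == _]negbK -ltx1; apply/negP => Ft.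
    have /negP := nb (cell \top x); apply; rewrite cell_lt_top andbT.
    by apply/cell_lt; split=> //; exact: component_refl.
  by rewrite rank_top -addn1 PoszD.
rewrite !ext_rank_cell; apply: rank_covers; split=> // H; apply/negP => /andP[FH HG].
have /negP := nb (cell H z); apply; apply/andP; split; apply/cell_lt.
  by split.
by split=> //; exact: component_refl.
Qed.

Lemma ext_diamond (p q : ext) : p < q -> ext_rank q = (ext_rank p + 2)%R ->
  [set t : ext | p < t < q] #= `I_2.
Proof.
case: (extP p) => [|F x]; first by rewrite (le_gtF (lex1 _)).
case: (extP q) => [_|G z].
  rewrite ext_rank_cell ext_rank_top => rF.
  have fF : facet F by rewrite /facet; lia.
  (* Above a facet [F] of [T] lie the copies at the two ends of an edge of colour [F], distinct
     because a step changes the parity. *)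
  apply/card_set2P; exists (cell \top x), (cell \top (step F x)).
  split=> [/cell_inj[_]|]; first by rewrite component_top => /(step_neq fF).
  apply/seteqP; split=> [t /= /andP[]|_ /= [] ->]; last 2 first.
  - rewrite cell_lt_top andbT; apply/cell_lt; split; last exact: component_refl.
    by rewrite ltx1; apply: contra_eq_neq rF => ->; rewrite rank_top; lia.
  - rewrite cell_lt_top andbT; apply/cell_lt; split; last exact: component_step.
    by rewrite ltx1; apply: contra_eq_neq rF => ->; rewrite rank_top; lia.
  case: (extP t) => [|H y]; first by rewrite ltxx.
  move=> /cell_lt[FH xy] _; have -> : H = \top.
    apply: (rk_eq (@rank_lt _ T)); rewrite ?lex1 // rank_top.
    have := rk_le (@rank_lt _ T) (lex1 H); have := rank_lt FH.
    by rewrite rank_top; lia.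
  by move: xy; rewrite component_facet // => -[->|->]; [left|right].
move=> /cell_lt[FG xz]; rewrite !ext_rank_cell => rFG.
have /card_set2P[a [b [ab e]]] := diamond FG rFG.
apply/card_set2P; exists (cell a z), (cell b z); split=> [/cell_inj[]//|].
apply/seteqP; split=> [t /= /andP[]|].
  case: (extP t) => [_|H y]; first by rewrite (le_gtF (lex1 _)).
  move=> /cell_lt[FH xy] /cell_lt[HG yz].
  have : [set H : T | F < H < G] H by rewrite /= FH.
  by rewrite e (cell_eq yz) => -[]->; [left|right].
have sub c : [set a; b] c -> cell F x < cell c z < cell G z.
  rewrite -e => /andP[Fc cG]; apply/andP; split; apply/cell_lt; split=> //.
  exact: component_refl.
by move=> _ [->|->]; apply: sub; [left|right].
Qed.

End Extension.

Section ExtensionFlags.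
Context (r : nat) (T : polytope r) (Z : cgraph T).
Implicit Types (F G H c : T) (z : Z) (Phi Psi : set T).
Local Notation comp := (component (@step _ _ Z)).
Local Notation rb := (@ext_rank_bot _ _ Z).
Local Notation rt := (@ext_rank_top _ _ Z).
Local Notation rl := (@ext_rank_lt _ _ Z).
Local Notation rc := (@ext_rank_covers _ _ Z).

Definition lift Phi z : set (ext Z) := \top |` [set cell F z | F in Phi].

Lemma flag_lift Phi z : flag Phi -> flag (lift Phi z).
Proof.
move=> fPhi; apply: (chain_flag rb rt rl).
  move=> _ _ [->|[F PF <-]] [->|[G PG <-]].
  - by left; rewrite lex1.
  - by right; rewrite lex1.
  - by left; rewrite lex1.
  have [FG|GF] := fPhi.1 _ _ PF PG; [left|right]; apply/cell_le; split=> //;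
    exact: component_refl.
move=> k k_bd; have [->|kr] := eqVneq k r.+1%:Z%R.
  by exists \top; [left | exact: rt].
have [|F PF eF] := @polytope_flag_rank _ T Phi k fPhi; first by lia.
by exists (cell F z); [right; exists F | rewrite ext_rank_cell].
Qed.

Lemma mem_lift Phi F z x : flag Phi ->
  lift Phi z (cell F x) <-> Phi F /\ comp F x z.
Proof.
move=> fPhi; split=> [[/cell_neq_top//|[G PG /cell_inj[<- xz]]]|[PF xz]].
  by split=> //; apply: component_sym.
by right; exists F => //; apply/esym/cell_eq.
Qed.

Lemma liftP (Om : set (ext Z)) : flag Om ->
  exists Phi z, flag Phi /\ Om = lift Phi z.
Proof.
move=> fOm; have [|p Omp] := flag_rank rb rt rl rc fOm (k := r%:Z%R); first by lia.
case: (extP p) Omp => [_|F z]; first by rewrite rt; lia.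
rewrite ext_rank_cell -(rank_top T) => Omz /(rk_eq (@rank_lt _ T) (lex1 _)) eF.
rewrite {}eF {F} in Omz.
have OmE q : Om q -> lift [set F | Om (cell F z)] z q.
  case: (extP q) => [|F x] Omq; first by left.
  suff e : cell F x = cell F z by rewrite e in Omq *; right; exists F.
  have [/cell_le[_ /cell_eq//]|/cell_le[]] := fOm.1 _ _ Omq Omz.
  by rewrite le1x component_top => /eqP-> ->.
exists [set F | Om (cell F z)], z; split; last first.
  apply/seteqP; split=> [//|q [->|[F OmF <-]//]]; exact: flag_top.
apply: (chain_flag (@rank_bot _ T) (rank_top T) (@rank_lt _ T)).
  by move=> F G /(fOm.1 _ _) h /h [/cell_le[]|/cell_le[]]; [left|right].
move=> k k_bd; have [|q Omq] := flag_rank rb rt rl rc fOm (k := k); first by lia.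
have [->|[F OmF <-]] := OmE q Omq; first by rewrite rt; lia.
by rewrite ext_rank_cell => eF; exists F.
Qed.

Lemma adjacent_lift Phi Psi z : flag Phi -> flag Psi -> adjacent Phi Psi ->
  adjacent (lift Phi z) (lift Psi z).
Proof.
move=> fPhi fPsi [aPhi aPsi]; suff h (X Y : set T) : flag X -> flag Y ->
    (exists x, X `\` Y = [set x]) ->
    exists x, lift X z `\` lift Y z = [set x] by split; apply: h.
move=> fX fY [x ex]; exists (cell x z); have [Xx nYx] : (X `\` Y) x by rewrite ex.
apply/seteqP; split=> [_ [[->|[F XF <-]] nY]|_ ->].
- by case: nY; left.
- suff -> : F = x by [].
  suff : (X `\` Y) F by rewrite ex.
  by split=> // YF; apply: nY; right; exists F.
split; first by right; exists x.
by move/(mem_lift _ _ _ fY) => [].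
Qed.

Lemma flag_le_facet Phi F c : flag Phi -> Phi F -> Phi c -> facet c ->
  F = \top \/ F <= c.
Proof.
move=> fPhi PF Pc fc; have [->|ne] := eqVneq F \top; [by left|right].
apply: (flag_rk_le (@rank_lt _ T) fPhi) => //.
have := @rank_lt _ T F \top; rewrite ltx1 ne rank_top fc => /(_ isT); lia.
Qed.

Lemma adjacent_step Phi c z : flag Phi -> Phi c -> facet c ->
  adjacent (lift Phi z) (lift Phi (step c z)).
Proof.
move=> fPhi Pc fc; suff h x : lift Phi x `\` lift Phi (step c x) = [set cell \top x].
  by split; eexists; [exact: h | rewrite -[in X in _ `\` X](stepK fc z); exact: h].
apply/seteqP; split=> [_ [[->|[F PF <-]] nY]|_ ->].
- by case: nY; left.
- have [->//|Fc] := flag_le_facet fPhi PF Pc fc.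
  by case: nY; apply/mem_lift => //; split=> //; apply: component_step.
split; first by right; exists \top => //; exact: flag_top.
by move/(mem_lift _ _ _ fPhi) => [_]; rewrite component_top => /(step_neq fc).
Qed.

(** If the vertices differ, [cell \top x] is the one face that is lost, so all the others are
    shared. For the facet [c] of the flag this says that [x] and [z] are the ends of an edge of
    colour [c]. *)
Lemma adjacent_liftP Phi Psi x z : flag Phi -> flag Psi ->
  adjacent (lift Phi x) (lift Psi z) ->
  (x = z /\ adjacent Phi Psi) \/
  (Phi = Psi /\ exists c, [/\ facet c, Phi c & z = step c x]).
Proof.
move=> fPhi fPsi [[p ep] [q eq]].
have [exz|xz] := pselect (x = z).
  subst z; left; split=> //; have h (X Y : set T) p' : flag X -> flag Y ->
     lift X x `\` lift Y x = [set p'] -> exists F, X `\` Y = [set F].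
    move=> fX fY e; have [[->|[F XF Fp]] nY] : (lift X x `\` lift Y x) p'.
    - by rewrite e.
    - by case: nY; left.
    exists F; apply/seteqP; split=> [G [XG nYG]|_ ->].
      have : (lift X x `\` lift Y x) (cell G x).
        split; first by right; exists G.
        by move/(mem_lift _ _ _ fY) => [].
      by rewrite e -Fp => /cell_inj[].
    by split=> // YF; apply: nY; rewrite -Fp; right; exists F.
  by split; [apply: h ep | apply: h eq].
right; have top_p : cell \top x = p.
  suff : (lift Phi x `\` lift Psi z) (cell \top x) by rewrite ep.
  split; first by right; exists \top => //; exact: flag_top.
  move/(mem_lift _ _ _ fPsi) => [_]; rewrite component_top => e.
  by apply: xz; rewrite e.
have sub F : Phi F -> F <> \top -> Psi F /\ comp F x z.
  move=> PF Ft; apply/(mem_lift _ _ _ fPsi); apply: contrapT => nPsi.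
  have : (lift Phi x `\` lift Psi z) (cell F x) by split=> //; right; exists F.
  by rewrite ep -top_p => /cell_inj[].
split.
  apply: flag_eq => // F PF; have [->|Ft] := pselect (F = \top).
    exact: flag_top.
  by have [] := sub F PF Ft.
have [|c Pc fc] := @polytope_flag_rank _ T Phi (r%:Z - 1)%R fPhi; first by lia.
exists c; split=> //; have [|_] := sub c Pc.
  by move=> ct; move: fc; rewrite ct rank_top; lia.
by rewrite component_facet // => -[/esym|].
Qed.

Lemma flag_path_lift A Phi Psi z B : flag_path A Phi Psi -> flag Psi ->
  B `<=` lift A z -> flag_path B (lift Phi z) (lift Psi z).
Proof.
have AB X : A `<=` X -> B `<=` lift A z -> B `<=` lift X z.
  move=> AX BA; apply: subset_trans BA _ => q [->|[F AF <-]]; first by left.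
  by right; exists F => //; apply: AX.
elim=> [X fX AX|X Y W fX AX adj pY IH] fW BA.
  by apply: flag_path_refl; [exact: flag_lift | exact: AB].
have fY : flag Y by case: pY.
apply: flag_path_step (IH fW BA); first exact: flag_lift.
  exact: AB.
exact: adjacent_lift.
Qed.

(* Walk in the graph through facets containing a common face [F0] of maximal
   rank, moving inside [T] between two successive steps. *)
Lemma ext_sfc : strongly_flag_connected (ext Z).
Proof.
move=> _ _ /liftP[Phi [x [fPhi ->]]] /liftP[Psi [z [fPsi ->]]].
pose K := [set F | [/\ Phi F, Psi F & comp F x z]].
have [F0 [[PF0 QF0 xz] maxF0]] : exists F0, K F0 /\ forall F, K F -> F <= F0.
  pose R m := `[< exists F, K F /\ (rank F + 1 = m%:Z)%R >].
  have R0 : exists m, R m.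
    exists 0%N; apply/asboolP; exists \bot; rewrite (@rank_bot _ T); split=> //.
    by split; [exact: flag_bot|exact: flag_bot|exact: component_bot].
  have R_ub m : R m -> (m <= r.+1)%N.
    case/asboolP=> F [_ e].
    by have := rk_le_top (rank_top T) (@rank_lt _ T) F; lia.
  have [m /asboolP[F [KF eF]] maxF] := ex_maxnP R0 R_ub.
  exists F; split=> // G KG; apply: (flag_rk_le (@rank_lt _ T) fPhi).
  - by case: KG.
  - by case: KF.
  have rG := rk_ge (@rank_bot _ T) (@rank_lt _ T) G.
  have : R `|(rank G + 1)%R|%N by apply/asboolP; exists G; split=> //; lia.
  by move/maxF; lia.
pose A := [set F | [/\ Phi F, Psi F & F <= F0]].
have sub y : comp F0 x y -> lift Phi x `&` lift Psi z `<=` lift A y.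
  move=> xy q [[->|[F PF <-]]]; first by left.
  move/(mem_lift _ _ _ fPsi) => [PsF xFz].
  have FF0 : F <= F0 by apply: maxF0; split.
  right; exists F; first by split.
  exact/esym/cell_eq/(component_mono FF0).
suff walk_path y Phi' : comp F0 x y -> flag Phi' -> A `<=` Phi' ->
    flag_path (lift Phi x `&` lift Psi z) (lift Phi x) (lift Phi' y).
  by apply: walk_path => // F [].
case=> w ww ey; elim: w ww y ey Phi' => [|c w IH] ww y /= ey Phi' fPhi' APhi'.
  rewrite ey; apply: (@flag_path_lift (Phi `&` Phi')) => //.
    exact: polytope_sfc.
  apply: subset_trans (sub x (component_refl _ _ _)) _ => q [->|[F AF <-]].
    by left.
  by right; exists F => //; split; [case: AF|apply: APhi'].
have ww' : walk F0 w by move=> d dw; apply: ww; rewrite inE dw orbT.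
have [|fc Fc] := ww c; first by rewrite inE eqxx.
set y' := foldr _ _ w in ey; have xy' : comp F0 x y' by exists w.
have [|Phi1 fPhi1 sPhi1] := @chain_sub_flag _ T (c |` A).
  have Ac F : A F -> F <= c by case=> _ _ FF0; exact: le_trans Fc.
  move=> F G [->|AF] [->|AG].
  - by left.
  - by right; apply: Ac.
  - by left; apply: Ac.
  - by apply: fPhi.1; [case: AF | case: AG].
have AP1 : A `<=` Phi1 by move=> F AF; apply: sPhi1; right.
have P1c : Phi1 c by apply: sPhi1; left.
have xy : comp F0 x y by rewrite ey; apply: component_trans xy' _; exact: component_step.
apply: flag_pathA (IH ww' y' erefl Phi1 fPhi1 AP1) _.
apply: (@flag_path_step _ _ _ _ (lift Phi1 y)); first exact: flag_lift.
- apply: subset_trans (sub y' xy') _ => q [->|[F AF <-]]; first by left.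
  by right; exists F => //; apply: AP1.
- by rewrite ey; apply: adjacent_step.
apply: (@flag_path_lift (Phi1 `&` Phi')) => //; first exact: polytope_sfc.
apply: subset_trans (sub y xy) _ => q [->|[F AF <-]]; first by left.
by right; exists F => //; split; [apply: AP1|apply: APhi'].
Qed.

Definition ext_polytope : polytope r.+1 :=
  @Polytope r.+1 ext_display (ext Z) (@ext_rank _ _ Z) rb rl rc
    (graded_flag_card rb rt rl rc) ext_sfc (@ext_diamond _ _ Z).

Lemma ext_facet (p : ext_polytope) : facet p ->
  isomorphic (section \bot p) T.
Proof.
rewrite /facet /rank /=; case: (extP p) => [|F z]; first by rewrite rt; lia.
rewrite ext_rank_cell => rF; have {rF F}-> : F = \top.
  by apply: (rk_eq (@rank_lt _ T)); rewrite ?lex1 // rank_top rF; lia.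
have cell_sec F : \bot <= cell F z <= cell \top z.
  rewrite le0x; apply/cell_le; split; [exact: lex1|exact: component_refl].
pose g F : section \bot (cell \top z) := exist _ (cell F z) (cell_sec F).
exists (fun x : section \bot (cell \top z) => (val (val x)).1).
have gK x : g (val (val x)).1 = x.
  apply: val_inj => /=; case: x => q /=; case: (extP q) => [|F y].
    by rewrite le1x => /andP[_ /eqP e]; case: (cell_neq_top e).
  by move=> /andP[_ /cell_le[_ yz]] /=; apply/esym/cell_eq.
split; first by exists g.
move=> x y; rewrite -[x in RHS]gK -[y in RHS]gK.
apply/idP/idP; last by move/cell_le => [].
by move=> xy; apply/cell_le; split=> //; exact: component_refl.
Qed.

End ExtensionFlags.

(** * Automorphisms of the extension *)

Section ExtensionAutomorphisms.
Context (r : nat) (T : polytope r) (Z : cgraph T).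
Implicit Types (F G H c : T) (z : Z) (Phi Psi : set T) (g : T -> T).
Local Notation comp := (component (@step _ _ Z)).

Definition graph_aut g (phi : Z -> Z) :=
  [/\ automorphism g, bijective phi &
      forall c z, facet c -> phi (step c z) = step (g c) (phi z)].

Lemma aut_facet g c : automorphism g -> facet c -> facet (g c).
Proof. by move=> ag; rewrite /facet polytope_aut_rank. Qed.

Lemma graph_aut_inv g phi : graph_aut g phi -> exists g' phi',
  [/\ graph_aut g' phi', cancel g g', cancel g' g, cancel phi phi' & cancel phi' phi].
Proof.
move=> [/automorphism_inv[g' [ag' gK g'K]] [phi' phiK phi'K] st].
exists g', phi'; split=> //; split=> //; first by exists phi.
move=> c z fc; apply: (can_inj phiK); rewrite phi'K st ?g'K ?phi'K //.
exact: aut_facet.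
Qed.

Lemma graph_aut_component g phi F x z : graph_aut g phi ->
  comp F x z -> comp (g F) (phi x) (phi z).
Proof.
move=> [ag _ st] [w ww ->]; exists [seq g c | c <- w].
  move=> _ /mapP[c /ww[fc Fc] ->]; split; first exact: aut_facet.
  by rewrite ag.2.
elim: w ww => //= c w IH ww; rewrite st ?IH //.
  by move=> d dw; apply: ww; rewrite inE dw orbT.
by have [|//] := ww c; rewrite inE eqxx.
Qed.

Lemma graph_aut_image g phi F z : graph_aut g phi ->
  phi @` comp F z = comp (g F) (phi z).
Proof.
move=> a; have [g' [phi' [a' gK g'K phiK phi'K]]] := graph_aut_inv a.
apply/seteqP; split=> [_ [y zy <-]|y zy]; first exact: graph_aut_component.
exists (phi' y) => //; rewrite -[F]gK -[z]phiK.
exact: graph_aut_component a' _.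
Qed.

(** When [g] and [phi] satisfy [graph_aut], components are mapped onto components, so the default
    value of [insubd] is never reached. *)
Definition ext_map g (phi : Z -> Z) (p : ext Z) : ext Z :=
  insubd (\top : ext Z) (g (val p).1, phi @` (val p).2).

Lemma ext_map_cell g phi F z : graph_aut g phi ->
  ext_map g phi (cell F z) = cell (g F) (phi z).
Proof.
move=> a; apply: val_inj; rewrite [LHS]insubdK /= (graph_aut_image _ _ a) //.
by apply/mem_set; right; exists (phi z).
Qed.

Lemma ext_map_top g phi : graph_aut g phi -> ext_map g phi \top = \top.
Proof.
move=> [ag _ _]; apply: val_inj.
have e : g \top = \top.
  by apply: (rk_eq (@rank_lt _ T)); rewrite ?lex1 // polytope_aut_rank.
by rewrite [LHS]insubdK /= image_set0 e //; apply/mem_set; left.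
Qed.

Lemma ext_mapP g phi : graph_aut g phi -> automorphism (ext_map g phi).
Proof.
move=> a; have [g' [phi' [a' gK g'K phiK phi'K]]] := graph_aut_inv a.
split.
  exists (ext_map g' phi') => p; case: (extP p) => [|F z].
  - by rewrite !ext_map_top.
  - by rewrite !ext_map_cell // gK phiK.
  - by rewrite !ext_map_top.
  - by rewrite !ext_map_cell // g'K phi'K.
move=> p q; case: (extP q) => [|G y]; first by rewrite ext_map_top // !lex1.
case: (extP p) => [|F x].
  by rewrite ext_map_top // ext_map_cell // !(lt_geF (cell_lt_top _ _)).
rewrite !ext_map_cell //; apply/idP/idP => /cell_le[FG xy]; apply/cell_le.
  split; first by rewrite -(proj2 (let: And3 ag _ _ := a in ag)).
  by rewrite -[F]gK -[x]phiK -[y]phiK; apply: graph_aut_component.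
split; last exact: graph_aut_component.
by rewrite (proj2 (let: And3 ag _ _ := a in ag)).
Qed.

Lemma ext_map_lift g phi Phi z : graph_aut g phi ->
  ext_map g phi @` lift Phi z = lift (g @` Phi) (phi z).
Proof.
move=> a; apply/seteqP; split.
  move=> _ [_ [->|[F PF <-]] <-]; first by left; apply: ext_map_top.
  by right; exists (g F); [exists F | rewrite ext_map_cell].
move=> _ [->|[_ [F PF <-] <-]]; first by exists \top; [left|apply: ext_map_top].
by exists (cell F z); [right; exists F|rewrite ext_map_cell].
Qed.

Lemma ext_aut_rank (h : ext Z -> ext Z) p : automorphism h -> ext_rank (h p) = ext_rank p.
Proof.
exact: (automorphism_rk (@ext_rank_bot _ _ Z) (@ext_rank_top _ _ Z)
  (@ext_rank_lt _ _ Z) (@ext_rank_covers _ _ Z)).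
Qed.

Lemma ext_aut_facet (h : ext Z -> ext Z) z : automorphism h ->
  exists z', h (cell \top z) = cell \top z'.
Proof.
move=> ah; have := ext_aut_rank (cell \top z) ah; rewrite ext_rank_cell rank_top.
case: (extP (h _)) => [|F z']; first by rewrite ext_rank_top; lia.
rewrite ext_rank_cell -(rank_top T) => /(rk_eq (@rank_lt _ T) (lex1 _)) ->.
by exists z'.
Qed.

Lemma ext_aut_cell (h : ext Z -> ext Z) z z' F : automorphism h ->
  h (cell \top z) = cell \top z' -> h (cell F z) = cell (val (h (cell F z))).1 z'.
Proof.
move=> ah ez; have : h (cell F z) <= h (cell \top z).
  by rewrite ah.2; apply/cell_le; split; [exact: lex1 | exact: component_refl].
rewrite ez; case: (extP (h (cell F z))) => [|G y].
  by rewrite (lt_geF (cell_lt_top _ _)).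
by move=> /cell_le[_ yz']; rewrite (cell_eq yz').
Qed.

(** A facet is sent to a facet, and the faces below each of the two form a copy of [T]; comparing
    the copies gives [g]. *)
Lemma ext_aut_local (h : ext Z -> ext Z) z : automorphism h ->
  exists g z', automorphism g /\ forall F, h (cell F z) = cell (g F) z'.
Proof.
move=> ah; have [h' [ah' hK h'K]] := automorphism_inv ah.
have [z' ez] := ext_aut_facet z ah.
have ez' : h' (cell \top z') = cell \top z by rewrite -ez hK.
pose g F := (val (h (cell F z))).1; pose g' F := (val (h' (cell F z'))).1.
have hg F : h (cell F z) = cell (g F) z' by apply: ext_aut_cell.
have hg' F : h' (cell F z') = cell (g' F) z by apply: ext_aut_cell.
exists g, z'; split=> //; split.
  exists g' => F.
    by have := hK (cell F z); rewrite hg hg' => /cell_inj[].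
  by have := h'K (cell F z'); rewrite hg' hg => /cell_inj[].
move=> F G; have cellE H K x : (cell H x <= cell K x :> ext Z) = (H <= K).
  apply/idP/idP => [/cell_le[]//|HK].
  by apply/cell_le; split=> //; apply: component_refl.
by rewrite -(cellE _ _ z') -!hg ah.2 cellE.
Qed.

(* An automorphism fixing the flag of one facet acts on the whole extension as
   a colour preserving automorphism of the graph, because the automorphisms
   induced on two adjacent facets agree on the flags through a common colour. *)
Lemma ext_aut_walk (h : ext Z -> ext Z) Phi x z (w : seq T) :
  automorphism h -> flag Phi -> h @` lift Phi x = lift Phi z ->
  (forall c, c \in w -> facet c) ->
  forall F, h (cell F (foldr (@step _ _ Z) x w)) = cell F (foldr (@step _ _ Z) z w).
Proof.
move=> ah fPhi e; have fixed g y y' Psi : automorphism g ->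
    (forall F, h (cell F y) = cell (g F) y') -> flag Psi ->
    (forall F, Psi F -> g F = F) -> forall F, h (cell F y) = cell F y'.
  by move=> ag hg fPsi fixg F; rewrite hg (automorphism_fix ag fPsi fixg).
elim: w => [|c w IH] ww.
  have [g [z' [ag hg]]] := ext_aut_local x ah.
  have inl F : Phi F -> Phi (g F) /\ comp (g F) z' z.
    move=> PF; apply/(mem_lift _ _ _ fPhi); rewrite -hg -e.
    by exists (cell F x) => //; right; exists F.
  have ez : z' = z.
    have [_] := inl \top (flag_top fPhi).
    have -> : g \top = \top.
      by apply: (rk_eq (@rank_lt _ T)); rewrite ?lex1 // polytope_aut_rank.
    by rewrite component_top => ->.
  subst z'; apply: fixed hg _ _ => // [|F PF]; first exact: fPhi.
  apply: (flag_rk_inj (@rank_lt _ T) fPhi) => //; first by have [] := inl F PF.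
  exact: polytope_aut_rank.
have fc : facet c by apply: ww; rewrite inE eqxx.
have {}IH : forall F, h (cell F (foldr (@step _ _ Z) x w)) = cell F (foldr (@step _ _ Z) z w).
  by apply: IH => d dw; apply: ww; rewrite inE dw orbT.
set y := foldr _ x w in IH *; set y' := foldr _ z w in IH *.
rewrite -[foldr _ x _]/(step c y) -[foldr _ z _]/(step c y').
have [g [u [ag hg]]] := ext_aut_local (step c y) ah.
have low F : F <= c -> F = g F /\ comp F y' u.
  move=> Fc; apply: cell_inj; rewrite -hg -IH; congr h; apply: cell_eq.
  exact: component_step.
have eu : u = step c y'.
  have [_] := low c (lexx c); rewrite component_facet // => -[uy'|//].
  have : h (cell \top (step c y)) = h (cell \top y).
    rewrite hg IH uy'; congr cell.
    by apply: (rk_eq (@rank_lt _ T)); rewrite ?lex1 // polytope_aut_rank.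
  move=> /(bij_inj ah.1) /cell_inj[_]; rewrite component_top => /esym e'.
  by case: (step_neq fc e').
rewrite -eu; have [Psi fPsi Pc] := @mem_flag _ T c.
apply: fixed hg _ _ => // [|F PF]; first exact: fPsi.
have [->|/low[]//] := flag_le_facet fPsi PF Pc fc.
by apply: (rk_eq (@rank_lt _ T)); rewrite ?lex1 // polytope_aut_rank.
Qed.

(** The orbit of [lift Phi z] is governed by [eps Phi (+) parity z]. Flags of equal value are
    exchanged by composing regularity of [T] with [autT] and then [trZ]. If both values shared an
    orbit, some automorphism would carry [lift Phi (root Z)] to [lift Phi z] with [z] on the other
    side; by [ext_aut_walk] it commutes with walks, so the closed walk [w] at the root would also
    close at [z]. Adjacent flags differ in exactly one summand. *)
Theorem ext_chiral (eps : set T -> bool) (w : seq T) :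
  (forall Phi Psi, flag Phi -> flag Psi -> adjacent Phi Psi ->
     eps Psi = ~~ eps Phi) ->
  regular T ->
  (forall g, automorphism g -> exists2 phi, graph_aut g phi &
     forall Phi z, flag Phi ->
       parity (phi z) = parity z (+) eps Phi (+) eps (g @` Phi)) ->
  (forall x z, parity x = parity z -> exists2 phi, graph_aut id phi & phi x = z) ->
  (forall c, c \in w -> facet c) ->
  foldr (@step _ _ Z) (root Z) w = root Z ->
  (forall z, parity z <> parity (root Z) -> foldr (@step _ _ Z) z w <> z) ->
  chiral (ext_polytope Z).
Proof.
move=> eps_adj regT autT trZ ww w_root w_odd.
have orbit_same Phi Psi x z : flag Phi -> flag Psi ->
    eps Phi (+) parity x = eps Psi (+) parity z ->
    flag_orbit (lift Phi x) (lift Psi z).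
  move=> fPhi fPsi e; have [g ag eg] := regT Phi Psi fPhi fPsi.
  have [phi a par] := autT g ag.
  have [|psi a' epsi] := trZ (phi x) z.
    rewrite (par Phi) // -eg; move: e.
    by case: (eps Phi); case: (eps Psi); case: (parity x); case: (parity z).
  exists (ext_map id psi \o ext_map g phi).
    by apply: automorphism_comp; apply: ext_mapP.
  rewrite -image_comp !ext_map_lift // -eg epsi; congr lift.
  by rewrite image_id.
have [Phi fPhi _] := @mem_flag _ T \top.
have [|c Pc fc] := @polytope_flag_rank _ T Phi (r%:Z - 1)%R fPhi; first by lia.
have no_orbit z : parity z <> parity (root Z) ->
    ~ flag_orbit (lift Phi (root Z)) (lift Phi z).
  move=> pz [h ah /esym e].
  have /(_ \top) := ext_aut_walk ah fPhi e ww.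
  have /(_ \top) := ext_aut_walk ah fPhi e (w := [::]) (fun _ => False_ind _ \o notF).
  rewrite /= w_root => -> /cell_inj[_]; rewrite component_top => e'.
  exact: (w_odd z pz).
have orbit_diff Psi Om x z : flag Psi -> flag Om ->
    flag_orbit (lift Psi x) (lift Om z) ->
    eps Psi (+) parity x = eps Om (+) parity z.
  (* If the two boolean values differ, one of them is the value of the base flag, and the roles of
     the flags may be exchanged. *)
  move=> fPsi fOm; wlog : Psi Om x z fPsi fOm /
      eps Psi (+) parity x = eps Phi (+) parity (root Z).
    move=> wl o; have [e|ne] := eqVneq (eps Psi (+) parity x) (eps Phi (+) parity (root Z)).
      exact: wl o.
    apply/eqP; apply: contraT => ne'; rewrite -(negbTE ne'); apply/eqP/esym/wl => //.
      by move: ne ne'; case: (_ (+) _); case: (_ (+) _); case: (_ (+) _).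
    exact: flag_orbit_sym.
  move=> e o; apply/eqP; apply: contraT => ne; exfalso.
  apply: (no_orbit (step c (root Z))); first by rewrite parity_step //; case: (parity _).
  apply: flag_orbit_trans (orbit_same _ _ _ _ fPhi fPsi (esym e)) _.
  apply: flag_orbit_trans o (orbit_same _ _ _ _ fOm fPhi _).
  move: ne; rewrite e parity_step //.
  by case: (eps Phi); case: (eps Om); case: (parity z); case: (parity (root Z)).
split; last first.
  move=> _ _ /liftP[Psi [x [fPsi ->]]] /liftP[Om [z [fOm ->]]] adj.
  move=> /(orbit_diff _ _ _ _ fPsi fOm).
  have [[<- /(eps_adj _ _ fPsi fOm) ->]|[<- [d [fd _ ->]]]] := adjacent_liftP fPsi fOm adj.
    by case: (eps _); case: (parity _).
  by rewrite parity_step //; case: (eps _); case: (parity _).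
apply/card_set2P; set z1 := root Z; set z2 := step c z1.
exists (flag_orbit (lift Phi z1)), (flag_orbit (lift Phi z2)); split.
  move=> e; have : flag_orbit (lift Phi z2) (lift Phi z2) by apply: orbit_same.
  rewrite -e => /orbit_diff -/(_ fPhi fPhi); rewrite parity_step //.
  by case: (eps _); case: (parity _).
have orbit_eq (X Y : set (ext Z)) : flag_orbit X Y -> flag_orbit Y = flag_orbit X.
  move=> XY; apply/seteqP; split=> W; first exact: flag_orbit_trans.
  exact/flag_orbit_trans/flag_orbit_sym.
apply/seteqP; split=> [_ [_ /liftP[Psi [x [fPsi ->]]] <-]|_ [->|->]]; last 2 first.
- by exists (lift Phi z1) => //; exact: flag_lift.
- by exists (lift Phi z2) => //; exact: flag_lift.
have [e|ne] := eqVneq (eps Psi (+) parity x) (eps Phi (+) parity z1).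
  by left; apply: orbit_eq; apply: orbit_same.
right; apply: orbit_eq; apply: orbit_same => //; rewrite parity_step //.
by move: ne; case: (eps _); case: (eps _); case: (parity _); case: (parity _).
Qed.

End ExtensionAutomorphisms.

(** * Voltage graphs *)

Section ConnectedComponent.
Context (r : nat) (T : polytope r) (Z : Type) (stp : T -> Z -> Z).
Context (par : Z -> bool) (z0 : Z).
Hypothesis stpK : forall c, facet c -> involutive (stp c).
Hypothesis par_stp : forall c z, facet c -> par (stp c z) = ~~ par z.

Definition comp_vertex : Type := {z : Z | `[< component stp \bot z0 z >]}.

(** Restricting to the component of one vertex supplies connectedness. The default of [insubd] can
    occur only when [c] is not a facet. *)
Definition comp_step (c : T) (x : comp_vertex) : comp_vertex := insubd x (stp c (val x)).

Definition comp_root : comp_vertex :=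
  Sub z0 (asboolT (component_refl stp \bot z0)).

Lemma comp_stepE c x : facet c -> val (comp_step c x) = stp c (val x).
Proof.
move=> fc; rewrite insubdK //; apply/asboolP.
apply: (component_trans (asboolW (valP x))).
by apply: component_step => //; exact: le0x.
Qed.

Lemma comp_stepK c : facet c -> involutive (comp_step c).
Proof. by move=> fc x; apply: val_inj; rewrite !comp_stepE // stpK. Qed.

Lemma comp_parity c x : facet c -> par (val (comp_step c x)) = ~~ par (val x).
Proof. by move=> fc; rewrite comp_stepE // par_stp. Qed.

Lemma comp_walkE (w : seq T) x : (forall c, c \in w -> facet c) ->
  val (foldr comp_step x w) = foldr stp (val x) w.
Proof.
elim: w => [//|c w IH] ww.
rewrite -[LHS]/(val (comp_step c (foldr comp_step x w))).
rewrite comp_stepE; last by apply: ww; rewrite mem_head.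
by rewrite IH // => d dw; apply: ww; rewrite inE dw orbT.
Qed.

Lemma comp_connected x : component comp_step \bot comp_root x.
Proof.
have /asboolP[w ww e] := valP x; exists w => //; apply: val_inj.
by rewrite comp_walkE // => c /ww[].
Qed.

Definition component_graph : cgraph T :=
  @CGraph r T comp_vertex comp_step (fun x => par (val x)) comp_root
    comp_stepK comp_parity comp_connected.

(** A symmetry of the whole graph maps components onto components, so it restricts to the chosen one
    as soon as a single vertex of it stays inside. *)
Lemma component_graph_aut g (phi psi : Z -> Z) x : automorphism g ->
  cancel phi psi -> cancel psi phi ->
  (forall c z, facet c -> phi (stp c z) = stp (g c) (phi z)) ->
  component stp \bot z0 x -> component stp \bot z0 (phi x) ->
  exists2 f : component_graph -> component_graph, graph_aut g f &
    forall z, val (f z) = phi (val z).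
Proof.
move=> ag phiK psiK st rx rphix.
have [g' [ag' gK g'K]] := automorphism_inv ag.
have st' c z : facet c -> psi (stp c z) = stp (g' c) (psi z).
  move=> fc; apply: (can_inj phiK); rewrite psiK st ?g'K ?psiK //.
  exact: aut_facet.
have sym y z := @component_symm _ _ _ stp \bot y z stpK.
have walk_map (h : T -> T) f y z : automorphism h ->
    (forall c z, facet c -> f (stp c z) = stp (h c) (f z)) ->
    component stp \bot y z -> component stp \bot (f y) (f z).
  move=> ah fst [w ww ->]; exists [seq h c | c <- w].
    move=> _ /mapP[c /ww[fc _] ->]; split; [exact: aut_facet | exact: le0x].
  elim: w ww => //= c w IH ww; rewrite fst ?IH //.
    by move=> d dw; apply: ww; rewrite inE dw orbT.
  by have [] := ww c (mem_head _ _).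
have reach_phi z : component stp \bot z0 z -> component stp \bot z0 (phi z).
  move=> rz; apply: component_trans rphix (walk_map g phi _ _ ag st _).
  exact: component_trans (sym _ _ rx) rz.
have reach_psi z : component stp \bot z0 z -> component stp \bot z0 (psi z).
  move=> rz; have := walk_map g' psi (phi x) z ag' st'; rewrite phiK => h.
  by apply: component_trans rx (h _); apply: component_trans (sym _ _ rphix) rz.
pose lft (f : Z -> Z) (h : forall z, component stp \bot z0 z ->
    component stp \bot z0 (f z)) (z : component_graph) : component_graph :=
  Sub (f (val z)) (asboolT (h _ (asboolW (valP z)))).
exists (lft phi reach_phi) => //; split=> //.
  exists (lft psi reach_psi) => z; apply: val_inj; [exact: phiK | exact: psiK].
move=> c z fc; apply: val_inj.
by rewrite /= !comp_stepE //= ?st //; apply: aut_facet.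
Qed.

End ConnectedComponent.

(** * Alternating products and the chiral word *)

Section AlternatingProduct.
Local Open Scope group_scope.
Context (gT : finGroupType) (I : eqType).
Implicit Types (y : I -> gT) (w : seq I) (b : bool).

(** This is the voltage collected along a walk in the bipartite graph: every step changes side, and
    on the side [true] a colour contributes its inverse. *)
Fixpoint altprod b y w : gT :=
  if w is c :: w' then (if b then (y c)^-1 else y c) * altprod (~~ b) y w' else 1.

Lemma altprod_cat b y v w :
  altprod b y (v ++ w) = altprod b y v * altprod (b (+) odd (size v)) y w.
Proof.
elim: v b => [|c v IH] b /=; first by rewrite mul1g addbF.
by rewrite IH mulgA; case: b; case: odd.
Qed.

Lemma altprod1 b y w : (forall c, y c = 1) -> altprod b y w = 1.
Proof. by move=> y1; elim: w b => //= c w IH b; rewrite IH y1 invg1 if_same mulg1. Qed.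

(* In an affine group of the line, where conjugation by [p] multiplies the
   translation [p q p^-1 q^-1] by some [X], this is its multiple by
   [(X - 1) (X - 2)]: it vanishes for [X = 1] and [X = 2] but not for [X = 2^-1]. *)
Definition chiral_word (gT : finGroupType) (p q : gT) : gT :=
  let t := p * q * p^-1 * q^-1 in let t1 := p * t * p^-1 * t^-1 in
  p * t1 * p^-1 * t1^-1 * t1^-1.

Lemma altprod_rev b y w :
  altprod (b (+) odd (size w)) y (rev w) = (altprod b y w)^-1.
Proof.
elim: w b => [|c w IH] b /=; first by rewrite invg1.
rewrite rev_cons -cats1 altprod_cat size_rev /= mulg1 invMg -IH addbN -addNb.
by rewrite -addbA addbb addbF; case: b; rewrite /= ?invgK.
Qed.

(** The expression of [chiral_word], with inverses replaced by reversed words. The auxiliary colour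
    [b] makes [p] and [q] of even length, so that each occurrence starts on the same side and
    reversal really inverts. *)
Definition chiral_walk (a b c : I) : seq I :=
  let p := [:: a; b] in let q := [:: c; b] in
  let t := p ++ q ++ rev p ++ rev q in let t1 := p ++ t ++ rev p ++ rev t in
  p ++ t1 ++ rev p ++ rev t1 ++ rev t1.

Lemma altprod_chiral_walk s y (a b c : I) : altprod s y (chiral_walk a b c) =
  chiral_word (altprod s y [:: a; b]) (altprod s y [:: c; b]).
Proof.
pose even w := ~~ odd (size w).
have catE v w : even v -> altprod s y (v ++ w) = altprod s y v * altprod s y w.
  by move=> /negbTE ev; rewrite altprod_cat ev addbF.
have revE w : even w -> altprod s y (rev w) = (altprod s y w)^-1.
  by move=> /negbTE ew; rewrite -altprod_rev ew addbF.
have commE v w : even v -> even w -> altprod s y (v ++ w ++ rev v ++ rev w) =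
    altprod s y v * altprod s y w * (altprod s y v)^-1 * (altprod s y w)^-1.
  by move=> ev ew; rewrite !catE ?revE ?mulgA //; rewrite /even size_rev.
rewrite /chiral_walk /chiral_word -(commE [:: a; b] [:: c; b]) //.
move: [:: a; b] [:: c; b] (isT : even [:: a; b]) (isT : even [:: c; b]) => p q ep eq.
have : even (p ++ q ++ rev p ++ rev q).
  by move: ep eq; rewrite /even !size_cat !size_rev !oddD; do 2!case: odd.
move: (p ++ q ++ rev p ++ rev q) => t et; rewrite -(commE p t) //.
have : even (p ++ t ++ rev p ++ rev t).
  by move: ep et; rewrite /even !size_cat !size_rev !oddD; do 2!case: odd.
move: (p ++ t ++ rev p ++ rev t) => t1 et1.
by rewrite !catE ?revE ?mulgA //; rewrite /even size_rev.
Qed.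

(** This is the case [X = 1]: already the second commutator is trivial. *)
Lemma chiral_word_comm_comm (p q : gT) : commute p (p * q * p^-1 * q^-1) -> chiral_word p q = 1.
Proof.
move=> cpt; rewrite /chiral_word; set t := p * q * _ * _ in cpt *.
by rewrite {1 2 3}cpt mulgK mulgV mulg1 mulgV invg1 !mulg1.
Qed.

Lemma chiral_word_comm (p q : gT) : commute p q -> chiral_word p q = 1.
Proof.
move=> cpq; apply: chiral_word_comm_comm; rewrite cpq mulgK mulgV.
exact: commute1.
Qed.

Lemma chiral_word_conj (p q : gT) : p * q * p^-1 = q * q -> chiral_word p q = 1.
Proof. by move=> e; rewrite /chiral_word e mulgK e mulgK e mulgK mulgV. Qed.

End AlternatingProduct.

(** * The affine group of the line over the field with five elements *)

Section Affine5.
Local Open Scope group_scope.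

Definition shift5 : {perm 'Z_5} := perm (addIr (1 : 'Z_5)%R).

Fact mul5_inj (k : 'Z_5) : k != 0%R -> injective (fun x : 'Z_5 => (x * k)%R).
Proof.
move=> k0 x y /eqP; apply: contraTeq.
by case: k k0 => -[|[|[|[|[|//]]]]] ki // _; case: x => -[|[|[|[|[|//]]]]] xi //;
   case: y => -[|[|[|[|[|//]]]]] yi.
Qed.

(** A product of permutations applies its left factor first, so conjugation by multiplication by 3
    ends with multiplication by its inverse 2, which doubles the shift. *)
Definition scale5 : {perm 'Z_5} := perm (@mul5_inj 3%R isT).

Lemma scale5_conj : scale5 * shift5 * scale5^-1 = shift5 * shift5.
Proof.
apply: (mulIg scale5); rewrite mulgKV; apply/permP => x; rewrite !permM !permE.
by case: x => -[|[|[|[|[|//]]]]] ?; apply: val_inj.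
Qed.

Lemma scale5V : scale5^-1 = perm (@mul5_inj 2%R isT).
Proof.
apply: (mulIg scale5); rewrite mulVg; apply/permP => x; rewrite !permM !permE.
by case: x => -[|[|[|[|[|//]]]]] ?; apply: val_inj.
Qed.

Lemma shift5V : shift5^-1 = perm (addIr (4 : 'Z_5)%R).
Proof.
apply: (mulIg shift5); rewrite mulVg; apply/permP => x; rewrite !permM !permE.
by case: x => -[|[|[|[|[|//]]]]] ?; apply: val_inj.
Qed.

Lemma chiral_word_mirror : chiral_word scale5^-1 shift5^-1 != 1.
Proof.
apply/eqP => /permP/(_ 0%R); rewrite /chiral_word !invMg !invgK scale5V shift5V.
by rewrite !permM !permE.
Qed.

End Affine5.

(** * Chirality of the voltage extension *)

Section ChiralExtension.
Context (r : nat) (T : polytope r) (eps : set T -> bool).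
Hypothesis eps_adj : forall Phi Psi, flag Phi -> flag Psi ->
  adjacent Phi Psi -> eps Psi = ~~ eps Phi.
Hypothesis regT : regular T.
Implicit Types (g h : T -> T) (Phi Psi : set T) (c : T).

Lemma eps_aut g Phi Psi : automorphism g -> flag Phi -> flag Psi ->
  eps Phi (+) eps (g @` Phi) = eps Psi (+) eps (g @` Psi).
Proof.
move=> ag fPhi fPsi.
have := polytope_sfc fPhi fPsi; elim {fPhi fPsi} => [//|X Y W fX _ adj pY <-].
have fY : flag Y by case: pY.
rewrite (eps_adj fX fY adj) (eps_adj _ _ (automorphism_adjacent ag adj)) //;
  try exact: automorphism_flag.
by case: (eps X); case: (eps _).
Qed.

Definition base_flag : set T := projT1 (cid2 (mem_flag (\top : T))).

Lemma base_flagP : flag base_flag.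
Proof. by rewrite /base_flag; case: cid2. Qed.

Definition reversing g := eps base_flag (+) eps (g @` base_flag).

Lemma reversing_comp g h : automorphism g -> automorphism h ->
  reversing (g \o h) = reversing g (+) reversing h.
Proof.
move=> ag ah; rewrite {2}/reversing (eps_aut (Psi := h @` base_flag) ag).
- rewrite /reversing -image_comp.
  by case: (eps base_flag); case: (eps (h @` _)); case: (eps _).
- exact: base_flagP.
- exact/automorphism_flag/base_flagP.
Qed.

Variables (al be ga : T).
Hypotheses (fal : facet al) (fbe : facet be) (fga : facet ga).
Hypotheses (al_be : al != be) (al_ga : al != ga) (be_ga : be != ga).
(** In coordinate [g] a colour [c] carries a nontrivial voltage only if [g c] is [al] or [ga]. The
    last two conditions make [be] trivial whenever [al] or [ga] is not; the first one excludes that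
    [al] and [ga] are seen in place by an orientation reversing [g], which would produce the mirror
    word. *)
Hypothesis al_ga_preserving : forall g Phi, automorphism g -> flag Phi ->
  g al = al -> g ga = ga -> eps (g @` Phi) = eps Phi.
Hypothesis al_be_far : forall g, automorphism g ->
  ~ (g al \in [:: al; ga] /\ g be \in [:: al; ga]).
Hypothesis be_ga_far : forall g, automorphism g ->
  ~ (g be \in [:: al; ga] /\ g ga \in [:: al; ga]).

Local Open Scope group_scope.

Definition voltage c : {perm 'Z_5} :=
  if c == al then scale5 else if c == ga then shift5 else 1.

(** Coordinates are indexed by all functions, those other than automorphisms being trivial. A
    reversing automorphism exchanges the sides, on which voltages act by inverse elements; the
    inversion compensates for that. *)
Definition total_voltage c g : {perm 'Z_5} :=
  if `[< automorphism g >] then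
    if reversing g then (voltage (g c))^-1 else voltage (g c)
  else 1.

Let vertices : Type := ((T -> T) -> {perm 'Z_5}) * bool.

Definition voltage_step c (z : vertices) : vertices :=
  (fun g => z.1 g * (if z.2 then (total_voltage c g)^-1 else total_voltage c g),
   ~~ z.2).

Lemma voltage_stepK c : facet c -> involutive (voltage_step c).
Proof.
move=> _ [k b]; rewrite /voltage_step /= negbK; congr pair.
by apply/funext => g; case: b; rewrite /= ?mulgK ?mulgKV.
Qed.

Definition voltage_graph : cgraph T :=
  component_graph (par := snd) ((fun=> 1), false) voltage_stepK (fun c z _ => erefl).

(** The word is reversed because [foldr] applies its last letter first. *)
Lemma voltage_walk (w : seq T) (z : vertices) :
  foldr voltage_step z (rev w) =
  (fun g => z.1 g * altprod z.2 (total_voltage^~ g) w, z.2 (+) odd (size w)).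
Proof.
elim: w z => [|c w IH] z /=.
  rewrite addbF [LHS]surjective_pairing; congr pair.
  by apply/funext => g; rewrite mulg1.
rewrite rev_cons -cats1 foldr_cat /= IH /=; congr pair.
  by apply/funext => g; rewrite mulgA.
by case: z.2; case: odd.
Qed.

Lemma total_voltage_comp c g h : automorphism h ->
  total_voltage c (g \o h) =
  if reversing h then (total_voltage (h c) g)^-1 else total_voltage (h c) g.
Proof.
move=> ah; rewrite /total_voltage.
have -> : `[< automorphism (g \o h) >] = `[< automorphism g >].
  apply: asbool_equiv_eq; split=> [agh|ag]; last exact: automorphism_comp.
  have [h' [ah' hK h'K]] := automorphism_inv ah.
  have -> : g = (g \o h) \o h' by apply/funext => x /=; rewrite h'K.
  exact: automorphism_comp.
case: asboolP => [ag|_]; last by rewrite invg1 if_same.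
by rewrite reversing_comp //; case: reversing; case: reversing; rewrite ?invgK.
Qed.

Lemma voltage_graph_aut h : automorphism h ->
  exists2 phi : voltage_graph -> voltage_graph, graph_aut h phi &
    forall Phi z, flag Phi ->
      parity (phi z) = parity z (+) eps Phi (+) eps (h @` Phi).
Proof.
move=> ah; have [h' [ah' hK h'K]] := automorphism_inv ah.
have [c _ fc] : exists2 c, base_flag c & facet c.
  by apply: polytope_flag_rank; [exact: base_flagP | lia].
(* Left multiplication by a constant commutes with the steps. For a reversing [h] this constant
   sends the root to its neighbour across [c], which keeps the image in the component of the
   root. *)
pose k0 g : {perm 'Z_5} := if reversing h then total_voltage c g else 1.
pose phi (z : vertices) : vertices :=
  ((fun g => k0 g * z.1 (g \o h)), z.2 (+) reversing h).
pose psi (z : vertices) : vertices :=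
  ((fun g => (k0 (g \o h'))^-1 * z.1 (g \o h')), z.2 (+) reversing h).
have ghK g : (g \o h) \o h' = g by apply/funext => x /=; rewrite h'K.
have gh'K g : (g \o h') \o h = g by apply/funext => x /=; rewrite hK.
have phiK : cancel phi psi.
  move=> [k b]; rewrite /phi /psi /= -addbA addbb addbF; congr pair.
  by apply/funext => g; rewrite mulKg gh'K.
have psiK : cancel psi phi.
  move=> [k b]; rewrite /phi /psi /= -addbA addbb addbF; congr pair.
  by apply/funext => g; rewrite ghK mulKVg.
have [d z fd|||f af ef] := @component_graph_aut _ _ _ _ snd ((fun=> 1), false)
    voltage_stepK (fun c z _ => erefl) h phi psi ((fun=> 1), false) ah phiK psiK.
- rewrite /phi /voltage_step /=; congr pair; last by case: z.2; case: reversing.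
  apply/funext => g; rewrite mulgA total_voltage_comp //.
  by case: z.2; case: (reversing h); rewrite /= ?invgK.
- exact: component_refl.
- have [rh|rh] := boolP (reversing h); last first.
    have -> : phi ((fun=> 1), false) = ((fun=> 1), false).
      rewrite /phi /= (negbTE rh); congr pair.
      by apply/funext => g; rewrite /k0 (negbTE rh) mulg1.
    exact: component_refl.
  have -> : phi ((fun=> 1), false) = voltage_step c ((fun=> 1), false).
    rewrite /phi /voltage_step /= rh; congr pair.
    by apply/funext => g; rewrite /k0 rh mulg1 mul1g.
  by apply: component_step => //; exact: le0x.
exists f => // Phi z fPhi; rewrite /= ef /phi /=.
rewrite /reversing -addbA; congr (_ (+) _).
by apply: eps_aut => //; exact: base_flagP.
Qed.

(** Steps multiply on the right, so multiplying every coordinate on the left respects all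
    colours. *)
Lemma voltage_graph_trans (x z : voltage_graph) : parity x = parity z ->
  exists2 phi : voltage_graph -> voltage_graph, graph_aut id phi & phi x = z.
Proof.
move=> par_xz.
pose phi (y : vertices) : vertices :=
  ((fun g => (val z).1 g * ((val x).1 g)^-1 * y.1 g), y.2).
pose psi (y : vertices) : vertices :=
  ((fun g => ((val z).1 g * ((val x).1 g)^-1)^-1 * y.1 g), y.2).
have phiK : cancel phi psi.
  by move=> [k b]; congr pair; apply/funext => g /=; rewrite mulKg.
have psiK : cancel psi phi.
  by move=> [k b]; congr pair; apply/funext => g /=; rewrite mulKVg.
have phix : phi (val x) = val z.
  rewrite /phi [RHS]surjective_pairing; congr pair => //.
  by apply/funext => g; rewrite mulgKV.
have [c y fc|||f af ef] := @component_graph_aut _ _ _ _ snd ((fun=> 1), false)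
    voltage_stepK (fun c z _ => erefl) id phi psi (val x) automorphism_id phiK psiK.
- by congr pair; apply/funext => g /=; rewrite mulgA.
- exact: asboolW (valP x).
- by rewrite phix; exact: asboolW (valP z).
by exists f => //; apply: val_inj; rewrite ef.
Qed.

(** When [al] and [ga] are exchanged the shift plays the role of [p]; its commutator with [scale5]
    is again a translation, and translations commute. *)
Lemma shift5_comm : commute shift5 (shift5 * scale5 * shift5^-1 * scale5^-1).
Proof.
have -> : shift5 * scale5 * shift5^-1 * scale5^-1 = shift5^-1.
  apply: (mulgI shift5^-1); rewrite -!mulgA mulKg !mulgA.
  apply: (mulIg (shift5 * shift5)); rewrite -{1}scale5_conj.
  by rewrite !mulgA mulgKV mulgKV mulgV mulgKV mulVg.
exact/commuteV/commute_refl.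
Qed.

Lemma shift5V_comm :
  commute shift5^-1 (shift5^-1 * scale5^-1 * shift5^-1^-1 * scale5^-1^-1).
Proof.
rewrite !invgK -!mulgA; apply: commuteM; first exact: commute_refl.
apply/commute_sym/commuteV; set b := scale5^-1 * _.
have -> : shift5 = b * b.
  by rewrite /b !mulgA mulgK -(mulgA scale5^-1) -scale5_conj !mulgA mulVg mul1g mulgKV.
by apply: commuteM; exact: commute_refl.
Qed.

(** If at most one of [al] and [ga] is sent into this pair, the words [p] and [q] have commuting
    values. If [g] fixes both, it is not reversing, and the relation [scale5_conj] applies. If [g]
    exchanges them, [p] is a translation and commutes with the first commutator, whether [g] is
    reversing or not. *)
Lemma altprod_voltage g :
  altprod false (total_voltage^~ g) (chiral_walk al be ga) = 1.
Proof.
have [ag|nag] := pselect (automorphism g); last first.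
  by apply: altprod1 => c; rewrite /total_voltage; case: asboolP.
have gi := bij_inj ag.1.
rewrite altprod_chiral_walk /= !mulg1.
have tv c : total_voltage c g =
    if reversing g then (voltage (g c))^-1 else voltage (g c).
  by rewrite /total_voltage asboolT.
have triv c : g c \notin [:: al; ga] -> total_voltage c g = 1.
  rewrite tv /voltage !inE negb_or => /andP[/negbTE-> /negbTE->].
  by rewrite invg1 if_same.
have g_al_ga : g al != g ga by apply: contra_neq al_ga; exact: gi.
have [gal|gal] := boolP (g al \in [:: al; ga]); last first.
  rewrite (triv al gal) mul1g.
  have [gga|gga] := boolP (g ga \in [:: al; ga]); last first.
    by rewrite (triv ga gga) mul1g chiral_word_comm //; exact: commute_refl.
  have gbe : g be \notin [:: al; ga].
    by apply/negP => gbe; apply: (be_ga_far ag).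
  by rewrite (triv be gbe) invg1 chiral_word_comm //; apply/commute_sym/commute1.
have gbe : g be \notin [:: al; ga] by apply/negP => gbe; apply: (al_be_far ag).
rewrite (triv be gbe) invg1 !mulg1.
have [gga|gga] := boolP (g ga \in [:: al; ga]); last first.
  by rewrite (triv ga gga) chiral_word_comm //; apply: commute1.
move: gal gga g_al_ga; rewrite !tv !inE /voltage.
have [ea|_] := eqVneq (g al) al => /=.
  have [ea'|_] := eqVneq (g ga) al => /=; first by rewrite ea ea' eqxx.
  move=> _ /eqP eg _; rewrite eg eqxx.
  have -> : reversing g = false.
    rewrite /reversing (al_ga_preserving ag _ ea eg) ?addbb //; exact: base_flagP.
  exact/chiral_word_conj/scale5_conj.
move=> /eqP-> + /negbTE; rewrite [ga == g ga]eq_sym => + ne; rewrite ne orbF => /eqP->.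
rewrite !eqxx.
apply: chiral_word_comm_comm; case: reversing; [exact: shift5V_comm | exact: shift5_comm].
Qed.

(** Started on the other side, the coordinate of the identity sees both generators inverted. The
    multiplier is then 3, and [(3 - 1) (3 - 2)] is not zero modulo 5. *)
Lemma voltage_mirror : altprod true (total_voltage^~ id) (chiral_walk al be ga) != 1.
Proof.
have tv c : total_voltage c id = voltage c.
  by rewrite /total_voltage asboolT ?/reversing ?image_id ?addbb //; exact: automorphism_id.
rewrite altprod_chiral_walk /= !tv !mulg1 /voltage eqxx.
by rewrite [be == al]eq_sym [ga == al]eq_sym (negbTE al_be) (negbTE be_ga) (negbTE al_ga)
  eqxx !mulg1 chiral_word_mirror.
Qed.

Theorem chiral_extension : exists P : polytope r.+1, chiral P /\
  forall F : P, facet F -> isomorphic (Defs.section \bot%O F) T.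
Proof.
exists (ext_polytope voltage_graph); split; last first.
  by move=> F; exact: ext_facet.
have fw c : c \in rev (chiral_walk al be ga) -> facet c.
  rewrite mem_rev => cw; suff : c \in [:: al; be; ga].
    by rewrite !inE => /or3P[] /eqP->.
  move: cw; rewrite /chiral_walk !(mem_cat, mem_rev, inE).
  by do ![case/orP]; move=> ->; rewrite ?orbT.
apply: (ext_chiral eps_adj regT voltage_graph_aut voltage_graph_trans fw).
  apply: val_inj; rewrite comp_walkE // voltage_walk; congr pair.
  by apply/funext => g; rewrite altprod_voltage mulg1.
move=> z; rewrite [in X in X -> _]/= => /eqP par_z.
move=> /(congr1 val); rewrite comp_walkE // voltage_walk => /(congr1 fst).
have -> : (val z).2 = true by case: (_.2) par_z.
move=> /(congr1 (fun k => k id)) /(canRL (mulKg _)); rewrite mulVg => e.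
by have := voltage_mirror; rewrite e eqxx.
Qed.

End ChiralExtension.

(** * Integer affine maps and galleries *)

Local Open Scope ring_scope.

Definition oddz (x : int) : bool := odd `|x|%N.

Section Orthogonal.
Context (n : nat).
Implicit Types (z w t : 'rV[int]_n) (M : 'M[int]_n) (i j k : 'I_n).

Definition orth M := M *m M^T = 1%:M.

Lemma orthT M : orth M -> orth M^T.
Proof. by move=> /mulmx1C; rewrite /orth trmxK. Qed.

Lemma orthM M N : orth M -> orth N -> orth (M *m N).
Proof.
by move=> oM oN; rewrite /orth trmx_mul mulmxA -(mulmxA M) oN mulmx1.
Qed.

Lemma orth1 : orth 1%:M.
Proof. by rewrite /orth trmx1 mulmx1. Qed.

Lemma orth_det M : orth M -> \det M = 1 \/ \det M = -1.
Proof.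
move=> /(congr1 determinant); rewrite det_mulmx det_tr det1 -expr2 => /eqP.
by rewrite sqrf_eq1 => /orP[]/eqP; [left|right].
Qed.

Lemma sum_sqr_eq1 (f : 'I_n -> int) : \sum_i f i ^+ 2 = 1 ->
  exists k, (f k = 1 \/ f k = -1) /\ forall i, i != k -> f i = 0.
Proof.
move=> e; have [k fk] : exists k, f k != 0.
  apply/existsP; apply: contra_eqT e => /existsPn f0.
  by rewrite big1 // => i _; move: (f0 i) => /negbNE/eqP->.
move: e; rewrite (bigD1 k) //= => e.
have r0 : 0 <= \sum_(i | i != k) f i ^+ 2 by apply: sumr_ge0 => i _; exact: sqr_ge0.
have fk0 : 0 < f k ^+ 2 by rewrite lt_neqAle sqr_ge0 eq_sym sqrf_eq0 fk.
have split1 (a b : int) : a + b = 1 -> 0 <= b -> 0 < a -> a = 1 /\ b = 0 by lia.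
have [/eqP fk1 /eqP] := split1 _ _ e r0 fk0.
rewrite psumr_eq0; last by move=> i _; exact: sqr_ge0.
move=> /allP all0; exists k; split; first by move: fk1; rewrite sqrf_eq1 => /orP[]/eqP; [left|right].
move=> i ik; have := all0 i (mem_index_enum _); rewrite ik /=.
by rewrite sqrf_eq0 => /eqP.
Qed.

(** Each column of an integral orthogonal matrix is a unit vector, so it has one nonzero entry,
    equal to 1 or -1; orthogonality of distinct columns puts these entries in distinct rows. *)
Lemma orth_perm M : orth M -> exists (s : 'S_n) (e : 'I_n -> int),
  (forall j, e j = 1 \/ e j = -1) /\
  forall z j, (z *m M) 0 j = e j * z 0 (s j).
Proof.
move=> /orthT; rewrite /orth trmxK => oM.
have colP j : exists i, (M i j = 1 \/ M i j = -1) /\ forall l, l != i -> M l j = 0.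
  apply: sum_sqr_eq1; have /matrixP/(_ j j) := oM.
  rewrite !mxE eqxx => oM'; apply: etrans oM'.
  by apply: eq_bigr => i _; rewrite !mxE expr2.
pose s j := projT1 (cid (colP j)).
have sP j : (M (s j) j = 1 \/ M (s j) j = -1) /\ forall l, l != s j -> M l j = 0.
  by rewrite /s; case: cid.
have s_inj : injective s.
  move=> j k e; apply/eqP; apply: contraT => jk.
  have /matrixP/(_ j k) := oM; rewrite !mxE (negbTE jk) (bigD1 (s j)) //= big1.
    rewrite addr0 !mxE; have [] := sP j; have [] := sP k; rewrite -e.
    by move=> [] -> _ [] -> _.
  by move=> i ij; rewrite mxE (sP j).2 // mul0r.
exists (perm s_inj), (fun j => M (s j) j); split=> [j|z j]; first by case: (sP j).
rewrite permE mxE (bigD1 (s j)) //= big1 ?addr0 1?mulrC // => i ij.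
by rewrite (sP j).2 // mulr0.
Qed.

End Orthogonal.

Section Cells.
Context (n : nat).
Implicit Types (z w t : 'rV[int]_n) (M : 'M[int]_n) (i j k : 'I_n).

(* Unlike [rowP] and [mxE], the next three lemmas produce entries typed in [int]
   itself rather than in an additive structure on [int], as [lia] requires. *)
Lemma int_rowP z w : (forall i, z 0 i = w 0 i) <-> z = w.
Proof. by split=> [e|-> //]; apply/rowP. Qed.

Lemma rowD z w i : (z + w) 0 i = z 0 i + w 0 i.
Proof. by rewrite mxE. Qed.

Lemma rowN z i : (- z) 0 i = - z 0 i.
Proof. by rewrite mxE. Qed.

(* [z] stands for the cell of the cubic tessellation with centre [z / 2] *)
Definition leZ z w : bool :=
  [forall i, (z 0 i == w 0 i) || oddz (w 0 i) && (`|w 0 i - z 0 i| == 1)].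

Lemma leZP z w : reflect
  (forall i, z 0 i = w 0 i \/
     oddz (w 0 i) /\ ~~ oddz (z 0 i) /\ `|w 0 i - z 0 i| = 1)
  (leZ z w).
Proof.
apply: (iffP forallP) => h i.
  have /orP[/eqP|/andP[o /eqP d]] := h i; [by left|right; do 2!split=> //].
  by rewrite /oddz in o *; lia.
by have [->|[-> [_ ->]]] := h i; rewrite ?eqxx // orbT.
Qed.

Lemma leZ_refl z : leZ z z.
Proof. by apply/leZP => i; left. Qed.

Lemma leZ_trans w z t : leZ z w -> leZ w t -> leZ z t.
Proof.
move=> /leZP zw /leZP wt; apply/leZP => i.
have [->|[ow [oz d]]] := zw i; first exact: wt.
by have [<-|[_ []]] := wt i; [right | rewrite ow].
Qed.

(** These are the directions in which the cell of [z] extends, which makes [dim] its dimension. *)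
Definition odds z : {set 'I_n} := [set i | oddz (z 0 i)]%SET.

Definition dim z := #|odds z|.

Lemma leZ_sub z w : leZ z w ->
  odds z \subset odds w.
Proof.
move=> /leZP zw; apply/fintype.subsetP => i; rewrite !inE.
by rewrite /=; have [->|[-> [/negbTE->]]] := zw i.
Qed.

Lemma leZ_dim z w : leZ z w -> (dim z <= dim w)%N.
Proof. by move=> /leZ_sub; exact: subset_leq_card. Qed.

Lemma leZ_eq z w : leZ z w -> dim z = dim w -> z = w.
Proof.
move=> zw e; have /eqP eS : odds z == odds w by rewrite eqEcard leZ_sub //= -/(dim w) -e.
apply/rowP => i; have /leZP/(_ i)[//|[ow [oz _]]] := zw.
by have : i \in odds z; [rewrite eS /odds inE | rewrite /odds inE (negbTE oz)].
Qed.

Lemma dim_le z : (dim z <= n)%N.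
Proof. by rewrite -[n in leqRHS]card_ord; exact: max_card. Qed.

Definition even_row t := forall i, ~~ oddz (t 0 i).

Lemma even_rowD s t : even_row s -> even_row t -> even_row (s + t).
Proof.
by move=> es et i; rewrite rowD; have := es i; have := et i; rewrite /oddz; lia.
Qed.

Lemma leZ_translate t z w : even_row t -> leZ (z + t) (w + t) = leZ z w.
Proof.
have h x y s : even_row s -> leZ x y -> leZ (x + s) (y + s).
  move=> es /leZP xy; apply/leZP => i; rewrite !rowD.
  by have := xy i; have := es i; rewrite /oddz; lia.
move=> et; apply/idP/idP => [zw|]; last exact: h.
rewrite -[z](addrK t) -[w](addrK t); apply: h => // i.
by rewrite rowN; have := et i; rewrite /oddz; lia.
Qed.

Lemma leZ_dist_below z w t : leZ z w -> leZ t w -> forall i, `|z 0 i - t 0 i| <= 2.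
Proof. by move=> /leZP zw /leZP tw i; have := zw i; have := tw i; lia. Qed.

Lemma leZ_dist_above z w t : leZ w z -> leZ w t -> forall i, `|z 0 i - t 0 i| <= 2.
Proof. by move=> /leZP zw /leZP tw i; have := zw i; have := tw i; lia. Qed.

Definition aff : Type := 'rV[int]_n * 'M[int]_n.
Implicit Types (u v : aff).

Definition act u z : 'rV[int]_n := u.1 + z *m u.2.
(** In doubled coordinates a translation by an integral vector [t] reads [2 t], hence the parity
    condition on [u.1]. *)
Definition affine u := even_row u.1 /\ orth u.2.
Definition amul u v : aff := (u.1 + v.1 *m u.2, v.2 *m u.2).
Definition ainv u : aff := (- (u.1 *m u.2^T), u.2^T).
Definition aid : aff := (0, 1%:M).

Lemma act_mul u v z : act (amul u v) z = act u (act v z).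
Proof. by rewrite /act /= mulmxDl mulmxA addrA. Qed.

Lemma act_id z : act aid z = z.
Proof. by rewrite /act add0r mulmx1. Qed.

Lemma mula1 u : amul u aid = u.
Proof. by rewrite /amul mul0mx addr0 mul1mx; case: u. Qed.

Lemma a1mul u : amul aid u = u.
Proof. by rewrite /amul /= add0r !mulmx1; case: u. Qed.

Lemma amulA u v (x : aff) : amul u (amul v x) = amul (amul u v) x.
Proof. by rewrite /amul /= mulmxDl !mulmxA addrA. Qed.

Lemma even_mul t M : orth M -> even_row t -> even_row (t *m M).
Proof.
move=> /orth_perm[s [e [es sE]]] et i; rewrite sE; have := et (s i).
by rewrite /oddz; case: (es i) => ->; lia.
Qed.

Lemma affine_mul u v : affine u -> affine v -> affine (amul u v).
Proof.
move=> [eu ou] [ev ov]; split; last exact: orthM.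
move=> i; rewrite rowD; have := eu i; have := even_mul ou ev i.
by rewrite /oddz; lia.
Qed.

Lemma affine_inv u : affine u -> affine (ainv u).
Proof.
move=> [eu ou]; split; last exact: orthT.
move=> i; rewrite rowN; have := even_mul (orthT ou) eu i.
by rewrite /oddz; lia.
Qed.

Lemma affine_id : affine aid.
Proof. by split; [move=> i; rewrite mxE | exact: orth1]. Qed.

Lemma mulVa u : affine u -> amul (ainv u) u = aid.
Proof. by move=> [_ ou]; rewrite /amul /ainv /= addNr ou. Qed.

Lemma mulaV u : affine u -> amul u (ainv u) = aid.
Proof.
move=> [_ ou]; rewrite /amul /ainv /= mulNmx -mulmxA.
by rewrite (mulmx1C ou) mulmx1 subrr.
Qed.

Lemma actK u z : affine u -> act (ainv u) (act u z) = z.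
Proof. by move=> au; rewrite -act_mul mulVa // act_id. Qed.

Lemma act_perm u : affine u -> exists (s : 'S_n) (e : 'I_n -> int),
  (forall j, e j = 1 \/ e j = -1) /\
  forall z j, act u z 0 j = u.1 0 j + e j * z 0 (s j).
Proof.
move=> [_ /orth_perm[s [e [es sE]]]]; exists s, e; split=> // z j.
by rewrite rowD sE.
Qed.

Lemma act_leZ u z w : affine u -> leZ (act u z) (act u w) = leZ z w.
Proof.
have h v x y : affine v -> leZ x y -> leZ (act v x) (act v y).
  move=> av /leZP xy; have [s [e [es sE]]] := act_perm av.
  apply/leZP => j; rewrite !sE; have := av.1 j; have := xy (s j).
  by rewrite /oddz; case: (es j) => ->; lia.
move=> au; apply/idP/idP; last exact: h.
by move=> /(h _ _ _ (affine_inv au)); rewrite !actK.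
Qed.

Lemma act_dim u z : affine u -> dim (act u z) = dim z.
Proof.
move=> au; have [s [e [es sE]]] := act_perm au.
rewrite /dim -[RHS](card_preimset _ (@perm_inj _ s)); congr #|pred_of_set _|.
apply/setP => j; rewrite !inE sE; have := au.1 j.
by rewrite /oddz; case: (es j) => ->; lia.
Qed.

(** The cells [omega 0], ..., [omega n] form the base flag, from the vertex at the origin to the
    unit cube. *)
Definition omega (j : nat) : 'rV[int]_n := \row_i (i < j)%N%:R.

Lemma dim_omega (j : nat) : (j <= n)%N -> dim (omega j) = j.
Proof.
move=> jn; rewrite /dim -sum1_card (eq_bigl (fun i : 'I_n => (i < j)%N)).
  by rewrite -(big_ord_widen _ (fun=> 1%N)) // sum1_card card_ord.
by move=> i; rewrite /odds inE mxE; case: ltnP.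
Qed.

Lemma leZ_omega (i j : nat) : (i <= j)%N -> leZ (omega i) (omega j).
Proof.
move=> ij; apply/leZP => k; rewrite !mxE /oddz.
by case: (ltnP k i) => ki; case: (ltnP k j) => kj; [left|lia|right|left].
Qed.

End Cells.

(** * Reflections in the walls of the base flag *)

Section Reflections.
Context (m : nat).
Local Notation n := m.+1.
Implicit Types (z w t y : 'rV[int]_n) (u v : aff n) (i j : nat) (k l : 'I_n).

Lemma aff_ext u v : (forall z, act u z = act v z) -> u = v.
Proof.
move=> e; have e1 : u.1 = v.1 by have := e 0; rewrite /act !mul0mx !addr0.
rewrite [u]surjective_pairing [v]surjective_pairing e1; congr pair.
apply/row_matrixP => k; have := e (delta_mx 0 k).
by rewrite /act e1 => /addrI; rewrite -!rowE.
Qed.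

Definition flip k : 'M[int]_n := diag_mx (\row_l (if l == k then -1 else 1)).

(* The reflections in the walls of the flag of the [omega j]; the one of index
   [i] moves only [omega i]. *)
Definition refl i : aff n :=
  if i == 0%N then (\row_k (if k == ord0 then 2 else 0), flip ord0)
  else if i == n then (0, flip ord_max)
  else (0, tperm_mx (inord i.-1) (inord i)).

Lemma mul_flip z k l : (z *m flip k) 0 l = if l == k then - z 0 l else z 0 l.
Proof. by rewrite mul_mx_diag !mxE; case: eqP => _; rewrite ?mulrN1 ?mulr1. Qed.

Lemma refl_act i z k : act (refl i) z 0 k =
  if i == 0%N then (if k == ord0 then 2 - z 0 k else z 0 k)
  else if i == n then (if k == ord_max then - z 0 k else z 0 k)
  else z 0 (tperm (inord i.-1) (inord i) k).
Proof.
rewrite /refl; case: eqP => _.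
  by rewrite /act rowD mul_flip mxE /=; case: eqP => _; rewrite ?add0r.
case: eqP => _; first by rewrite /act add0r mul_flip.
by rewrite /act add0r -xcolE !mxE.
Qed.

Lemma flip_orth k : orth (flip k).
Proof.
rewrite /orth /flip tr_diag_mx mulmx_diag -diag_const_mx; congr diag_mx.
by apply/rowP => l; rewrite !mxE; case: eqP => _; rewrite ?mulr1 ?mulrNN ?mulr1.
Qed.

Lemma tperm_orth k l : orth (tperm_mx k l : 'M[int]_n).
Proof. by rewrite /orth /tperm_mx tr_perm_mx -perm_mxM mulgV perm_mx1. Qed.

Lemma refl_affine i : affine (refl i).
Proof.
rewrite /refl; case: eqP => _.
  by split=> [k|] /=; [rewrite mxE; case: eqP | exact: flip_orth].
by case: eqP => _; split=> [k|] /=;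
  [rewrite mxE | exact: flip_orth | rewrite mxE | exact: tperm_orth].
Qed.

Lemma refl_omega i j : (i <= n)%N -> (j <= n)%N -> i != j -> act (refl i) (omega _ j) = omega _ j.
Proof.
move=> i_n j_n ij; apply/rowP => k; rewrite refl_act !mxE.
have [i0|i0] := eqVneq i 0%N.
  case: eqP => [->|//]; suff -> : ((ord0 : 'I_n) < j)%N by [].
  by move: ij; rewrite i0 /=; lia.
have [ei|ne] := eqVneq i n.
  case: eqP => [->|//]; suff -> : ((ord_max : 'I_n) < j)%N = false by rewrite oppr0.
  by apply: negbTE; rewrite -leqNgt /=; lia.
by case: tpermP => [->|->|//]; rewrite !inordK; try lia; congr (_%:R); lia.
Qed.

Lemma refl_omega_neq i : (i <= n)%N -> act (refl i) (omega _ i) != omega _ i.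
Proof.
move=> i_n; apply/eqP => /rowP e.
have [i0|i0] := eqVneq i 0%N.
  by have := e ord0; rewrite refl_act i0 !mxE.
have [ei|ne] := eqVneq i n.
  by have := e ord_max; rewrite refl_act (negbTE i0) ei eqxx !mxE eqxx /= ltnSn.
have := e (inord i); rewrite refl_act (negbTE i0) (negbTE ne) tpermR !mxE !inordK; lia.
Qed.

Lemma refl_reflK i : (i <= n)%N -> amul (refl i) (refl i) = aid n.
Proof.
move=> i_n; apply: aff_ext => z; rewrite act_mul act_id; apply/rowP => k.
rewrite !refl_act; case: eqP => _; first by case: eqP => _; lia.
case: eqP => _; first by case: eqP => _; lia.
by rewrite tpermK.
Qed.

Lemma det_flip k : \det (flip k) = -1.
Proof.
rewrite /flip det_diag (bigD1 k) //= !mxE eqxx big1 ?mulr1 // => l lk.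
by rewrite mxE (negbTE lk).
Qed.

Lemma refl_det i : (i <= n)%N -> \det (refl i).2 = -1.
Proof.
move=> i_n; rewrite /refl; case: eqP => [_|/eqP i0]; first exact: det_flip.
case: eqP => [_|/eqP ne]; first exact: det_flip.
rewrite /= /tperm_mx det_perm odd_tperm; case: eqP => [/(congr1 val)|//].
by rewrite /= !inordK; lia.
Qed.

(** A positive multiple of the barycentre of the flag, kept integral by summing instead of
    averaging. *)
Definition bary u : 'rV[int]_n := \sum_(j < n.+1) act u (omega _ j).

Lemma baryE u k : bary u 0 k = \sum_(j < n.+1) act u (omega _ j) 0 k.
Proof. by rewrite summxE. Qed.

Lemma sum_omega k : \sum_(j < n.+1) omega n j 0 k = n%:Z - k%:Z.
Proof.
have h p : \sum_(j < p) ((k < j)%N%:R : int) = (p - k.+1)%N%:Z.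
  elim: p => [|p IH]; first by rewrite big_ord0.
  by rewrite big_ord_recr /= IH; case: ltnP => /=; lia.
under eq_bigr do rewrite mxE.
by rewrite h; have := ltn_ord k; lia.
Qed.

Lemma bary_perm u : affine u -> exists (s : 'S_n) (e : 'I_n -> int),
  [/\ forall k, e k = 1 \/ e k = -1,
      forall z k, act u z 0 k = u.1 0 k + e k * z 0 (s k) &
      forall k, bary u 0 k = n.+1%:Z * u.1 0 k + e k * (n%:Z - (s k)%:Z)].
Proof.
move=> /act_perm[s [e [es sE]]]; exists s, e; split=> // k.
rewrite baryE; under eq_bigr do rewrite sE.
rewrite big_split /= -big_distrr /= sum_omega sumr_const card_ord.
by rewrite -mulr_natl natz.
Qed.

Lemma bary_refl i u k : bary (amul (refl i) u) 0 k =
  if i == 0%N then (if k == ord0 then 2 * n.+1%:Z - bary u 0 k else bary u 0 k)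
  else if i == n then (if k == ord_max then - bary u 0 k else bary u 0 k)
  else bary u 0 (tperm (inord i.-1) (inord i) k).
Proof.
rewrite !baryE; under eq_bigr do rewrite act_mul refl_act.
case: eqP => _; first case: eqP => // _.
  by rewrite big_split /= sumrN sumr_const card_ord; congr (_ - _); lia.
by case: eqP => // _; case: eqP => // _; rewrite sumrN.
Qed.

(** In the scale of [bary] the base flag spans the chamber [n + 1 > y_0 > y_1 > ... > y_(n-1) > 0];
    the condition puts [y] strictly beyond the wall of index [i]. *)
Definition wall_neg i y : bool :=
  if i == 0%N then n.+1%:Z < y 0 ord0 else if i == n then y 0 ord_max < 0
  else y 0 (inord i.-1) < y 0 (inord i).

(** The vector with entries [n - k] is [bary] of the base flag, by [sum_omega]. *)
Definition bary_dist y : int := \sum_(k < n) (y 0 k - (n%:Z - k%:Z)) ^+ 2.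

Lemma bary_dist_ge0 y : 0 <= bary_dist y.
Proof. by apply: sumr_ge0 => k _; exact: sqr_ge0. Qed.

Lemma bary_dist_refl i u : (i <= n)%N -> wall_neg i (bary u) ->
  bary_dist (bary (amul (refl i) u)) < bary_dist (bary u).
Proof.
move=> i_n; rewrite /wall_neg /bary_dist; set y := bary u.
have [i0|i0] := eqVneq i 0%N.
  move=> y0; rewrite [ltLHS](bigD1 ord0) // [ltRHS](bigD1 ord0) //=.
  apply: ltr_leD; last first.
    by apply: ler_sum => k k0; rewrite bary_refl i0 /= (negbTE k0).
  by rewrite bary_refl i0 !eqxx -/y; move: y0; rewrite !expr2; nia.
have [ei|ne] := eqVneq i n.
  move=> y0; rewrite [ltLHS](bigD1 ord_max) // [ltRHS](bigD1 ord_max) //=.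
  apply: ltr_leD; last first.
    by apply: ler_sum => k k0; rewrite bary_refl (negbTE i0) ei eqxx /= (negbTE k0).
  by rewrite bary_refl (negbTE i0) ei !eqxx -/y; move: y0; rewrite /= !expr2; nia.
set a := inord i.-1; set b := inord i => yab.
have ab : b != a by apply/eqP => /(congr1 val); rewrite /= !inordK; lia.
rewrite [ltLHS](bigD1 a) // [ltRHS](bigD1 a) //=.
rewrite [X in _ + X < _](bigD1 b) //= [X in _ < _ + X](bigD1 b) //=.
rewrite !addrA; apply: ltr_leD; last first.
  apply: ler_sum => k /andP[ka kb].
  by rewrite bary_refl (negbTE i0) (negbTE ne) tpermD // eq_sym.
rewrite !bary_refl (negbTE i0) (negbTE ne) tpermL tpermR -/y.
have eab : (b : nat)%:Z = a%:Z + 1 by rewrite /= !inordK; lia.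
move: yab; rewrite eab; move: (y 0 a) (y 0 b) (a%:Z) => p q c pq.
by rewrite !expr2; nia.
Qed.

(** All cells of the image flag are incident with [omega i]. The inequality of wall [i] holds for
    every cell incident with [omega i], hence for the sum. *)
Lemma wall_pos i u : (i <= n)%N -> affine u -> act u (omega n i) = omega n i ->
  ~~ wall_neg i (bary u).
Proof.
move=> i_n au fix_i; rewrite /wall_neg.
have le_i (j : 'I_n.+1) : leZ (act u (omega n j)) (omega n i) \/
    leZ (omega n i) (act u (omega n j)).
  have [ji|/ltnW ij] := leqP j i; [left|right].
    by rewrite -[X in leZ _ X]fix_i act_leZ //; apply: leZ_omega.
  by rewrite -[X in leZ X _]fix_i act_leZ //; apply: leZ_omega.
have oi k : omega n i 0 k = (k < i)%N%:R by rewrite mxE.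
have [i0|i0] := eqVneq i 0%N.
  have -> : n.+1%:Z = \sum_(j < n.+1) 1 by rewrite sumr_const card_ord natz.
  rewrite -leNgt baryE; apply: ler_sum => j _.
  by have [/leZP/(_ ord0)|/leZP/(_ ord0)] := le_i j; rewrite oi i0 /= /oddz; lia.
have [ei|ne] := eqVneq i n.
  rewrite -leNgt baryE; apply: sumr_ge0 => j _.
  by have [/leZP/(_ ord_max)|/leZP/(_ ord_max)] := le_i j;
    rewrite oi ei /= ltnSn /oddz; lia.
rewrite -leNgt !baryE; apply: ler_sum => j _.
have oa : omega n i 0 (inord i.-1) = 1.
  rewrite oi inordK; last by lia.
  by have -> : (i.-1 < i)%N by lia.
have ob : omega n i 0 (inord i) = 0 by rewrite oi inordK ?ltnn //; lia.
by have [/leZP le|/leZP le] := le_i j;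
  move: (le (inord i)) (le (inord i.-1)); rewrite oa ob /oddz; lia.
Qed.

Lemma even_half (x : int) : ~~ oddz x -> exists h, x = 2 * h.
Proof. by rewrite /oddz => ex; exists (x %/ 2)%Z; lia. Qed.

Lemma mul_lt_eq0 (a b : int) : `|a * b| < a -> b = 0.
Proof.
move=> h; have a0 : 0 < a by apply: le_lt_trans h.
by move: h; rewrite normrM gtr0_norm // -[ltRHS]mulr1 ltr_pM2l //; lia.
Qed.

(** Modulo [2 (n + 1)] entry [k] is [e k] times [n - s k], a number between 1 and [n]. Hence no wall
    inequality is an equality: no entry is 0 or [n + 1], and no two entries agree. Strictly
    decreasing integers from at most [n] to at least 1 are [n], ..., 1, and these values determine
    translation, signs and permutation. *)
Lemma bary_eq u : affine u -> (forall i, (i <= n)%N -> ~~ wall_neg i (bary u)) ->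
  u = aid n.
Proof.
move=> au wall; have [s [e [es sE yE]]] := bary_perm au.
set y := bary u in wall yE.
have /choice[t tE] : forall k, exists h, u.1 0 k = 2 * h.
  by move=> k; apply: even_half (au.1 k).
have {}yE k : y 0 k = n.+1%:Z * (2 * t k) + e k * (n%:Z - (s k)%:Z) by rewrite yE tE.
have s_lt k := ltn_ord (s k).
have y0 : y 0 ord0 <= n%:Z.
  have := wall 0%N isT; rewrite /wall_neg /= -leNgt => le.
  suff ne : y 0 ord0 <> n.+1%:Z by lia.
  rewrite yE => eq; have : 2 * t ord0 - 1 = 0; last by lia.
  apply: (@mul_lt_eq0 n.+1%:Z); rewrite mulrBr.
  by have := s_lt ord0; case: (es ord0) eq => ->; lia.
have ymax : 1 <= y 0 ord_max.
  have := wall n (leqnn _); rewrite /wall_neg /= eqxx -leNgt => le.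
  suff ne : y 0 ord_max <> 0 by lia.
  rewrite yE => eq; have t0 : 2 * t ord_max = 0.
    apply: (@mul_lt_eq0 n.+1%:Z).
    by have := s_lt ord_max; case: (es ord_max) eq => ->; lia.
  by move: eq; rewrite t0; have := s_lt ord_max; case: (es ord_max) => ->; lia.
have ystep i : (0 < i < n)%N -> y 0 (inord i) + 1 <= y 0 (inord i.-1).
  move=> i_n; have := wall i; rewrite /wall_neg.
  have /negbTE-> : i != 0%N by lia.
  have /negbTE-> : i != n by lia.
  set a := inord i.-1; set b := inord i => /(_ _); rewrite -leNgt => le.
  suff ne : y 0 a <> y 0 b by have := le ltac:(lia); lia.
  have ab : a != b by apply/eqP => /(congr1 val); rewrite /= !inordK; lia.
  have sab : (s a : nat) <> s b by move=> /val_inj/perm_inj/eqP; rewrite (negbTE ab).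
  rewrite !yE => eq; have t0 : t a - t b = 0.
    apply: (@mul_lt_eq0 (2 * n.+1%:Z)); rewrite mulrBr.
    by have := s_lt a; have := s_lt b; case: (es a) eq => ->; case: (es b) => ->; lia.
  have tab : t a = t b by lia.
  by move: eq; rewrite tab; have := s_lt a; have := s_lt b;
    case: (es a) => ->; case: (es b) => ->; lia.
have up i : (i < n)%N -> y 0 (inord i) <= n%:Z - i%:Z.
  elim: i => [|i IH] i_n; first by rewrite (_ : inord 0 = ord0) ?subr0 //; apply: val_inj; rewrite /= inordK.
  by have := ystep i.+1; have := IH; rewrite /=; lia.
have lo i : (i < n)%N -> i%:Z + 1 <= y 0 (inord (m - i)%N).
  elim: i => [|i IH] i_n.
    by rewrite subn0 (_ : inord m = ord_max) //; apply: val_inj; rewrite /= inordK.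
  have := ystep (m - i)%N; have := IH.
  by rewrite (_ : (m - i).-1 = m - i.+1)%N; lia.
have yP k : y 0 k = n%:Z - k%:Z.
  have := up k (ltn_ord k); rewrite inord_val => le1.
  have := lo (m - k)%N; have k_n := ltn_ord k.
  rewrite (_ : (m - (m - k)) = k)%N; last by lia.
  by rewrite inord_val; lia.
have main k : t k = 0 /\ e k = 1 /\ s k = k.
  have := yP k; rewrite yE => eq; have k_n := ltn_ord k.
  have t0 : t k = 0.
    apply: (@mul_lt_eq0 (2 * n.+1%:Z)).
    by have := s_lt k; case: (es k) eq => ->; lia.
  move: eq; rewrite t0 !mulr0 add0r; have := s_lt k.
  case: (es k) => ->; last by lia.
  by move=> _ eq; do 2!split=> //; apply: val_inj => /=; lia.
apply: aff_ext => z; apply/rowP => k; rewrite act_id sE tE.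
by have [-> [-> ->]] := main k; lia.
Qed.

(* Galleries: an affine map other than the identity moves the barycentre of the
   fundamental flag behind one of its walls, reflecting in that wall brings it
   nearer, and the wall contains every vertex fixed by the map. *)
Lemma affine_ind (J : pred nat) (Q : aff n -> Prop) :
  Q (aid n) ->
  (forall u i, affine u -> (i <= n)%N -> ~~ J i -> Q u -> Q (amul (refl i) u)) ->
  forall u, affine u ->
    (forall j, (j <= n)%N -> J j -> act u (omega _ j) = omega _ j) -> Q u.
Proof.
move=> Q1 Qr u; have [N] := ubnP `|bary_dist (bary u)|%N.
elim: N u => [//|N IH] u u_lt au fixu.
have [[i [i_n wi]]|none] := pselect (exists i, (i <= n)%N /\ wall_neg i (bary u)).
  have Ji : ~~ J i.
    by apply: contraL wi => Ji; apply: wall_pos => //; apply: fixu.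
  have au' := affine_mul (refl_affine i) au.
  rewrite -[u](_ : amul (refl i) (amul (refl i) u) = u); last first.
    by rewrite amulA refl_reflK // a1mul.
  apply: Qr => //; apply: IH => // [|j j_n Jj].
    have := bary_dist_refl i_n wi; have := bary_dist_ge0 (bary u).
    by have := bary_dist_ge0 (bary (amul (refl i) u)); lia.
  rewrite act_mul fixu // refl_omega //.
  by apply: contraNneq Ji => ->.
rewrite (bary_eq au) // => i i_n; apply/negP => wi; apply: none; by exists i.
Qed.

End Reflections.

(** * Faces of a toroid *)

Definition halfz (x : int) : int := (x %/ 2)%Z.

Section ToroidFaces.
Context (R : realType) (n : nat) (B : 'M[R]_n).
Implicit Types (z w t : 'rV[int]_n) (i : 'I_n) (O : toroid B).

Definition cell_cube z : set 'rV[R]_n := cube (\row_i halfz (z 0 i)) (odds z).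

Lemma cell_cubeP z (x : 'rV[R]_n) : cell_cube z x <-> forall i,
  if oddz (z 0 i) then ((halfz (z 0 i))%:~R <= x 0 i <= (halfz (z 0 i) + 1)%:~R : Prop)
  else x 0 i = (halfz (z 0 i))%:~R.
Proof.
by split=> h i; have := h i; rewrite inE mxE; case: oddz => // /eqP.
Qed.

Lemma cell_tessellation z : tessellation (cell_cube z : set 'rV[R]_n).
Proof. by apply: Or32; do 2!eexists. Qed.

Lemma cubeE (a : 'rV[int]_n) (S : {set 'I_n}) :
  cube a S = cell_cube (\row_i (2 * a 0 i + (i \in S)%:R)) :> set 'rV[R]_n.
Proof.
rewrite /cell_cube; congr cube.
  apply/rowP => i; rewrite !mxE; move: (a 0 i) => b.
  by rewrite /halfz; case: (i \in S) => /=; lia.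
apply/setP => i; rewrite /odds inE mxE; move: (a 0 i) => b.
by case: (i \in S); rewrite /oddz /halfz /=; lia.
Qed.

Lemma cell_cube_corner z (e : bool) :
  cell_cube z (\row_i (halfz (z 0 i) + (e && oddz (z 0 i))%:R)%:~R).
Proof.
apply/cell_cubeP => i; rewrite mxE; case: oddz; rewrite ?andbF ?addr0 //.
by rewrite !ler_int; rewrite /halfz; case: e => /=; lia.
Qed.

(** The corner with the smallest coordinates and the one with the largest suffice to test an
    inclusion. *)
Lemma cell_cube_sub z w : (cell_cube z `<=` cell_cube w) <-> leZ z w.
Proof.
split=> [sub|/leZP zw x /cell_cubeP xz]; last first.
  apply/cell_cubeP => i; have := xz i; have [->//|[ow [/negbTE oz d]]] := zw i.
  rewrite ow oz => ->; rewrite !ler_int; move: ow oz d; rewrite /oddz /halfz.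
  by move: (z 0 i) (w 0 i) => a b; lia.
apply/leZP => i.
have /cell_cubeP/(_ i) := sub _ (cell_cube_corner z false).
have /cell_cubeP/(_ i) := sub _ (cell_cube_corner z true).
rewrite !mxE /= addr0; move: (z 0 i) (w 0 i) => a b.
rewrite /oddz /halfz; case: ifP => ob.
  by rewrite !ler_int; case ea : (odd _) => /=; lia.
by move=> /intr_inj + /intr_inj; case ea : (odd _) => /=; lia.
Qed.

Lemma translate_cell z t :
  translate (map_mx intr t) (cell_cube z) = cell_cube (z + 2 *: t).
Proof.
have zt i : (z + 2 *: t) 0 i = z 0 i + 2 * t 0 i by rewrite !mxE.
have o i : oddz (z 0 i + 2 * t 0 i) = oddz (z 0 i) by rewrite /oddz /halfz; lia.
have q i : halfz (z 0 i + 2 * t 0 i) = halfz (z 0 i) + t 0 i by rewrite /halfz; lia.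
apply/seteqP; split=> [_ [x /cell_cubeP xz <-]|x /cell_cubeP xz].
  apply/cell_cubeP => i; rewrite zt o q; have := xz i; rewrite !mxE.
  case: oddz => [|->]; last by rewrite intrD.
  by rewrite (addrAC _ _ 1) 2!(intrD _ _ (t 0 i)) !lerD2r.
exists (x - map_mx intr t); last by rewrite subrK.
apply/cell_cubeP => i; have := xz i; rewrite zt o q !mxE.
case: oddz => [|->]; last by rewrite intrD addrK.
by rewrite lerBrDr lerBlDr -!intrD (addrAC _ 1).
Qed.

Lemma cell_cube_neq0 z : cell_cube z <> set0.
Proof. by move=> e; have := cell_cube_corner z false; rewrite e. Qed.

Definition face z : toroid B := toroid_face B (cell_tessellation z).

Definition lat t : Prop := lattice B (map_mx intr t).

Lemma lat0 : lat 0.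
Proof. by rewrite /lat map_mx0; exact: lattice0. Qed.

Lemma latB s t : lat s -> lat t -> lat (s - t).
Proof. by rewrite /lat map_mxB; exact: latticeB. Qed.

Lemma latN t : lat t -> lat (- t).
Proof. by rewrite -sub0r; apply: latB; exact: lat0. Qed.

Lemma latD s t : lat s -> lat t -> lat (s + t).
Proof. by move=> Ls Lt; rewrite -[t]opprK; apply: latB => //; exact: latN. Qed.

Lemma toroid_cases O : O = \bot%O \/ O = \top%O \/ exists z, O = face z.
Proof.
have := valP O; rewrite inE => -[X [->|[a [S ->]]|->] eX].
- by left; apply: val_inj.
- right; right; rewrite cubeE in eX; eexists; apply: val_inj; exact: esym eX.
- by right; left; apply: val_inj.
Qed.

Hypothesis cubicB : cubic_lattice B.

(** A generator moves the vertex at the origin to a face of the tessellation. That face is a single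
    point, so it is an integral vertex. *)
Lemma lattice_int s : lattice B s -> exists t, s = map_mx intr t.
Proof.
have rowB i : exists a, row i B = map_mx intr a.
  have : (translate (row i B) @` tessellation) (translate (row i B) (cell_cube 0)).
    by exists (cell_cube 0) => //; exact: cell_tessellation.
  rewrite cubicB.2 => -[e|[a [S e]]|e].
  - exfalso; apply: (cell_cube_neq0 (z := 0)); apply/seteqP; split=> // x x0.
    have : translate (row i B) (cell_cube 0) (x + row i B) by exists x.
    by rewrite e.
  - exists a; have : cube a S (map_mx intr a : 'rV[R]_n).
      by move=> j; rewrite mxE; case: ifP => // _; rewrite lexx ler_int lerDl.
    rewrite -e => -[x x0 <-]; rewrite (_ : x = 0) ?add0r //.
    apply/rowP => j; have /cell_cubeP/(_ j) := x0; rewrite !mxE /=.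
    by rewrite /halfz div0z.
  - have : translate (row i B) (cell_cube 0) (row i B + const_mx 1) by rewrite e.
    move=> [x /cell_cubeP x0] /rowP/(_ i); rewrite !mxE addrC => /addrI.
    have := x0 i; rewrite !mxE /= /halfz div0z => -> /eqP.
    by rewrite eq_sym oner_eq0.
have /choice[a aE] := rowB.
move=> [z _ <-]; exists (z *m (\matrix_i a i)).
rewrite map_mxM; congr mulmx; apply/row_matrixP => i.
by rewrite aE -map_row rowK.
Qed.

Lemma face_le z w : (face z <= face w)%O <-> exists2 t, lat t & leZ (z + 2 *: t) w.
Proof.
split=> [/asboolP[X [Y [[s Ls <-] [s' Ls' <-]]]]|[t Lt zw]].
  have [t et] := lattice_int Ls; have [t' et'] := lattice_int Ls'.
  rewrite et et' !translate_cell => /cell_cube_sub le.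
  exists (t - t'); first by apply: latB; rewrite /lat -?et -?et'.
  rewrite -(@leZ_translate _ (2 *: t')).
    by rewrite -addrA -scalerDr subrK.
  by move=> i; rewrite mxE /oddz; lia.
apply/asboolP; exists (cell_cube (z + 2 *: t)), (cell_cube w); split.
- by exists (map_mx intr t) => //; rewrite translate_cell.
- exact: orbit_self.
- exact/cell_cube_sub.
Qed.

Lemma face_neq_bot z : face z <> \bot%O.
Proof.
move=> /(congr1 val)/(congr1 (fun X => X (cell_cube z))) /= e.
have : lattice_orbit B set0 (cell_cube z) by rewrite -e; exact: orbit_self.
by move=> [t _]; rewrite /translate image_set0 => /esym/cell_cube_neq0.
Qed.

Hypothesis n_gt0 : (0 < n)%N.

Lemma cell_cube_neqT z : cell_cube z <> setT.
Proof.
move=> e; pose i := Ordinal n_gt0.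
have : cell_cube z (const_mx (halfz (z 0 i) + 2)%:~R) by rewrite e.
move/cell_cubeP/(_ i); rewrite mxE; case: oddz.
  by rewrite !ler_int /halfz; lia.
by move/intr_inj; lia.
Qed.

Lemma face_neq_top z : face z <> \top%O.
Proof.
move=> /(congr1 val)/(congr1 (fun X => X (cell_cube z))) /= e.
have : lattice_orbit B setT (cell_cube z) by rewrite -e; exact: orbit_self.
move=> [t _ et]; apply: (@cell_cube_neqT z); rewrite -et.
by apply/seteqP; split=> // x _; exists (x - t) => //; rewrite subrK.
Qed.

Lemma toroid_bot_neq_top : (\bot : toroid B)%O <> \top%O.
Proof.
move=> e; apply: (@face_neq_bot 0); apply/eqP.
by rewrite eq_le le0x andbT e lex1.
Qed.

End ToroidFaces.

Section CellChains.
Context (n : nat).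
Implicit Types (z w t : 'rV[int]_n) (i : 'I_n).

Definition set_coord z i (a : int) : 'rV[int]_n := \row_k (if k == i then a else z 0 k).

Lemma set_coordE z i a k : set_coord z i a 0 k = if k == i then a else z 0 k.
Proof. by rewrite mxE. Qed.

Lemma dim_up z i a : ~~ oddz (z 0 i) -> oddz a -> dim (set_coord z i a) = (dim z).+1.
Proof.
move=> ez oa; rewrite /dim; have -> : odds (set_coord z i a) = (i |: odds z)%SET.
  apply/setP => k; rewrite !inE set_coordE.
  by case: eqVneq => [->|//]; rewrite oa.
by rewrite cardsU1 /odds inE ez.
Qed.

Lemma dim_down z i a : oddz (z 0 i) -> ~~ oddz a -> (dim (set_coord z i a)).+1 = dim z.
Proof.
move=> oz ea; rewrite -(@dim_up _ i (z 0 i)) ?set_coordE ?eqxx //.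
by congr dim; apply/rowP => k; rewrite !set_coordE; case: eqVneq => [->|].
Qed.

Lemma leZ_up z i a : ~~ oddz (z 0 i) -> `|a - z 0 i| = 1 -> leZ z (set_coord z i a).
Proof.
move=> ez d; apply/leZP => k; rewrite set_coordE; case: eqVneq => [->|_]; last by left.
by right; split=> //; move: ez d; rewrite /oddz; lia.
Qed.

Lemma leZ_down z i a : oddz (z 0 i) -> `|a - z 0 i| = 1 -> leZ (set_coord z i a) z.
Proof.
move=> ez d; apply/leZP => k; rewrite set_coordE; case: eqVneq => [->|_]; last by left.
by right; split=> //; move: ez d; rewrite /oddz; lia.
Qed.

Lemma exists_odd z : (0 < dim z)%N -> exists i, oddz (z 0 i).
Proof. by case/card_gt0P => i; rewrite /odds inE => oi; exists i. Qed.

Lemma exists_even z : (dim z < n)%N -> exists i, ~~ oddz (z 0 i).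
Proof.
move=> zn; apply/existsP; apply: contraTT zn; rewrite negb_exists => /forallP h.
rewrite -leqNgt -[X in (X <= _)%N]card_ord; apply: subset_leq_card.
by apply/fintype.subsetP => i _; rewrite /odds inE; have := h i; rewrite negbK.
Qed.

Lemma leZ_interpolate z w : leZ z w -> (dim z < dim w)%N ->
  exists y, [/\ leZ z y, leZ y w & dim y = (dim z).+1].
Proof.
move=> /leZP zw lt; have [i ne] : exists i, z 0 i != w 0 i.
  apply/existsP; apply: contraTT lt; rewrite negb_exists => /forallP h.
  rewrite (_ : z = w) ?ltnn //; apply/rowP => i.
  by have := h i; rewrite negbK => /eqP.
have [/eqP|[ow [ez d]]] := zw i; first by rewrite (negbTE ne).
exists (set_coord z i (w 0 i)); split; [exact: leZ_up| |exact: dim_up].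
by apply/leZP => k; rewrite set_coordE; case: eqVneq => [->|_]; [left|exact: zw].
Qed.

Lemma dim_translate z t : dim (z + 2 *: t) = dim z.
Proof.
rewrite /dim; congr #|pred_of_set _|; apply/setP => i; rewrite !inE rowD.
have -> : (2 *: t) 0 i = 2 * t 0 i by rewrite mxE.
by rewrite /oddz; lia.
Qed.

Lemma even_double t : even_row (2 *: t).
Proof.
by move=> i; have -> : (2 *: t) 0 i = 2 * t 0 i by [rewrite mxE]; rewrite /oddz; lia.
Qed.

Lemma dim_eq0 z : dim z = 0%N -> even_row z.
Proof.
move=> /eqP; rewrite cards_eq0 => /eqP /setP e i; have := e i.
by rewrite /odds !inE => ->.
Qed.

End CellChains.

Section ToroidRank.
Context (R : realType) (m : nat) (B : 'M[R]_m.+1).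
Hypothesis cubicB : cubic_lattice B.
Local Notation n := m.+1.
Local Notation T := (toroid B).
Implicit Types (z w t y : 'rV[int]_n) (i : 'I_n) (F G : T).
Local Notation face := (face B).
Local Notation L := (lat B).
Local Notation le_face := (face_le cubicB).
Local Notation neqT := (face_neq_top (ltn0Sn m)).

Lemma face_eq z w : face z = face w <-> exists2 t, L t & z + 2 *: t = w.
Proof.
split=> [e|[t Lt <-]].
  have [|t Lt zw] := (le_face z w).1; first by rewrite e lexx.
  have [|s _ wz] := (le_face w z).1; first by rewrite e lexx.
  exists t => //; apply: (leZ_eq zw); apply/eqP; rewrite dim_translate eqn_leq.
  by rewrite -{1}(dim_translate z t) leZ_dim //= -{1}(dim_translate w s) leZ_dim.
apply/le_anti/andP; split; apply/le_face.
  by exists t => //; exact: leZ_refl.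
exists (- t); first exact: latN.
by rewrite scalerN addrK; exact: leZ_refl.
Qed.

Lemma face_translate z t : L t -> face (z + 2 *: t) = face z.
Proof. by move=> Lt; apply/esym/face_eq; exists t. Qed.

Definition trank F : int :=
  if pselect (exists z, F = face z) is left e then (dim (projT1 (cid e)))%:Z
  else if `[< F = \bot%O >] then -1 else n.+1%:Z.

Lemma trank_face z : trank (face z) = (dim z)%:Z.
Proof.
rewrite /trank; case: pselect => [e|[]]; last by exists z.
by case: cid => w /= /face_eq[t _ <-]; rewrite dim_translate.
Qed.

Lemma trank_bot : trank \bot%O = -1.
Proof.
rewrite /trank; case: pselect => [[z /esym/face_neq_bot//]|_].
by rewrite asboolT.
Qed.

Lemma trank_top : trank \top%O = n.+1%:Z.
Proof.
rewrite /trank; case: pselect => [[z /esym/neqT//]|_].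
by rewrite asboolF // => /esym; exact: toroid_bot_neq_top.
Qed.

Lemma trank_lt : {homo trank : F G / (F < G)%O >-> F < G}.
Proof.
move=> F G; have [->|[->|[z ->]]] := toroid_cases F; first last.
- have [->|[->|[w ->]]] := toroid_cases G.
  + by rewrite ltx0.
  + by rewrite trank_face trank_top => _; have := dim_le z; lia.
  + rewrite !trank_face lt_neqAle => /andP[ne /le_face[t Lt zw]].
    rewrite -(dim_translate z t) ltz_nat ltn_neqAle leZ_dim // andbT.
    by apply: contra_neq ne => e; apply/face_eq; exists t => //; exact: leZ_eq.
- by rewrite (le_gtF (lex1 _)).
- have [->|[->|[w ->]]] := toroid_cases G.
  + by rewrite ltxx.
  + by rewrite trank_bot trank_top.
  + by rewrite trank_bot trank_face.
Qed.

Lemma face_lt z w : leZ z w -> (dim z < dim w)%N -> (face z < face w)%O.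
Proof.
move=> zw lt; rewrite lt_neqAle; apply/andP; split.
  by apply/eqP => /(congr1 trank); rewrite !trank_face => -[]; lia.
by apply/le_face; exists 0; [exact: lat0|rewrite scaler0 addr0].
Qed.

Lemma face_bot_lt z : (\bot < face z)%O.
Proof. by rewrite lt0x; apply/eqP/face_neq_bot. Qed.

Lemma face_lt_top z : (face z < \top)%O.
Proof. by rewrite ltx1; apply/eqP/neqT. Qed.

Lemma trank_covers F G : covers F G -> trank G = trank F + 1.
Proof.
move=> [FG nb]; have {}nb H : (F < H)%O -> (H < G)%O -> False.
  by move=> FH HG; have /negP := nb H; apply; rewrite FH.
have [eF|[eF|[z eF]]] := toroid_cases F; subst F; first last.
- have [eG|[eG|[w eG]]] := toroid_cases G; subst G.
  + by move: FG; rewrite ltx0.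
  + rewrite trank_face trank_top; have := dim_le z; rewrite leq_eqVlt.
    case/orP=> [/eqP->|zn]; first by lia.
    have [i ei] := exists_even zn; case: (nb (face (set_coord z i (z 0 i + 1)))).
      apply: face_lt; first by apply: leZ_up => //; lia.
      by rewrite dim_up //; move: ei; rewrite /oddz; lia.
    exact: face_lt_top.
  + have /ltW/le_face[t Lt zw] := FG; rewrite !trank_face.
    have := trank_lt FG; rewrite !trank_face -(dim_translate z t) => lt.
    have [|y [zy yw dy]] := leZ_interpolate zw; first by lia.
    rewrite -(face_translate z Lt) in nb FG.
    have [->|ne] := eqVneq (dim w) (dim (z + 2 *: t)).+1; first by lia.
    by case: (nb (face y)); apply: face_lt => //; lia.
- by move: FG; rewrite (le_gtF (lex1 _)).
- have [eG|[eG|[w eG]]] := toroid_cases G; subst G.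
  + by move: FG; rewrite ltxx.
  + by case: (nb (face 0)); [exact: face_bot_lt | exact: face_lt_top].
  + rewrite trank_bot trank_face; case: (posnP (dim w)) => [->//|w0].
    have [i oi] := exists_odd w0.
    case: (nb (face (set_coord w i (w 0 i + 1)))); first exact: face_bot_lt.
    apply: face_lt; first by apply: leZ_down => //; lia.
    by rewrite -(@dim_down _ w i (w 0 i + 1)) //; move: oi; rewrite /oddz; lia.
Qed.

Definition aflag (u : aff n) : set T :=
  [set F | [\/ F = \bot%O, F = \top%O |
             exists2 j, (j <= n)%N & F = face (act u (omega n j))]].

Lemma dim_act_omega u j : affine u -> (j <= n)%N -> dim (act u (omega n j)) = j.
Proof. by move=> au jn; rewrite act_dim // dim_omega. Qed.

Lemma aflag_flag u : affine u -> flag (aflag u).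
Proof.
move=> au; apply: (chain_flag trank_bot trank_top trank_lt).
  move=> _ _ [->|->|[j jn ->]] [->|->|[k kn ->]]; rewrite ?le0x ?lex1; try by [left|right].
  have [jk|/ltnW kj] := leqP j k; [left|right]; apply/le_face;
    by exists 0; [exact: lat0 | rewrite scaler0 addr0 act_leZ //; apply: leZ_omega].
move=> k /andP[k_ge k_le].
have [->|kb] := eqVneq k (-1); first by exists \bot%O; [apply: Or31|exact: trank_bot].
have [->|kt] := eqVneq k n.+1%:Z; first by exists \top%O; [apply: Or32|exact: trank_top].
exists (face (act u (omega n `|k|%N))); last by rewrite trank_face dim_act_omega //; lia.
by apply: Or33; exists `|k|%N => //; lia.
Qed.

Lemma aflag_face u j F : affine u -> (j <= n)%N -> aflag u F ->
  trank F = j%:Z -> F = face (act u (omega n j)).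
Proof.
move=> au jn uF rF; apply: (flag_rk_inj trank_lt (aflag_flag au)) => //.
  by apply: Or33; exists j.
by rewrite rF trank_face dim_act_omega.
Qed.

Lemma toroid_aut_rank f F : automorphism f -> trank (f F) = trank F.
Proof. exact: (automorphism_rk trank_bot trank_top trank_lt trank_covers). Qed.

Lemma aflag_map f u v : affine u -> affine v -> automorphism f ->
  (f @` aflag u = aflag v) <->
  (forall j, (j <= n)%N -> f (face (act u (omega n j))) = face (act v (omega n j))).
Proof.
move=> au av af; split=> [e j jn|e].
  apply: aflag_face => //.
    by rewrite -e; exists (face (act u (omega n j))) => //; apply: Or33; exists j.
  by rewrite toroid_aut_rank // trank_face dim_act_omega.
apply: flag_eq; [exact/automorphism_flag/aflag_flag | exact: aflag_flag |].
move=> _ [F uF <-]; have [eb|[et|[z ez]]] := toroid_cases (f F).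
- by apply: Or31.
- by apply: Or32.
case: uF ez => [->|->|[j jn ->]].
- by move=> /(congr1 trank); rewrite toroid_aut_rank // trank_bot trank_face.
- move=> /(congr1 trank); rewrite toroid_aut_rank // trank_top trank_face.
  by have := dim_le z; lia.
- by rewrite e // => _; apply: Or33; exists j.
Qed.

End ToroidRank.

(** * Regular toroids with a very short lattice vector *)

Section ShortVectors.
Context (R : realType) (m : nat) (B : 'M[R]_m.+1).
Hypothesis cubicB : cubic_lattice B.
Hypothesis regT : regular (toroid B).
Local Notation n := m.+1.
Local Notation T := (toroid B).
Implicit Types (z w t y : 'rV[int]_n) (i : 'I_n) (F G : T).
Local Notation face := (face B).
Local Notation L := (lat B).
Local Notation le_face := (face_le cubicB).
Local Notation rkT := (trank_face cubicB).

Lemma toroid_lower w F : (F < face w)%O -> (0 < dim w)%N ->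
  trank F = (dim w)%:Z - 1 -> exists y, [/\ F = face y, leZ y w & (dim y).+1 = dim w].
Proof.
move=> Fw w0 rF; have [eF|[eF|[z eF]]] := toroid_cases F; subst F.
- by move: rF; rewrite trank_bot // => e; exfalso; lia.
- by move: Fw; rewrite (le_gtF (lex1 _)).
have /ltW/le_face[t Lt zw] := Fw; exists (z + 2 *: t); split=> //.
  by rewrite face_translate.
by move: rF; rewrite dim_translate rkT; lia.
Qed.

Let small t := forall i, `|t 0 i| <= 1.

(** The vectors 0 and [2 t] are opposite vertices of the cell [t], and every facet of a cube
    contains one of two opposite vertices. Missing both would need two coordinates of [y] that have
    left the odd values of [t], lowering the dimension by two. *)
Lemma small_pair_le t y : small t -> leZ y t -> (dim y).+1 = dim t ->
  leZ 0 y \/ leZ (2 *: t) y.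
Proof.
move=> st /leZP yt dy.
have t2 i : (2 *: t) 0 i = 2 * t 0 i by rewrite mxE.
have o0 i : (0 : 'rV[int]_n) 0 i = 0 by rewrite mxE.
have [|/negP n0] := boolP (leZ 0 y); first by left.
have [|/negP nt] := boolP (leZ (2 *: t) y); first by right.
have [i ni] : exists i, ~~ oddz (y 0 i) && (y 0 i != 0).
  apply/existsP; apply: contra_notT n0 => /existsPn h; apply/leZP => i.
  rewrite o0; have := h i; have := yt i; have := st i; move: (y 0 i) (t 0 i) => a b.
  by rewrite /oddz; lia.
have [j nj] : exists j, ~~ oddz (y 0 j) && (y 0 j != 2 * t 0 j).
  apply/existsP; apply: contra_notT nt => /existsPn h; apply/leZP => j.
  rewrite t2; have := h j; have := yt j; have := st j; move: (y 0 j) (t 0 j) => a b.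
  by rewrite /oddz; lia.
have oti : oddz (t 0 i) by have := yt i; have := st i; move: ni; rewrite /oddz; lia.
have otj : oddz (t 0 j) by have := yt j; have := st j; move: nj; rewrite /oddz; lia.
have ij : i != j.
  apply/eqP => e; subst j; have := yt i; have := st i; move: ni nj oti; rewrite /oddz; lia.
have : (odds y \subset odds t :\ i :\ j)%SET.
  apply/fintype.subsetP => k; rewrite /odds !inE => ok.
  have -> : k != j by apply: contraTneq ok => ->; case/andP: nj.
  have -> : k != i by apply: contraTneq ok => ->; case/andP: ni.
  by have [<-|[->]] := yt k.
move/subset_leq_card; move: dy; rewrite /dim (cardsD1 i (odds t)) /odds inE oti.
rewrite (cardsD1 j (_ :\ i)) !inE otj eq_sym ij /= !add1n => -[->].
by rewrite ltnn.
Qed.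

(* If some cell of rank [k] has two opposite vertices identified, then all its
   facets contain that vertex; by regularity all cells of rank [k] have this
   property, and for minimal [k] it forces their opposite vertices to coincide. *)
Lemma regular_short t : L t -> t != 0 -> small t -> forall i, L (2 *: delta_mx 0 i).
Proof.
move=> Lt t0 st.
pose P k := `[< (0 < k)%N /\ exists t, [/\ L t, small t & dim t = k] >].
have [k /asboolP[k0 [{t Lt t0 st}t [Lt st dt]]] mink] : exists2 k, P k & forall j, P j -> (k <= j)%N.
  have exP : exists k, P k.
    exists (dim t); apply/asboolP; split; last by exists t.
    have [i ti] : exists i, t 0 i != 0.
      by apply/existsP; apply: contra_neqT t0 => /existsPn h; apply/rowP => i;
         rewrite mxE; have := h i; rewrite negbK => /eqP.
    apply/card_gt0P; exists i; rewrite /odds inE.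
    by have := st i; move: ti; rewrite /oddz; lia.
  by have [k Pk mink] := ex_minnP exP; exists k.
have kn : (k <= n)%N by rewrite -dt dim_le.
have t2 i : (2 *: t) 0 i = 2 * t 0 i by rewrite mxE.
have o0 i : (0 : 'rV[int]_n) 0 i = 0 by rewrite mxE.
have d0 : dim (0 : 'rV[int]_n) = 0%N.
  by apply/eqP; rewrite cards_eq0; apply/eqP/setP => i; rewrite /odds !inE o0.
have le0t : leZ 0 t.
  by apply/leZP => i; rewrite o0; have := st i; rewrite /oddz; lia.
have all_facets G : (G < face t)%O -> trank G = k%:Z - 1 -> (face 0 <= G)%O.
  move=> Gt rG; have [||y [-> yt dy]] := toroid_lower Gt; rewrite ?dt //.
  apply/le_face; have [y0|yt2] := small_pair_le st yt dy.
    by exists 0; [exact: lat0|rewrite scaler0 addr0].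
  by exists t => //; rewrite add0r.
have [Phi fPhi [Phi0 Phit]] : exists2 Phi, flag Phi & Phi (face 0) /\ Phi (face t).
  have [|Phi fPhi sPhi] := @chain_sub_flag _ T [set face 0; face t]%classic.
    have le : (face 0 <= face t)%O.
      by apply/le_face; exists 0; [exact: lat0|rewrite scaler0 addr0].
    by move=> x y [->|->] [->|->]; rewrite ?lexx ?le; [left|left|right|left].
  by exists Phi => //; split; apply: sPhi; [left|right].
have all_u u : affine u -> L (omega n k *m u.2).
  move=> au; have [f af ef] := regT fPhi (aflag_flag cubicB au).
  have img F j : Phi F -> trank F = j%:Z -> (j <= n)%N -> f F = face (act u (omega n j)).
    move=> PF rF jn; apply: (aflag_face cubicB au) => //.
      by rewrite ef; exists F.
    by rewrite toroid_aut_rank.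
  have f0 : f (face 0) = face (act u (omega n 0)) by apply: img; rewrite ?rkT ?d0.
  have ft : f (face t) = face (act u (omega n k)) by apply: img; rewrite ?rkT ?dt.
  have om0 : omega n 0 = 0 by apply/rowP => i; rewrite !mxE.
  (* This is the facet of [omega k] that avoids the vertex 0 in the first direction. By regularity
     its image under [u] contains a lattice translate of the image of 0; pulled back, [2 s'] is a
     vertex of [g], so [s'] has entries 0 and 1 supported in the first [k] places, and minimality of
     [k] makes them all 1 there. *)
  pose g := set_coord (omega n k) ord0 2.
  have oomk : oddz (omega n k 0 ord0) by rewrite mxE k0.
  have gom : leZ g (omega n k) by apply: leZ_down => //; rewrite mxE k0.
  have dg : (dim g).+1 = k by rewrite dim_down ?dim_omega.
  have [f' [af' fK f'K]] := automorphism_inv af.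
  have [|s Ls sg] := (le_face (act u 0) (act u g)).1.
    rewrite -om0 -f0 -[face (act u g)]f'K af.2; apply: all_facets.
      rewrite -(automorphism_lt af) f'K ft; apply: face_lt => //.
        by rewrite act_leZ.
      by rewrite !act_dim // dim_omega //; lia.
    by rewrite toroid_aut_rank // rkT act_dim //; lia.
  have [s' es] : exists s', s = s' *m u.2.
    by exists (s *m u.2^T); rewrite -mulmxA (mulmx1C au.2) mulmx1.
  have {}sg : leZ (2 *: s') g.
    rewrite -(act_leZ _ _ au); suff -> : act u (2 *: s') = act u 0 + 2 *: s by [].
    by rewrite /act mul0mx addr0 -scalemxAl -es.
  have s2 i : (2 *: s') 0 i = 2 * s' 0 i by rewrite mxE.
  have gE i : g 0 i = if i == ord0 then 2 else (i < k)%N%:R by rewrite !mxE.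
  have s'P i : s' 0 i = if i == ord0 then 1 else s' 0 i.
    case: eqVneq => [->|//]; have /leZP/(_ ord0) := sg; rewrite s2 gE eqxx /oddz /=.
    by lia.
  have s'b i : i != ord0 -> if (i < k)%N then s' 0 i = 0 \/ s' 0 i = 1 else s' 0 i = 0.
    move=> /negbTE i0; have /leZP/(_ i) := sg; rewrite s2 gE i0 /oddz.
    by case: (i < k)%N => /=; lia.
  have s'small : small s'.
    move=> i; rewrite s'P; case: eqVneq => [//|/s'b].
    by case: (i < k)%N; lia.
  have sub : (odds s' \subset odds (omega n k))%SET.
    apply/fintype.subsetP => i; rewrite /odds !inE [omega _ _ _ _]mxE; case: (eqVneq i ord0) => [-> _|/s'b].
      by rewrite k0.
    by case: (i < k)%N => // ->.
  have dims' : dim s' = dim s.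
    have a2 : affine (0, u.2) by split; [move=> i; rewrite mxE|exact: au.2].
    by rewrite es -[s' *m _]add0r -(act_dim s' a2).
  have sm : small s.
    move=> i; rewrite es; have [p [e [ee pE]]] := orth_perm au.2.
    by rewrite pE; have := s'small (p i); case: (ee i) => ->; lia.
  have ge : (k <= dim s')%N.
    apply: mink; apply/asboolP; split; last by exists s; split=> //; rewrite dims'.
    apply/card_gt0P; exists ord0; rewrite /odds inE s'P eqxx.
    by [].
  have eqs : odds s' = odds (omega n k).
    apply/eqP; rewrite eqEcard sub /=; move: ge; rewrite /dim.
    by rewrite -[#|odds (omega n k)|]/(dim (omega n k)) dim_omega.
  have <- : s' = omega n k.
    apply/rowP => i; rewrite s'P [RHS]mxE; case: eqVneq => [->|i0]; first by rewrite k0.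
    have /setP/(_ i) := eqs; rewrite /odds !inE [omega _ _ _ _]mxE; have := s'b i i0.
    by case: (i < k)%N => [[]|] ->.
  by rewrite -es.
(* Reversing the sign of the first coordinate of [omega k] gives a second lattice vector; the
   difference of the two is twice a basis vector. *)
have two (u : aff n) : affine u -> L (2 *: delta_mx 0 ord0 *m u.2).
  move=> au; have oM : orth (flip ord0 *m u.2) by apply: orthM; [exact: flip_orth|exact: au.2].
  have a2 : affine (0, flip ord0 *m u.2) by split=> // i; rewrite mxE.
  have := latB (all_u _ au) (all_u _ a2).
  rewrite /= mulmxA -mulmxBl; suff -> : omega n k - omega n k *m flip ord0 = 2 *: delta_mx 0 ord0 by [].
  apply/rowP => i; rewrite rowD rowN mul_flip !mxE /=.
  by case: (eqVneq i ord0) => [->|]; rewrite ?k0; lia.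
move=> i; have ai : affine (0, tperm_mx ord0 i : 'M[int]_n).
  by split; [move=> j; rewrite mxE|exact: tperm_orth].
have := two _ ai; rewrite -scalemxAl /= -xcolE; suff -> : xcol ord0 i (delta_mx 0 ord0) = delta_mx 0 i :> 'rV[int]_n by [].
apply/rowP => j; rewrite !mxE /=; congr (_%:R); case: tpermP => [->|->|/eqP j0 /eqP ji].
- by rewrite eq_sym.
- by rewrite !eqxx.
- by rewrite (negbTE j0) (negbTE ji).
Qed.

End ShortVectors.

(** * Flags of a toroid without short vectors *)

Section ToroidPolytope.
Context (R : realType) (m : nat) (B : 'M[R]_m.+1).
Hypothesis cubicB : cubic_lattice B.
Local Notation n := m.+1.
Local Notation T := (toroid B).
Implicit Types (z w t y : 'rV[int]_n) (i : 'I_n) (F G : T) (u v : aff n).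
Local Notation face := (face B).
Local Notation L := (lat B).
Local Notation le_face := (face_le cubicB).
Local Notation rkT := (trank_face cubicB).
Local Notation om := (omega n).
Hypothesis lat_large : forall t, L t -> (forall i, `|t 0 i| <= 1) -> t = 0.

Lemma lat_double_small t : L t -> (forall i, `|2 * t 0 i| <= 2) -> t = 0.
Proof. by move=> Lt h; apply: lat_large => // i; have := h i; lia. Qed.

(** Cells below a common cell differ by at most 2 in each doubled coordinate, so a lattice vector
    carrying one to the other has entries in {-1, 0, 1}. This makes the quotient map injective
    around every cell. *)
Lemma lift_below z w t : L t -> leZ z w -> leZ (z + 2 *: t) w -> t = 0.
Proof.
move=> Lt zw zw'; apply: lat_double_small => // i.
have := leZ_dist_below zw zw' i; rewrite rowD.
have -> : (2 *: t) 0 i = 2 * t 0 i by rewrite mxE.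
by lia.
Qed.

Lemma lift_above z w t : L t -> leZ z w -> leZ z (w + 2 *: t) -> t = 0.
Proof.
move=> Lt zw zw'; apply: lat_double_small => // i.
have := leZ_dist_above zw zw' i; rewrite rowD.
have -> : (2 *: t) 0 i = 2 * t 0 i by rewrite mxE.
by lia.
Qed.

Lemma face_inj_below z y w : leZ z w -> leZ y w -> face z = face y -> z = y.
Proof.
move=> zw yw /(face_eq cubicB)[t Lt e]; move: yw; rewrite -e => yw.
by rewrite (lift_below Lt zw yw) scaler0 addr0.
Qed.

Lemma face_inj_above z y w : leZ w z -> leZ w y -> face z = face y -> z = y.
Proof.
move=> zw yw /(face_eq cubicB)[t Lt e]; move: yw; rewrite -e => yw.
by rewrite (lift_above Lt zw yw) scaler0 addr0.
Qed.

Lemma dim_full z : dim z = n -> forall i, oddz (z 0 i).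
Proof.
move=> dz i; have : i \in odds z; last by rewrite /odds inE.
suff -> : odds z = [set: 'I_n]%SET by rewrite finset.in_setT.
apply/eqP; rewrite eqEcard finset.subsetT cardsT card_ord /=.
by rewrite -[#|odds z|]/(dim z) dz.
Qed.

(** The section lifts to the tessellation, where the two intermediate cells arise by changing one
    coordinate. Without short lattice vectors these two cells are not identified, and no further
    translate fits between. *)
Lemma toroid_diamond F G : (F < G)%O -> trank G = trank F + 2 ->
  [set H : T | (F < H < G)%O] #= `I_2.
Proof.
move=> FG rFG; apply/card_set2P.
have [eF|[eF|[z eF]]] := toroid_cases F; subst F; first last.
- have [eG|[eG|[w eG]]] := toroid_cases G; subst G.
  + by move: FG; rewrite ltx0.
  + move: rFG; rewrite rkT trank_top => rz.
    have [|i ei] := exists_even (z := z); first by lia.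
    have up a : `|a - z 0 i| = 1 -> leZ z (set_coord z i a) by exact: leZ_up.
    have oa a : `|a - z 0 i| = 1 -> oddz a by move: ei; rewrite /oddz; lia.
    have du a : `|a - z 0 i| = 1 -> dim (set_coord z i a) = n.
      by move=> ha; rewrite (dim_up ei (oa a ha)); lia.
    have hp : `|z 0 i + 1 - z 0 i| = 1 by lia.
    have hm : `|z 0 i - 1 - z 0 i| = 1 by lia.
    exists (face (set_coord z i (z 0 i + 1))), (face (set_coord z i (z 0 i - 1))); split.
      move=> /(face_inj_above (up _ hp) (up _ hm)) /rowP/(_ i).
      by rewrite !set_coordE eqxx; lia.
    apply/seteqP; split=> [H /= /andP[zH Ht]|H].
      have [eH|[eH|[w eH]]] := toroid_cases H; subst H.
      * by move: zH; rewrite ltx0.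
      * by move: Ht; rewrite ltxx.
      have /ltW/le_face[t Lt zw] := zH.
      have Lt' : L (- t) by exact: latN.
      rewrite -(face_translate cubicB w Lt') in zH Ht *.
      have {}zw : leZ z (w + 2 *: - t).
        rewrite -(@leZ_translate _ (2 *: t)); last exact: even_double.
        by rewrite scalerN subrK.
      set y : 'rV[int]_n := w + _ in zw zH Ht *; clearbody y.
      have [zy zy'] := (zw, zH).
      have dy : dim y = n.
        by have := trank_lt cubicB zy'; have := dim_le y; rewrite !rkT; lia.
      have oy := dim_full dy i.
      have ya : `|y 0 i - z 0 i| = 1.
        by have /leZP/(_ i) := zy; move: ei oy; rewrite /oddz; lia.
      have -> : y = set_coord z i (y 0 i).
        apply/esym/leZ_eq; last by rewrite du.
        apply/leZP => k; rewrite set_coordE; case: eqVneq => [->|_]; first by left.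
        by have /leZP := zy.
      have [->|->] : y 0 i = z 0 i + 1 \/ y 0 i = z 0 i - 1 by lia.
        by left.
      by right.
    move=> [->|->]; apply/andP; split; try exact: face_lt_top;
      by apply: face_lt => //; [apply: up|rewrite du //; lia].
  + have /ltW/le_face[t Lt zw] := FG.
    move: rFG; rewrite !rkT -(face_translate cubicB z Lt) -(dim_translate z t).
    set z1 : 'rV[int]_n := z + _ in zw *; clearbody z1.
    move: z1 zw => {Lt t FG}z zw rzw.
    have /leZP zw' := zw.
    have dup i : z 0 i != w 0 i -> dim (set_coord z i (w 0 i)) = (dim z).+1 /\ leZ (set_coord z i (w 0 i)) w.
      move=> ne; have [e|[ow [ez d]]] := zw' i; first by rewrite e eqxx in ne.
      split; first exact: dim_up.
      by apply/leZP => k; rewrite set_coordE; case: eqVneq => [->|_]; [left|exact: zw'].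
    have [i ne] : exists i, z 0 i != w 0 i.
      apply/existsP; apply: contra_eqT rzw => /existsPn h.
      rewrite (_ : z = w); first by lia.
      by apply/rowP => i; have := h i; rewrite negbK => /eqP.
    have [di li] := dup i ne.
    have [j nej] : exists j, set_coord z i (w 0 i) 0 j != w 0 j.
      apply/existsP; apply: contra_eqT rzw => /existsPn h.
      have e : set_coord z i (w 0 i) = w.
        by apply/rowP => j; have := h j; rewrite negbK => /eqP.
      by move: di; rewrite e => ->; lia.
    have ji : j != i by apply: contraNneq nej => ->; rewrite set_coordE eqxx.
    have nej' : z 0 j != w 0 j by move: nej; rewrite set_coordE (negbTE ji).
    have [dj lj] := dup j nej'.
    have up k : leZ z (set_coord z k (w 0 k)).
      apply/leZP => l; rewrite set_coordE; case: eqVneq => [->|_]; [exact: zw'|by left].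
    exists (face (set_coord z i (w 0 i))), (face (set_coord z j (w 0 j))); split.
      move=> /(face_inj_below li lj) /rowP/(_ i).
      by rewrite !set_coordE eqxx eq_sym (negbTE ji) => e; rewrite e eqxx in ne.
    apply/seteqP; split=> [H /= /andP[zH Hw]|H].
      have [eH|[eH|[y eH]]] := toroid_cases H; subst H.
      * by move: zH; rewrite ltx0.
      * by move: Hw; rewrite (le_gtF (lex1 _)).
      have /ltW/le_face[t Lt yw] := Hw.
      rewrite -(face_translate cubicB y Lt) in zH Hw *.
      set y1 : 'rV[int]_n := y + _ in yw zH Hw *; clearbody y1.
      move: y1 yw zH Hw => {Lt t}y yw zH Hw.
      have /ltW/le_face[t Lt zy] := zH.
      have t0 := lift_below Lt zw (leZ_trans zy yw).
      move: zy; rewrite t0 scaler0 addr0 => zy.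
      have dy : dim y = (dim z).+1.
        by have := trank_lt cubicB zH; have := trank_lt cubicB Hw; rewrite !rkT; lia.
      have yk k : y 0 k = z 0 k \/ y 0 k = w 0 k.
        have /leZP/(_ k)[->|[_ [oy _]]] := yw; first by right.
        have /leZP/(_ k)[->|[]] := zy; first by left.
        by rewrite (negbTE oy).
      have eqk k : z 0 k != w 0 k -> y 0 k = w 0 k -> y = set_coord z k (w 0 k).
        move=> nk ek; apply/esym/leZ_eq; last by rewrite dy; case: (dup k nk).
        apply/leZP => l; rewrite set_coordE; case: eqVneq => [->|_]; first by left.
        by have /leZP := zy.
      have [yi|yi] := yk i; last by left; rewrite {1}(eqk i ne yi).
      have [yj|yj] := yk j; last by right; rewrite {1}(eqk j nej' yj).
      (* Otherwise [y] agrees with [z] in both coordinates [i] and [j], so it lies below a cell of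
         dimension [dim w - 2], although its own dimension is [dim w - 1]. *)
      exfalso; have : leZ y (set_coord (set_coord w i (z 0 i)) j (z 0 j)).
        apply/leZP => k; rewrite !set_coordE.
        case: eqVneq => [->|_]; first by left.
        by case: eqVneq => [->|_]; [left | have /leZP := yw].
      have ow k : z 0 k != w 0 k -> oddz (w 0 k) /\ ~~ oddz (z 0 k).
        by move=> nk; have [e|[? []//]] := zw' k; rewrite e eqxx in nk.
      move=> /leZ_dim; rewrite dy.
      have : (dim (set_coord (set_coord w i (z 0 i)) j (z 0 j))).+2 = dim w.
        rewrite dim_down ?set_coordE ?(negbTE ji) ?dim_down //; try by case: (ow _ ne).
          by case: (ow _ nej').
        by case: (ow _ nej').
      by lia.
    by move=> [->|->]; apply/andP; split; apply: face_lt => //; try exact: up; lia.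
- by move: FG; rewrite (le_gtF (lex1 _)).
- have [eG|[eG|[w eG]]] := toroid_cases G; subst G.
  + by move: FG; rewrite ltxx.
  + by move: rFG; rewrite trank_bot // trank_top //; lia.
  + move: rFG; rewrite trank_bot // rkT => rw; have dw : dim w = 1%N by lia.
    have [|i oi] := exists_odd (z := w); first by lia.
    have down a : `|a - w 0 i| = 1 -> leZ (set_coord w i a) w by exact: leZ_down.
    have ea a : `|a - w 0 i| = 1 -> ~~ oddz a by move: oi; rewrite /oddz; lia.
    have dd a : `|a - w 0 i| = 1 -> dim (set_coord w i a) = 0%N.
      by move=> ha; have := dim_down oi (ea a ha); lia.
    have hp : `|w 0 i + 1 - w 0 i| = 1 by lia.
    have hm : `|w 0 i - 1 - w 0 i| = 1 by lia.
    exists (face (set_coord w i (w 0 i + 1))), (face (set_coord w i (w 0 i - 1))); split.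
      move=> /(face_inj_below (down _ hp) (down _ hm)) /rowP/(_ i).
      by rewrite !set_coordE eqxx; lia.
    apply/seteqP; split=> [H /= /andP[bH Hw]|H].
      have [eH|[eH|[y eH]]] := toroid_cases H; subst H.
      * by move: bH; rewrite ltxx.
      * by move: Hw; rewrite (le_gtF (lex1 _)).
      have /ltW/le_face[t Lt yw] := Hw.
      rewrite -(face_translate cubicB y Lt) in bH Hw *.
      set y1 : 'rV[int]_n := y + _ in yw bH Hw *; clearbody y1.
      move: y1 yw bH Hw => {Lt t}y yw bH Hw.
      have dy : dim y = 0%N by have := trank_lt cubicB Hw; rewrite !rkT; lia.
      have ya : `|y 0 i - w 0 i| = 1.
        by have /leZP/(_ i) := yw; have := dim_eq0 dy i; move: oi; rewrite /oddz; lia.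
      have -> : y = set_coord w i (y 0 i).
        apply: leZ_eq; last by rewrite dd.
        apply/leZP => k; rewrite set_coordE; case: eqVneq => [->|ki]; first by left.
        have /leZP/(_ k)[|[ok _]] := yw; first by left.
        have := dim_eq0 (dd _ hp) k; rewrite set_coordE (negbTE ki).
        by rewrite ok.
      have [->|->] : y 0 i = w 0 i + 1 \/ y 0 i = w 0 i - 1 by lia.
        by left.
      by right.
    move=> [->|->]; apply/andP; split; try exact: face_bot_lt;
      by apply: face_lt => //; [apply: down|rewrite dd //; lia].
Qed.

End ToroidPolytope.

(** * Flags and automorphisms as affine maps *)

Section ToroidFlags.
Context (R : realType) (m : nat) (B : 'M[R]_m.+1).
Hypothesis cubicB : cubic_lattice B.
Local Notation n := m.+1.
Local Notation T := (toroid B).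
Implicit Types (z w t y : 'rV[int]_n) (i j : nat) (F G : T) (u v : aff n).
Local Notation face := (face B).
Local Notation L := (lat B).
Local Notation le_face := (face_le cubicB).
Local Notation rkT := (trank_face cubicB).
Local Notation om := (omega n).
Local Notation aflag := (@aflag R m B).
Hypothesis lat_large : forall t, L t -> (forall k, `|t 0 k| <= 1) -> t = 0.

Lemma chain_affine (z : nat -> 'rV[int]_n) :
  (forall j, (j <= n)%N -> dim (z j) = j) ->
  (forall j, (j < n)%N -> leZ (z j) (z j.+1)) ->
  exists2 u, affine u & forall j, (j <= n)%N -> act u (om j) = z j.
Proof.
move=> dz lez.
have step (j : 'I_n) : exists c : 'I_n,
    [/\ odds (z j.+1) = (c |: odds (z j))%SET, c \notin odds (z j) &
        (z j.+1 - z j) 0 c ^+ 2 = 1 /\ forall k, k != c -> (z j.+1 - z j) 0 k = 0].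
  have [le] := (lez j (ltn_ord j)); have /leZP le' := le.
  have [d1 d2] := (dz j (ltnW (ltn_ord j)), dz j.+1 (ltn_ord j)).
  have [c /andP[nc oc]] : exists c, (c \notin odds (z j)) && (c \in odds (z j.+1)).
    apply/existsP; apply: contra_eqT d2 => /existsPn h.
    have /subset_leq_card : (odds (z j.+1) \subset odds (z j))%SET.
      by apply/fintype.subsetP => k ok; have := h k; rewrite ok andbT negbK.
    by rewrite -[#|odds (z j)|]/(dim (z j)) -[#|odds (z j.+1)|]/(dim (z j.+1)) d1; lia.
  have ec : (c |: odds (z j))%SET = odds (z j.+1).
    apply/eqP; rewrite eqEcard finset.subUset finset.sub1set oc leZ_sub //=.
    rewrite cardsU1 nc /= -[#|odds (z j)|]/(dim (z j)) -[#|odds (z j.+1)|]/(dim (z j.+1)).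
    by rewrite d1 d2.
  exists c; split=> //; split.
    rewrite rowD rowN; have [e|[_ [_ d]]] := le' c.
      by move: nc oc; rewrite /odds !inE e => /negbTE->.
    by apply/eqP; rewrite sqrf_eq1; move: d; lia.
  move=> k kc; rewrite rowD rowN; have [->|[ok [nk _]]] := le' k; first by rewrite subrr.
  have : k \in odds (z j.+1) by rewrite /odds inE.
  by rewrite -ec /odds !inE (negbTE kc) (negbTE nk).
have /choice[c cP] := step.
have odds_mono (i j : nat) : (i <= j <= n)%N -> (odds (z i) \subset odds (z j))%SET.
  elim: j => [|j IH]; first by rewrite leqn0 => /andP[/eqP->].
  case/andP; rewrite leq_eqVlt => /orP[/eqP-> //|ij jn].
  apply: (fintype.subset_trans (IH _)); first by lia.
  exact/leZ_sub/lez.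
have c_inj (i j : 'I_n) : (i < j)%N -> c i != c j.
  move=> ij; have [ei _ _] := cP i; have [_ nj _] := cP j.
  apply: contraNneq nj => <-; have jn := ltn_ord j.
  apply: (fintype.subsetP (odds_mono i.+1 j _)); first by lia.
  by rewrite ei !inE eqxx.
have [M rowM] : exists M : 'M[int]_n, forall (j : 'I_n) k, M j k = (z j.+1 - z j) 0 k.
  by exists (\matrix_(j < n) (z j.+1 - z j)) => j k; rewrite mxE.
have oM : orth M.
  apply/matrixP => i j; rewrite mxE [RHS]mxE.
  under eq_bigr do rewrite mxE !rowM.
  have [_ _ [ci1 ci0]] := cP i; have [_ _ [cj1 cj0]] := cP j.
  rewrite (bigD1 (c i)) //= big1 => [|k kc]; last by rewrite ci0 // mul0r.
  rewrite addr0; case: (ltngtP i j) => [ij|ji|/val_inj e].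
  - by rewrite -val_eqE /= (ltn_eqF ij) cj0 ?mulr0 // c_inj.
  - by rewrite -val_eqE /= (gtn_eqF ji) cj0 ?mulr0 // eq_sym c_inj.
  - by subst j; rewrite eqxx -expr2.
exists (z 0%N, M) => [|j jn]; first by split; [exact/dim_eq0/dz | exact: oM].
rewrite /act /= -[RHS](subrK (z 0%N)) addrC; congr (_ + _).
apply/rowP => k; rewrite mxE.
transitivity (\sum_(i < n | (i < j)%N) (z i.+1 - z i) 0 k).
  rewrite [RHS]big_mkcond /=; apply: eq_bigr => i _.
  by rewrite rowM [om _ _ _]mxE; case: ltnP => _; rewrite ?mul1r ?mul0r.
rewrite -(big_ord_widen n (fun i : nat => (z i.+1 - z i) 0 k) jn) -summxE.
congr (fun_of_matrix _ _ _).
by rewrite -(big_mkord predT (fun i : nat => z i.+1 - z i)) telescope_sumr.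
Qed.

(** All faces are lifted below one fixed cube [w]. Two lifts that are incident only up to a lattice
    vector are then incident outright, by [lift_below]. *)
Lemma aflagP Phi : flag Phi -> exists2 u, affine u & Phi = aflag u.
Proof.
move=> fPhi; have rk j : (j <= n)%N -> exists z, Phi (face z) /\ dim z = j.
  move=> jn; have [|F PF rF] := flag_rank (@trank_bot _ _ B) (@trank_top _ _ B)
    (trank_lt cubicB) (trank_covers cubicB) fPhi (k := j%:Z); first by lia.
  have [eF|[eF|[z eF]]] := toroid_cases F; subst F.
  - by move: rF; rewrite trank_bot.
  - by move: rF; rewrite trank_top; lia.
  by exists z; split=> //; move: rF; rewrite rkT => -[].
have [w [Pw dw]] := rk n (leqnn n).
have /choice[z zP] : forall j : nat, exists z,
    (j <= n)%N -> [/\ Phi (face z), dim z = j & leZ z w].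
  move=> j; have [jn|_] := boolP (j <= n)%N; last by exists 0.
  have [z [Pz dz]] := rk j jn.
  have /le_face[t Lt zw] : (face z <= face w)%O.
    by apply: (flag_rk_le (trank_lt cubicB) fPhi) => //; rewrite !rkT dz dw; lia.
  by exists (z + 2 *: t) => _; rewrite face_translate ?dim_translate.
have [||u au uE] := @chain_affine z.
- by move=> j /zP[].
- move=> j jn; have [Pj dj ljw] := zP j (ltnW jn); have [Pj1 dj1 lj1w] := zP j.+1 jn.
  have /le_face[t Lt le] : (face (z j) <= face (z j.+1))%O.
    by apply: (flag_rk_le (trank_lt cubicB) fPhi) => //; rewrite !rkT dj dj1; lia.
  have t0 := lift_below lat_large Lt ljw (leZ_trans le lj1w).
  by move: le; rewrite t0 scaler0 addr0.
exists u => //; apply/esym/flag_eq => //; first exact: aflag_flag.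
move=> _ [->|->|[j jn ->]]; [exact: flag_bot | exact: flag_top | rewrite uE //].
by have [] := zP j jn.
Qed.

Lemma aflag_ext u v : affine u -> affine v ->
  (forall j, (j <= n)%N -> face (act u (om j)) = face (act v (om j))) ->
  aflag u = aflag v.
Proof.
move=> au av e; rewrite -[LHS]image_id.
by apply/(aflag_map cubicB au av (@automorphism_id _ _)).
Qed.

Lemma aflag_inj_face u v j : affine u -> affine v -> aflag u = aflag v ->
  (j <= n)%N -> face (act u (om j)) = face (act v (om j)).
Proof.
move=> au av e jn; have e' : id @` aflag u = aflag v by rewrite image_id.
exact: ((aflag_map cubicB au av (@automorphism_id _ _)).1 e').
Qed.

(** One common face determines a lattice translation that makes its two lifts equal. The other
    common faces are incident with that cell, where the quotient map is injective, so their lifts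
    agree as well. *)
Lemma align (J : pred nat) u v : affine u -> affine v ->
  (forall j, (j <= n)%N -> J j -> face (act u (om j)) = face (act v (om j))) ->
  exists v', [/\ affine v', aflag v' = aflag v, v'.2 = v.2 &
    forall j, (j <= n)%N -> J j -> act u (om j) = act v' (om j)].
Proof.
move=> au av e.
have [[j0 [j0n Jj0]]|none] := pselect (exists j, (j <= n)%N /\ J j); last first.
  by exists v; split=> // j jn Jj; case: none; exists j.
have /(face_eq cubicB)[t Lt et] := e j0 j0n Jj0.
pose v' : aff n := (v.1 + 2 *: - t, v.2).
have actv' z : act v' z = act v z + 2 *: - t by rewrite /act /v' /= addrAC.
have av' : affine v'.
  by split; [exact: even_rowD av.1 (even_double _) | exact: av.2].
have Lt' : L (- t) by exact: latN.
have ef : aflag v' = aflag v.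
  by apply: aflag_ext => // j jn; rewrite actv' face_translate.
exists v'; split=> // j jn Jj.
have e0 : act u (om j0) = act v' (om j0) by rewrite actv' -et scalerN addrK.
have fe : face (act u (om j)) = face (act v' (om j)).
  by rewrite e // actv' face_translate.
have [jj|/ltnW jj] := leqP j j0.
  apply: (face_inj_below cubicB lat_large _ _ fe (w := act u (om j0))).
    by rewrite act_leZ //; exact: leZ_omega.
  by rewrite e0 act_leZ //; exact: leZ_omega.
apply: (face_inj_above cubicB lat_large _ _ fe (w := act u (om j0))).
  by rewrite act_leZ //; exact: leZ_omega.
by rewrite e0 act_leZ //; exact: leZ_omega.
Qed.

Lemma aflag_inj u v : affine u -> affine v -> aflag u = aflag v -> u.2 = v.2.
Proof.
move=> au av e; have [|v' [av' _ <- ev]] := @align predT u v au av.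
  by move=> j jn _; apply: aflag_inj_face.
suff /(congr1 (amul u)) : amul (ainv u) v' = aid n.
  by rewrite amulA mulaV // a1mul mula1 => ->.
(* All cells of the base flag are fixed, so no reflection is admissible and the induction reduces to
   the identity. *)
apply: (@affine_ind _ predT (fun x => x = aid n)) => //.
  by apply: affine_mul => //; exact: affine_inv.
by move=> j jn _; rewrite act_mul -ev // actK.
Qed.

Lemma affine_fix_all_but i u : affine u ->
  (forall j, (j <= n)%N -> j != i -> act u (om j) = om j) ->
  (i <= n)%N -> u = aid n \/ u = refl m i.
Proof.
move=> au fixu i_n.
apply: (@affine_ind _ (predC1 i) (fun u => u = aid n \/ u = refl m i) _ _ u au) => //.
  by left.
move=> v k av kn /negPn/eqP-> [->|->]; first by right; rewrite mula1.
by left; rewrite refl_reflK.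
Qed.

Lemma aflag_refl_face u i j : affine u -> (i <= n)%N -> (j <= n)%N -> i != j ->
  act (amul u (refl m i)) (om j) = act u (om j).
Proof. by move=> au i_n jn ij; rewrite act_mul refl_omega. Qed.

(** After alignment the two lifts differ by a map fixing all cells of the base flag except
    [omega i], hence by the identity or by [refl i], which reverses the determinant. *)
Lemma one_off u v i : affine u -> affine v -> (i <= n)%N ->
  (forall j, (j <= n)%N -> j != i -> face (act u (om j)) = face (act v (om j))) ->
  (aflag v = aflag u /\ \det v.2 = \det u.2) \/
  (aflag v = aflag (amul u (refl m i)) /\ \det v.2 = - \det u.2).
Proof.
move=> au av i_n e; have [v' [av' <- <- ev]] := @align (predC1 i) u v au av e.
have [||//|eu|eu] := @affine_fix_all_but i (amul (ainv u) v').
- by apply: affine_mul => //; exact: affine_inv.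
- by move=> j jn ji; rewrite act_mul -ev // actK.
- have -> : v' = u by rewrite -[v']a1mul -(mulaV au) -amulA eu mula1.
  by left.
have -> : v' = amul u (refl m i) by rewrite -eu amulA mulaV // a1mul.
by right; split=> //; rewrite /= det_mulmx refl_det // mulN1r.
Qed.

(** The two cells are incident with a common cell of another rank, so they could not be identified
    without being equal; but the reflection does move [omega i]. *)
Lemma refl_face_neq u i : affine u -> (i <= n)%N ->
  face (act u (om i)) <> face (act (amul u (refl m i)) (om i)).
Proof.
move=> au i_n e; have ar := refl_affine m i.
have [j [jn ij]] : exists j, (j <= n)%N /\ i != j.
  by case: (eqVneq i 0%N) => [->|]; [exists 1%N | exists 0%N].
have fixj : act u (om j) = act (amul u (refl m i)) (om j) by rewrite aflag_refl_face.
have aur := affine_mul au ar.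
have : act u (om i) = act (amul u (refl m i)) (om i).
  have [lij|/ltnW lji] := leqP i j.
    apply: (face_inj_below cubicB lat_large _ _ e (w := act u (om j))).
      by rewrite act_leZ //; exact: leZ_omega.
    by rewrite fixj act_leZ //; exact: leZ_omega.
  apply: (face_inj_above cubicB lat_large _ _ e (w := act u (om j))).
    by rewrite act_leZ //; exact: leZ_omega.
  by rewrite fixj act_leZ //; exact: leZ_omega.
rewrite act_mul => /(congr1 (act (ainv u))); rewrite !actK // => /esym/eqP.
by rewrite (negbTE (refl_omega_neq _)).
Qed.

Lemma aflag_notin u v i : affine u -> affine v -> (i <= n)%N ->
  face (act u (om i)) <> face (act v (om i)) -> ~ aflag v (face (act u (om i))).
Proof.
move=> au av i_n ne vu; apply: ne; apply: aflag_face => //.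
by rewrite rkT dim_act_omega.
Qed.

Lemma adjacent_refl u i : affine u -> (i <= n)%N ->
  adjacent (aflag u) (aflag (amul u (refl m i))).
Proof.
move=> au i_n; have aur := affine_mul au (refl_affine m i).
have h v v' : affine v -> affine v' ->
    (forall j, (j <= n)%N -> i != j -> act v (om j) = act v' (om j)) ->
    face (act v (om i)) <> face (act v' (om i)) ->
    aflag v `\` aflag v' = [set face (act v (om i))].
  move=> av av' e ne; apply/seteqP; split=> [F [[->|->|[j jn ->]] nF]|_ ->].
  - by case: nF; apply: Or31.
  - by case: nF; apply: Or32.
  - have [->//|ij] := eqVneq i j; case: nF; rewrite e //.
    by apply: Or33; exists j.
  split; first by apply: Or33; exists i.
  exact: aflag_notin.
split; eexists; apply: h => //.
- by move=> j jn ij; rewrite aflag_refl_face.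
- exact: refl_face_neq.
- by move=> j jn ij; rewrite aflag_refl_face.
- by move=> e; exact: (refl_face_neq au i_n (esym e)).
Qed.

(** Once the flags are aligned, the map [x] between their lifts fixes the cells they share, and
    [affine_ind] writes it with reflections fixing these cells. Multiplying on the right by a
    reflection passes to an adjacent flag, and [A w] keeps the shared faces all along. *)
Lemma toroid_sfc : strongly_flag_connected T.
Proof.
move=> _ _ /aflagP[u au ->] /aflagP[v av ->].
pose J j := `[< face (act u (om j)) = face (act v (om j)) >].
have [|v' [av' ev' _ ev]] := @align J u v au av; first by move=> j jn /asboolP.
pose A (w : aff n) : set T := [set F | [\/ F = \bot%O, F = \top%O |
   exists2 j, (j <= n)%N && J j & F = face (act w (om j))]].
suff path (x : aff n) : affine x -> (forall j, (j <= n)%N -> J j -> act x (om j) = om j) ->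
    forall w : aff n, affine w -> flag_path (A w) (aflag w) (aflag (amul w x)).
  have := path (amul (ainv u) v') _ _ u au; rewrite amulA mulaV // a1mul ev' => p.
  apply: flag_path_sub (p _ _); last 2 first.
  - by apply: affine_mul => //; exact: affine_inv.
  - by move=> j jn Jj; rewrite act_mul -ev // actK.
  move=> F [uF vF]; case: (uF) => [->|->|[j jn eF]]; [by apply: Or31|by apply: Or32|].
  apply: Or33; exists j => //; rewrite jn /=; apply/asboolP; rewrite eF in vF.
  by apply: (aflag_face cubicB av jn vF); rewrite rkT dim_act_omega.
move=> ax fixx; apply: (@affine_ind m [pred j | (j <= n)%N && J j]
    (fun x => forall w : aff n, affine w -> flag_path (A w) (aflag w) (aflag (amul w x)))
    _ _ x ax) => [w aw||j jn /andP[_ Jj]]; last exact: fixx.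
  rewrite mula1; apply: flag_path_refl; first exact: aflag_flag.
  move=> _ [->|->|[j /andP[jn _] ->]]; [by apply: Or31|by apply: Or32|].
  by apply: Or33; exists j.
move=> y i ay i_n /negP nJi IH w aw; have awr := affine_mul aw (refl_affine m i).
rewrite amulA; apply: flag_path_step (adjacent_refl aw i_n) _.
- exact: aflag_flag.
- move=> _ [->|->|[j /andP[jn _] ->]]; [by apply: Or31|by apply: Or32|].
  by apply: Or33; exists j.
apply: flag_path_sub (IH _ awr) => _ [->|->|[j /andP[jn Jj] ->]];
  [by apply: Or31|by apply: Or32|].
apply: Or33; exists j; first by rewrite jn.
rewrite aflag_refl_face //; apply: contra_notN nJi => /eqP->.
by rewrite inE jn.
Qed.

Definition toroid_polytope : polytope n.+1 :=
  @Polytope n.+1 _ T (@trank _ _ B) (trank_bot B) (trank_lt cubicB)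
    (trank_covers cubicB)
    (graded_flag_card (trank_bot B) (trank_top B) (trank_lt cubicB) (trank_covers cubicB))
    toroid_sfc (toroid_diamond cubicB lat_large).

(** The orientation of a flag; by [aflag_inj] all affine lifts of a flag have the same
    determinant. *)
Definition aflag_sign (Phi : set T) : bool :=
  `[< exists u, [/\ affine u, Phi = aflag u & \det u.2 = -1] >].

Lemma aflag_signE u : affine u -> aflag_sign (aflag u) = (\det u.2 == -1).
Proof.
move=> au; apply/asboolP/eqP => [[v [av e <-]]|d]; last by exists u.
by rewrite (aflag_inj au av e).
Qed.

Lemma aflag_sign_adj (Phi Psi : set T) : flag Phi -> flag Psi -> adjacent Phi Psi ->
  aflag_sign Psi = ~~ aflag_sign Phi.
Proof.
move=> /aflagP[u au ->] /aflagP[v av ->] [[F eF] [G eG]].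
have [uF nvF] : (aflag u `\` aflag v) F by rewrite eF.
have [i i_n eFi] : exists2 i, (i <= n)%N & F = face (act u (om i)).
  by case: uF nvF => [->|->|[i i_n e] _]; [case; apply: Or31|case; apply: Or32|exists i].
have [|[e _]|[_ d]] := one_off au av i_n.
- move=> j jn ji; apply: aflag_face => //; last by rewrite rkT dim_act_omega.
  apply: contrapT => nv.
  have : (aflag u `\` aflag v) (face (act u (om j))) by split=> //; apply: Or33; exists j.
  rewrite eF eFi => /(congr1 (@trank _ _ B)); rewrite !rkT !dim_act_omega // => -[].
  by move/eqP; rewrite (negbTE ji).
- by case: nvF; rewrite e.
rewrite !aflag_signE // d.
by have [->|->] := orth_det au.2.
Qed.

(** Automorphisms preserve adjacency, which is right multiplication by a reflection, so along a
    gallery they act on the left, by the map [v] describing the image of the base flag. *)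
Lemma aut_aflag f v (w : aff n) : automorphism f -> affine v -> affine w ->
  f @` aflag (aid n) = aflag v -> f @` aflag w = aflag (amul v w).
Proof.
move=> af av aw e.
suff h : forall x y : aff n, affine x -> affine y -> f @` aflag x = aflag y ->
    f @` aflag (amul x w) = aflag (amul y w).
  by have := h _ _ (affine_id n) av e; rewrite a1mul.
pose Q (w : aff n) := forall x y : aff n, affine x -> affine y ->
  f @` aflag x = aflag y -> f @` aflag (amul x w) = aflag (amul y w).
suff : Q w by [].
apply: (@affine_ind m pred0 Q _ _ w aw) => //.
  by move=> x y _ _; rewrite !mula1.
move=> w' i aw' i_n _ IH x y ax ay exy; rewrite !amulA.
have axr := affine_mul ax (refl_affine m i).
have ayr := affine_mul ay (refl_affine m i).
apply: IH => //.
have [y' ay' ey'] := aflagP (automorphism_flag af (aflag_flag cubicB axr)).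
have fx := (aflag_map cubicB ax ay af).1 exy.
have fx' := (aflag_map cubicB axr ay' af).1 ey'.
have [|[e' _]|[e' _]] := one_off ay ay' i_n; last by rewrite ey'.
  by move=> j jn ji; rewrite -fx // -fx' // aflag_refl_face // eq_sym.
exfalso; apply: (refl_face_neq ax i_n).
apply: (bij_inj af.1); rewrite fx // fx' //.
by apply: aflag_inj_face => //; rewrite ey'.
Qed.

Lemma aut_affine f : automorphism f ->
  exists2 v, affine v & f @` aflag (aid n) = aflag v.
Proof.
by move=> af; apply/aflagP/automorphism_flag/aflag_flag/affine_id.
Qed.

Lemma aut_face f v z j : automorphism f -> affine v ->
  f @` aflag (aid n) = aflag v -> even_row z -> (j <= n)%N ->
  f (face (z + om j)) = face (act v (z + om j)).
Proof.
move=> af av e ez jn; pose w : aff n := (z, 1%:M).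
have aw : affine w by split=> //; exact: orth1.
have actw x : act w x = z + x by rewrite /act mulmx1.
have := (aflag_map cubicB aw (affine_mul av aw) af).1 (aut_aflag af av aw e) j jn.
by rewrite act_mul actw.
Qed.

(** Regularity provides an automorphism acting as [M] around the vertex 0. The vertices 0 and [2 t]
    are the same face, so their images 0 and [2 t M] differ by a lattice translation too. *)
Lemma regular_invariant : regular T -> forall t (M : 'M[int]_n), L t -> orth M -> L (t *m M).
Proof.
move=> regT t M Lt oM; have av : affine (0, M) by split=> // i; rewrite mxE.
have a1 := affine_id n.
have [f af /esym e] := regT _ _ (aflag_flag cubicB a1) (aflag_flag cubicB av).
have om0 : om 0 = 0 by apply/rowP => i; rewrite !mxE.
have e0 : even_row (0 : 'rV[int]_n) by move=> i; rewrite mxE.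
have := aut_face af av e e0 (leq0n n).
have := aut_face af av e (even_double t) (leq0n n).
rewrite om0 !addr0 -[2 *: t]add0r face_translate // => ->.
rewrite add0r /act mul0mx !add0r => /(face_eq cubicB)[s Ls].
rewrite -scalemxAl => es; rewrite -[t *m M]opprK; apply: latN.
suff -> : - (t *m M) = s by [].
apply/rowP => i; have /rowP/(_ i) := es; rewrite rowD rowN.
have h2 (x : 'rV[int]_n) : (2 *: x) 0 i = 2 * x 0 i by rewrite mxE.
have z0 : (0 : 'rV[int]_n) 0 i = 0 by rewrite mxE.
by rewrite !h2 z0 /=; lia.
Qed.

End ToroidFlags.

(** * Toroids with large lattices *)

Section SquaredNorm.
Context (n : nat).
Implicit Types (x y t : 'rV[int]_n).

Definition nrm x : int := \sum_k x 0 k ^+ 2.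

Lemma nrmE x : nrm x = (x *m x^T) 0 0.
Proof. by rewrite mxE; apply: eq_bigr => k _; rewrite mxE expr2. Qed.

Lemma nrm_orth x (M : 'M[int]_n) : orth M -> nrm (x *m M) = nrm x.
Proof.
move=> oM; rewrite !nrmE trmx_mul mulmxA -(mulmxA x).
by rewrite oM mulmx1.
Qed.

Lemma nrm_sub x y : nrm (x - y) <= 2 * nrm x + 2 * nrm y.
Proof.
rewrite /nrm !mulr_sumr -big_split; apply: ler_sum => k _.
rewrite rowD rowN; have := sqr_ge0 (x 0 k + y 0 k).
by move: (x 0 k) (y 0 k) => a b; rewrite !expr2 /=; nia.
Qed.

Lemma nrmN x : nrm (- x) = nrm x.
Proof. by apply: eq_bigr => k _; rewrite rowN sqrrN. Qed.

Lemma nrm_coord x k : x 0 k ^+ 2 <= nrm x.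
Proof.
rewrite /nrm (bigD1 k) //= lerDl; apply: sumr_ge0 => l _; exact: sqr_ge0.
Qed.

(** Its entries are positive and distinct, so no signed permutation other than the identity fixes
    it. *)
Definition ramp : 'rV[int]_n := \row_k k.+1%:Z.

Lemma orth_ramp (M : 'M[int]_n) : orth M -> ramp *m M = ramp -> M = 1%:M.
Proof.
move=> /orth_perm[s [e [es sE]]] /int_rowP h.
have hk k : e k = 1 /\ s k = k.
  have := h k; rewrite sE !mxE; case: (es k) => ->; last by lia.
  by move=> eq; split=> //; apply: val_inj => /=; lia.
apply/row_matrixP => k; rewrite !rowE; apply/int_rowP => l.
by rewrite sE mulmx1; have [-> ->] := hk l; rewrite mul1r.
Qed.

End SquaredNorm.

(** * Three cubes in general position *)

Section LargeToroid.
Context (R : realType) (m : nat) (B : 'M[R]_m.+1).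
Local Notation n := m.+1.
Local Notation T := (toroid B).
Local Notation face := (face B).
Local Notation L := (lat B).
Local Notation om := (omega n n).
Hypothesis cubicB : cubic_lattice B.
Hypothesis m_gt0 : (0 < m)%N.
Hypothesis regT : regular T.
(** The factor 4 comes from [nrm_sub]: the difference of two vectors of squared norm at most
    [nrm (ramp n)] is still too short to be a nonzero lattice vector. *)
Hypothesis lat_big : forall t, L t -> t != 0 -> 4 * nrm (ramp n) < nrm t.
Implicit Types (x y z t : 'rV[int]_n) (k : 'I_n).

Lemma lat_eq0 t : L t -> nrm t <= 4 * nrm (ramp n) -> t = 0.
Proof. by move=> Lt le; apply/eqP; apply: contraTT le => /(lat_big Lt); rewrite -ltNge. Qed.

Lemma nrm_ge0 x : 0 <= nrm x.
Proof. by apply: sumr_ge0 => k _; exact: sqr_ge0. Qed.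

Lemma lat_large t : L t -> (forall k, `|t 0 k| <= 1) -> t = 0.
Proof.
move=> Lt small; apply: lat_eq0 => //.
have : nrm t <= nrm (ramp n).
  apply: ler_sum => k _; rewrite [ramp _ _ _]mxE; have := small k.
  move: (t 0 k) (k : nat) => a j; rewrite !expr2; nia.
have := nrm_ge0 (ramp n); lia.
Qed.

Let e0 : 'rV[int]_n := delta_mx 0 ord0.

(** With [N = nrm (ramp n)], the squared distances between 0, [e0] and the ramp are 1, [N - 1] and
    [N]. A second coordinate exists by [m_gt0], so [N] differs from 1. *)
Lemma nrm_ramp : nrm (ramp n) = 1 + nrm (ramp n - e0) /\ 0 < nrm (ramp n - e0).
Proof.
have e0E k : e0 0 k = (k == ord0)%:R by rewrite mxE.
have rE k : ramp n 0 k = k.+1%:Z by rewrite mxE.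
rewrite /nrm (bigD1 ord0) //= [\sum_k (ramp n - e0) 0 k ^+ 2](bigD1 ord0) //=.
have e : \sum_(k | k != ord0) (ramp n - e0) 0 k ^+ 2 = \sum_(k | k != ord0) ramp n 0 k ^+ 2.
  by apply: eq_bigr => k /negbTE k0; rewrite rowD rowN e0E k0 subr0.
rewrite e rowD rowN !rE e0E eqxx subrr expr0n add0r /= expr1n; split=> //.
rewrite (bigD1 (ord_max : 'I_n)) /=; last by rewrite -val_eqE /=; lia.
have h : 0 <= \sum_(k < n | (k != ord0) && (k != ord_max)) ramp n 0 k ^+ 2.
  by apply: sumr_ge0 => k _; exact: sqr_ge0.
by apply: ltr_wpDr => //; rewrite rE exprn_gt0.
Qed.

Lemma nrm_e0 : nrm e0 = 1.
Proof.
rewrite /nrm (bigD1 ord0) //= mxE !eqxx expr1n big1 ?addr0 // => k /negbTE k0.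
by rewrite mxE k0 andbF.
Qed.

Let center x := face (2 *: x + om).

Lemma center_eq x y : center x = center y -> exists2 t, L t & x + t = y.
Proof.
move=> /(face_eq cubicB)[t Lt e]; exists t => //; apply/int_rowP => k.
have /int_rowP/(_ k) := e; rewrite !rowD.
have h2 z : (2 *: z) 0 k = 2 * z 0 k by rewrite mxE.
by rewrite !h2; lia.
Qed.

(** The linear part of [f] maps one difference to the other up to a lattice vector. This vector is
    the difference of two vectors no longer than the ramp, hence 0. *)
Lemma center_aut f v x y x' y' : automorphism f -> affine v ->
  f @` @aflag R m B (aid n) = @aflag R m B v ->
  nrm (y - x) <= nrm (ramp n) -> nrm (y' - x') <= nrm (ramp n) ->
  f (center x) = center x' -> f (center y) = center y' -> (y - x) *m v.2 = y' - x'.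
Proof.
move=> af av ev nxy nxy'.
rewrite /center !(aut_face cubicB lat_large af av ev (even_double _) (leqnn n)).
move=> /(face_eq cubicB)[s Ls es] /(face_eq cubicB)[t Lt et].
have e : (y - x) *m v.2 + (t - s) = y' - x'.
  apply/int_rowP => k; have /int_rowP/(_ k) := es; have /int_rowP/(_ k) := et.
  have h2 z : (2 *: z) 0 k = 2 * z 0 k by rewrite mxE.
  rewrite /act !mulmxDl mulNmx -!scalemxAl !rowD !rowN !h2.
  by set Y : 'rV[int]_n := y *m _; set X : 'rV[int]_n := x *m _; lia.
rewrite -[LHS]addr0 -e; congr (_ + _); apply/esym/lat_eq0; first exact: latB.
have -> : t - s = (y' - x') - (y - x) *m v.2 by rewrite -e [RHS]addrC addKr.
apply: le_trans (nrm_sub _ _) _; rewrite nrm_orth; last exact: av.2.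
by lia.
Qed.

Lemma center_neq x y : x != y -> nrm (y - x) <= nrm (ramp n) -> center x != center y.
Proof.
move=> ne le; apply/eqP => /center_eq[t Lt e]; case/eqP: ne.
suff t0 : t = 0 by rewrite -e t0 addr0.
apply: lat_eq0 => //; have -> : t = y - x by rewrite -e [RHS]addrC addKr.
by have := nrm_ge0 (ramp n); lia.
Qed.

Lemma dim_center x : dim (2 *: x + om) = n.
Proof. by rewrite addrC dim_translate dim_omega. Qed.

Theorem large_toroid_chiral : exists P : polytope n.+2, chiral P /\
  forall F : P, facet F -> isomorphic (Defs.section \bot%O F) T.
Proof.
have [N1 N0] := nrm_ramp; have Ne := nrm_e0.
have facet_center x : @facet _ (toroid_polytope cubicB lat_large) (center x).
  by rewrite /facet /rank /= (trank_face cubicB) dim_center; lia.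
have n0 : nrm (0 : 'rV[int]_n) = 0 by rewrite /nrm big1 // => k _; rewrite mxE.
have sub0 x : x - 0 = x by rewrite subr0.
have nle : nrm e0 <= nrm (ramp n) by lia.
have nlr : nrm (ramp n - e0) <= nrm (ramp n) by lia.
have nr0 : nrm (0 - ramp n) = nrm (ramp n) by rewrite sub0r nrmN.
have diff f x y x' y' : automorphism f -> nrm (y - x) <= nrm (ramp n) ->
    nrm (y' - x') <= nrm (ramp n) ->
    f (center x) = center x' -> f (center y) = center y' -> nrm (y - x) = nrm (y' - x').
  move=> af h h' e e'; have [v av ev] := aut_affine cubicB lat_large af.
  by rewrite -(center_aut af av ev h h' e e') nrm_orth //; exact: av.2.
(* An automorphism fixing [center 0] and [center (ramp n)] has linear part fixing the ramp, hence
   the identity, and preserves orientation. Neither of these cubes is as far from [center e0] as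
   they are from each other, which gives the two remaining conditions. *)
apply: (@chiral_extension _ (toroid_polytope cubicB lat_large) (@aflag_sign R m B) _ regT
  (center 0) (center e0) (center (ramp n))) => //.
- by move=> Phi Psi; exact: (aflag_sign_adj cubicB lat_large).
- apply: center_neq; rewrite ?sub0 //; apply/eqP => /(congr1 (@nrm n)); rewrite Ne n0; lia.
- apply: center_neq; rewrite ?sub0 //; apply/eqP => /(congr1 (@nrm n)); rewrite N1 n0; lia.
- by apply: center_neq => //; apply/eqP => /(congr1 (@nrm n)); rewrite Ne N1; lia.
- move=> f Phi af /(aflagP cubicB lat_large)[w aw ->] e0f erf.
  have [v av ev] := aut_affine cubicB lat_large af.
  rewrite (aut_aflag cubicB lat_large af av aw ev) !(aflag_signE cubicB lat_large) //; last exact: affine_mul.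
  have : (ramp n - 0) *m v.2 = ramp n - 0 by apply: center_aut ev _ _ e0f erf; rewrite ?sub0.
  by rewrite sub0 /= => /(orth_ramp av.2) ->; rewrite mulmx1.
- move=> f af; rewrite !inE => -[/orP[]/eqP e /orP[]/eqP e'].
  + have /(bij_inj af.1)/eqP : f (center 0) = f (center e0) by rewrite e e'.
    apply/negP/center_neq; rewrite ?sub0 //; apply/eqP => /(congr1 (@nrm n)); rewrite Ne n0; lia.
  + by have := diff f _ _ _ _ af _ _ e e'; rewrite !sub0 Ne => /(_ _ _); lia.
  + by have := diff f _ _ _ _ af _ _ e e'; rewrite sub0 nr0 Ne => /(_ _ _); lia.
  + have /(bij_inj af.1)/eqP : f (center 0) = f (center e0) by rewrite e e'.
    apply/negP/center_neq; rewrite ?sub0 //; apply/eqP => /(congr1 (@nrm n)); rewrite Ne n0; lia.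
- move=> f af; rewrite !inE => -[/orP[]/eqP e /orP[]/eqP e'].
  + have /(bij_inj af.1)/eqP : f (center e0) = f (center (ramp n)) by rewrite e e'.
    by apply/negP/center_neq => //; apply/eqP => /(congr1 (@nrm n)); rewrite Ne N1; lia.
  + by have := diff f _ _ _ _ af _ _ e e'; rewrite !sub0 => /(_ _ _); lia.
  + by have := diff f _ _ _ _ af _ _ e e'; rewrite nr0 => /(_ _ _); lia.
  + have /(bij_inj af.1)/eqP : f (center e0) = f (center (ramp n)) by rewrite e e'.
    by apply/negP/center_neq => //; apply/eqP => /(congr1 (@nrm n)); rewrite Ne N1; lia.
Qed.

End LargeToroid.

Section LatticeTransport.
Context (R : realType) (n : nat).
Implicit Types B C : 'M[R]_n.

Lemma lattice_orbit_eq B C : lattice B = lattice C ->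
  lattice_orbit B = lattice_orbit C.
Proof. by move=> e; apply/funext => X; rewrite /lattice_orbit e. Qed.

Lemma toroid_transport_subproof B C (O : toroid B) :
  lattice_orbit B = lattice_orbit C ->
  val O \in lattice_orbit C @` tessellation.
Proof. by move=> <-; exact: valP O. Qed.

Lemma isomorphic_lattice B C : lattice B = lattice C ->
  isomorphic (toroid B) (toroid C).
Proof.
move=> /lattice_orbit_eq e.
pose f (O : toroid B) : toroid C := exist _ (val O) (toroid_transport_subproof O e).
pose g (O : toroid C) : toroid B := exist _ (val O) (toroid_transport_subproof O (esym e)).
exists f; split; first by exists g => O; apply: val_inj.
by move=> O O'.
Qed.

End LatticeTransport.

(** * The finitely many exceptional lattices *)

Section Dichotomy.
Context (R : realType) (m : nat).
Local Notation n := m.+1.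
Implicit Types (B C : 'M[R]_n) (t : 'rV[int]_n) (k l : 'I_n).

(** An integer is bounded in absolute value by its square, so the entries of a short vector are at
    most [radius]. Twice any nonzero one then divides [modulus], whatever the lattice. *)
Definition radius : nat := absz (4 * nrm (ramp n)).
Definition modulus : nat := (2 * radius`!)%N.

Definition dense_lattice B := forall k, lat B (modulus%:Z *: delta_mx 0 k).

Lemma modulus_gt0 : (0 < modulus)%N.
Proof. by rewrite /modulus muln_gt0 fact_gt0. Qed.

Lemma lat_mul B t (c : nat) : lat B t -> lat B (c%:Z *: t).
Proof.
move=> Lt; elim: c => [|c IH]; first by rewrite scale0r; exact: lat0.
by rewrite intS scalerDl scale1r; apply: latD.
Qed.

Lemma lat_sum B (I : finType) (f : I -> 'rV[int]_n) :
  (forall i, lat B (f i)) -> lat B (\sum_i f i).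
Proof.
by move=> h; apply: (big_ind (lat B)) => //; [exact: lat0 | move=> x y; exact: latD].
Qed.

Lemma lat_scale B t (c : int) : lat B t -> lat B (c *: t).
Proof.
move=> Lt; case: c => c; first exact: lat_mul.
by rewrite NegzE scaleNr; apply/latN/lat_mul.
Qed.

(** Subtracting from [t] its image under a sign change isolates [2 t_k] times a basis vector, a
    transposition moves it to any direction, and [2 t_k] divides [modulus]. *)
Lemma coord_dense B t k : lat B t ->
  (forall (s : 'rV[int]_n) (M : 'M[int]_n), lat B s -> orth M -> lat B (s *m M)) ->
  t 0 k != 0 -> (absz (t 0%R k) <= radius)%N -> dense_lattice B.
Proof.
move=> Lt inv tk le l.
have Lk : lat B ((2 * t 0 k) *: delta_mx 0 k).
  have := latB Lt (inv t _ Lt (flip_orth k)).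
  suff -> : t - t *m flip k = (2 * t 0 k) *: delta_mx 0 k by [].
  apply/int_rowP => i; rewrite rowD rowN mul_flip [RHS]mxE [delta_mx _ _ _ _]mxE /=.
  by case: eqVneq => [->|_] /=; lia.
have Ll : lat B ((2 * t 0 k) *: delta_mx 0 l).
  have := inv _ _ Lk (tperm_orth k l); rewrite -scalemxAl.
  suff -> : delta_mx 0 k *m tperm_mx k l = delta_mx 0 l :> 'rV[int]_n by [].
  rewrite -xcolE; apply/int_rowP => i; rewrite !mxE /=; congr (_%:R).
  by case: tpermP => [->|->|/eqP ik /eqP il]; rewrite ?eqxx // ?(negbTE ik) ?(negbTE il) // eq_sym.
have /dvdnP[q eq] : (absz (t 0%R k) %| radius`!)%N by apply: dvdn_fact; rewrite absz_gt0 tk.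
have := lat_scale (sgz (t 0 k) * q%:Z) Ll; rewrite scalerA.
suff -> : sgz (t 0 k) * q%:Z * (2 * t 0 k) = modulus%:Z by [].
by rewrite /modulus eq PoszM PoszM abszEsg; ring.
Qed.

Lemma dense_or_chiral B : (0 < m)%N -> cubic_lattice B -> regular (toroid B) ->
  dense_lattice B \/ exists P : polytope n.+2, chiral P /\
    forall F : P, facet F -> isomorphic (Defs.section \bot%O F) (toroid B).
Proof.
move=> m0 cB regT.
have [[t [Lt t0 st]]|none] :=
    pselect (exists t, [/\ lat B t, t != 0 & forall k, `|t 0 k| <= 1]).
  left=> k; have := lat_scale (radius`!)%:Z (regular_short cB regT Lt t0 st k).
  by rewrite scalerA /modulus PoszM mulrC.
have large t : lat B t -> (forall k, `|t 0 k| <= 1) -> t = 0.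
  move=> Lt st; apply/eqP; apply: contraT => t0.
  by case: none; exists t.
have [[t [Lt t0 nt]]|none'] :=
    pselect (exists t, [/\ lat B t, t != 0 & nrm t <= 4 * nrm (ramp n)]).
  left; have [k tk] : exists k, t 0 k != 0.
    apply/existsP; apply: contra_neqT t0 => /existsPn h; apply/rowP => i.
    by rewrite mxE; have := h i; rewrite negbK => /eqP.
  apply: (coord_dense Lt (regular_invariant cB large regT) tk).
  have := le_trans (nrm_coord t k) nt; rewrite /radius.
  by move: (t 0 k) (nrm _) tk => a b; rewrite expr2; nia.
right; apply: large_toroid_chiral => // t Lt t0; rewrite ltNge; apply/negP => nt.
by apply: none'; exists t.
Qed.

(** A dense lattice is a union of classes modulo [modulus], so this finite datum determines it. *)
Definition residues B : {set {ffun 'I_n -> 'I_modulus}} :=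
  [set r : {ffun 'I_n -> 'I_modulus} | `[< lat B (\row_k (r k : nat)%:Z) >]]%SET.

Lemma dense_residue B t : dense_lattice B ->
  lat B t <-> lat B (\row_k modz (t 0 k) modulus%:Z).
Proof.
move=> dB; pose q := \sum_k divz (t 0 k) modulus%:Z *: (modulus%:Z *: delta_mx 0 k : 'rV[int]_n).
have Lq : lat B q by apply: lat_sum => k; apply: lat_scale.
have e : t = \row_k modz (t 0 k) modulus%:Z + q.
  apply/rowP => k; rewrite !mxE /q summxE (bigD1 k) //= big1 => [|i ik].
    by rewrite !mxE !eqxx mulr1 addr0 addrC -divz_eq.
  by rewrite !mxE eq_sym (negbTE ik) !mulr0.
split=> [Lt|Lr]; last by rewrite e; apply: latD.
have -> : \row_k modz (t 0 k) modulus%:Z = t - q by rewrite {2}e addrK.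
exact: latB.
Qed.

Lemma residues_lattice B C : cubic_lattice B -> cubic_lattice C ->
  dense_lattice B -> dense_lattice C -> residues B = residues C ->
  lattice B = lattice C.
Proof.
suff sub X Y : cubic_lattice X -> dense_lattice X -> dense_lattice Y ->
    residues X = residues Y -> lattice X `<=` lattice Y.
  by move=> cB cC dB dC e; apply/seteqP; split; apply: sub.
move=> cX dX dY e s Xs; have [t et] := lattice_int cX Xs.
rewrite {}et in Xs *; apply/(dense_residue t dY).
have /(dense_residue t dX) := Xs.
have lt k : (absz (modz (t 0%R k) modulus%:Z) < modulus)%N.
  have := modulus_gt0; move: (t 0 k) modulus => a p p0.
  by have := modz_ge0 a (_ : p%:Z != 0); have := ltz_pmod a (_ : 0 < p%:Z); lia.
pose r := [ffun k => Ordinal (lt k)].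
have er : \row_k modz (t 0 k) modulus%:Z = \row_k (r k : nat)%:Z.
  apply/rowP => k; rewrite !mxE ffunE /= gez0_abs // modz_ge0 //.
  by have := modulus_gt0; lia.
rewrite er => Xr; have : r \in residues X by rewrite inE; apply/asboolP.
by rewrite e inE => /asboolP.
Qed.

End Dichotomy.

Theorem theorem1p1 (R : realType) (n : nat) (hn : (2 <= n)%N) :
  exists E : seq 'M[R]_n,
    forall B : 'M[R]_n, cubic_lattice B -> regular (toroid B) ->
      (forall C, C \in E -> ~ isomorphic (toroid B) (toroid C)) ->
      exists P : polytope n.+2, chiral P /\
        forall F : P, facet F -> isomorphic (section \bot%O F) (toroid B).
Proof.
case: n hn => [//|m] m_gt0.
pose good (B : 'M[R]_m.+1) := cubic_lattice B /\ dense_lattice B.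
(* One lattice is chosen for each set of residues; the default 0 is taken for the sets that come
   from no dense cubic lattice. *)
pose rep K : 'M[R]_m.+1 :=
  if pselect (exists B, good B /\ residues B = K) is left e then projT1 (cid e) else 0.
exists [seq rep K | K <- enum {set {ffun 'I_m.+1 -> 'I_(modulus m)}}] => B cB regT notE.
have [dB|//] := dense_or_chiral m_gt0 cB regT.
have [[cC dC] eC] : good (rep (residues B)) /\ residues (rep (residues B)) = residues B.
  by rewrite /rep; case: pselect => [e|[]]; [case: cid | exists B].
case: (notE (rep (residues B))); first by apply: map_f; rewrite mem_enum.
exact/isomorphic_lattice/residues_lattice.
Qed.
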